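(* Let $L$ be a set of $n$ distinct lines in the plane labelled $1,\dots,n$, and let $G$ be any $n$-vertex planar graph. Then there exists a vertex labelling $\pi$ of $G$ such that $L$ supports $G$ with vertex labelling $\pi$; that is, $G$ has a straight-line crossing-free drawing in which each vertex of $G$ lies on a distinct line of $L$.
   Context: A straight-line crossing-free drawing of a graph maps its vertices to distinct points of the plane and each edge to the closed segment between its endpoints, such that no edge contains a vertex other than its endpoints and no two edges intersect except at a common endpoint. A vertex labelling of an $n$-vertex graph $G=(V,E)$ is a bijection $\pi:V\to\{1,\dots,n\}$. A set of $n$ lines labelled $1,\dots,n$ supports $G$ with vertex labelling $\pi$ if there is a straight-line crossing-free drawing of $G$ in which, for each $i$, the vertex $\pi^{-1}(i)$ is placed on line $i$. *)

(* Defs.v *)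
From Stdlib Require Import Reals Lra Lia.
Open Scope R_scope.

Definition point := (R * R)%type.

Record line := mkLine { la : R; lb : R; lc : R; l_nondeg : la <> 0 \/ lb <> 0 }.

Definition on_line (l : line) (p : point) : Prop :=
  la l * fst p + lb l * snd p = lc l.

Definition same_line (l1 l2 : line) : Prop :=
  forall p, on_line l1 p <-> on_line l2 p.

Definition simple_graph (n : nat) (E : nat -> nat -> Prop) : Prop :=
  (forall u v, E u v -> (u < n)%nat /\ (v < n)%nat) /\
  (forall u v, E u v -> E v u) /\
  (forall u, ~ E u u).

Definition on_segment (p q r : point) : Prop :=
  exists t, 0 <= t <= 1 /\
    fst r = fst p + t * (fst q - fst p) /\ snd r = snd p + t * (snd q - snd p).

Definition same_edge (u v x y : nat) : Prop :=
  (u = x /\ v = y) \/ (u = y /\ v = x).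

Definition straight_line_drawing (n : nat) (E : nat -> nat -> Prop)
    (pos : nat -> point) : Prop :=
  (forall u v, (u < n)%nat -> (v < n)%nat -> pos u = pos v -> u = v) /\
  (forall u v w, E u v -> (w < n)%nat -> w <> u -> w <> v ->
     ~ on_segment (pos u) (pos v) (pos w)) /\
  (forall u v x y r, E u v -> E x y -> ~ same_edge u v x y ->
     on_segment (pos u) (pos v) r -> on_segment (pos x) (pos y) r ->
     exists w, (w = u \/ w = v) /\ (w = x \/ w = y) /\ r = pos w).

Definition continuous_on_01 (g : R -> point) : Prop :=
  forall t, 0 <= t <= 1 -> forall eps, 0 < eps -> exists delta, 0 < delta /\
    forall s, 0 <= s <= 1 -> Rabs (s - t) < delta ->
      Rabs (fst (g s) - fst (g t)) < eps /\ Rabs (snd (g s) - snd (g t)) < eps.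

Definition on_arc (g : R -> point) (r : point) : Prop :=
  exists t, 0 <= t <= 1 /\ g t = r.

Definition planar (n : nat) (E : nat -> nat -> Prop) : Prop :=
  exists (pos : nat -> point) (arc : nat -> nat -> R -> point),
    (forall u v, (u < n)%nat -> (v < n)%nat -> pos u = pos v -> u = v) /\
    (forall u v, E u v ->
       continuous_on_01 (arc u v) /\
       (forall s t, 0 <= s <= 1 -> 0 <= t <= 1 -> arc u v s = arc u v t -> s = t) /\
       arc u v 0 = pos u /\ arc u v 1 = pos v) /\
    (forall u v w, E u v -> (w < n)%nat -> w <> u -> w <> v ->
       ~ on_arc (arc u v) (pos w)) /\
    (forall u v x y r, E u v -> E x y -> ~ same_edge u v x y ->
       on_arc (arc u v) r -> on_arc (arc x y) r ->
       exists w, (w = u \/ w = v) /\ (w = x \/ w = y) /\ r = pos w).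

Definition vertex_labelling (n : nat) (pi : nat -> nat) : Prop :=
  (forall v, (v < n)%nat -> (1 <= pi v <= n)%nat) /\
  (forall u v, (u < n)%nat -> (v < n)%nat -> pi u = pi v -> u = v).

Definition supports (n : nat) (L : nat -> line) (E : nat -> nat -> Prop)
    (pi : nat -> nat) : Prop :=
  exists pos : nat -> point,
    straight_line_drawing n E pos /\
    (forall v, (v < n)%nat -> on_line (L (pi v)) (pos v)).

(* Main.v *)
(* A planar drawing is traced on a fine square grid: the vertices become disjoint connected sets of cells, adjacent
   whenever the vertices are, so that the graph is a minor of a grid.  Triangulated discs are handled through their
   homology mod 2: every edge lies in at most two triangles, every cycle bounds, and no nonempty set of triangles is
   closed.  These conditions survive edge contractions (after subdividing edges that would become double), hence the
   graph is contained in a triangulated disc; they also play the role of the Jordan curve theorem and show, by removing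
   boundary vertices and cutting along chords, that the disc can be built vertex by vertex, each new vertex being
   joined to an interval of the current upper boundary (a canonical ordering).

   Such a graph can be drawn with its vertices at any prescribed increasing heights: if the gaps of the upper boundary
   are wide enough, its edges are flat and a new, higher vertex sees them from above.  All the inequalities involved
   are strict, so that a point of height h may slide along a line of small slope through (0, h).  Finally, a transversal
   meeting the lines in distinct points, taken as vertical axis, and a strong horizontal compression turn the given
   lines into lines of small slope. *)
Require Import Defs.
From Stdlib Require Import Reals Lra Lia List Permutation Classical ClassicalEpsilon
  Relation_Operators Operators_Properties.
From Coquelicot Require Import Rcomplements Compactness.
From mathcomp Require all_boot.
Import ListNotations.

(** * Graphs built by stacking *)

(** Since the labelling may be chosen, the vertices take the lines in the order in which these meet
    the transversal, following the canonical ordering; vertices of the disc that represent no vertex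
    of the graph get intermediate heights and need not lie on any given line. The obstacle is that
    [planar] speaks of arbitrary continuous arcs, from which neither faces nor a rotation system can
    be read directly. Sets of grid cells retain only disjointness and adjacency, and the host grid
    is a disc by construction. Homology suits this because no interior has to be defined: the part
    of a disc cut off by a chord is the 2-chain bounded by the resulting cycle. The drawing cannot
    be fixed vertex by vertex, since vertices buried later must lie under flat edges. The abscissae
    of the final upper boundary are therefore chosen first, with large gaps, and those of the buried
    vertices are found by going back through the construction. The compression [e] comes last: how
    small it must be depends on all abscissae. *)

Definition joins {T : Type} (u v a b : T) : Prop := (a = u /\ b = v) \/ (a = v /\ b = u).

(* The second argument lists the placed vertices, most recent first; the first one is the upper boundary of the
   picture, from left to right. *)
Inductive stacked {T : Type} : list T -> list T -> (T -> T -> Prop) -> Prop :=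
| stacked_base a b : a <> b -> stacked [a; b] [b; a] (joins a b)
| stacked_add p1 u w p2 ord E v : ~ In v ord -> stacked (p1 ++ u :: w :: p2) ord E ->
    stacked (p1 ++ u :: v :: w :: p2) (v :: ord) (fun a b => E a b \/ joins v u a b \/ joins v w a b)
| stacked_fill p1 v w0 w1 p2 ord E : stacked (p1 ++ v :: w0 :: w1 :: p2) (v :: ord) E ->
    stacked (p1 ++ v :: w1 :: p2) (v :: ord) (fun a b => E a b \/ joins v w1 a b).

Lemma joins_sym {T : Type} (u v a b : T) : joins u v a b -> joins u v b a.
Proof. unfold joins; tauto. Qed.

Lemma stacked_sym {T : Type} (p ord : list T) E : stacked p ord E -> forall a b, E a b -> E b a.
Proof.
induction 1 as [a b ne|p1 u w p2 ord E v nv st IH|p1 v w0 w1 p2 ord E st IH]; intros c d H.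
- now apply joins_sym.
- destruct H as [H|[H|H]]; [left|right; left|right; right]; auto using joins_sym.
- destruct H as [H|H]; [left|right]; auto using joins_sym.
Qed.

Lemma stacked_mem {T : Type} (p ord : list T) E : stacked p ord E ->
  (forall a, In a p -> In a ord) /\ (forall a b, E a b -> In a ord).
Proof.
induction 1 as [a b ne|p1 u w p2 ord E v nv st [IH1 IH2]|p1 v w0 w1 p2 ord E st [IH1 IH2]];
  split; unfold joins in *.
- simpl; tauto.
- simpl; intuition congruence.
- intros c H; rewrite in_app_iff in *; simpl in *.
  destruct H as [H|[H|[H|[H|H]]]]; auto; right; apply IH1; rewrite in_app_iff; simpl; auto.
- intros c d [H|[[[H _]|[H _]]|[[H _]|[H _]]]]; subst; simpl; eauto;
  right; apply IH1; rewrite in_app_iff; simpl; auto.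
- intros c H; apply IH1; rewrite in_app_iff in *; simpl in *; tauto.
- intros c d [H|[[H _]|[H _]]]; subst; eauto; apply IH1; rewrite in_app_iff; simpl; auto.
Qed.

Definition adj4 (a b : nat * nat) : Prop :=
  (fst a = fst b /\ (snd b = S (snd a) \/ snd a = S (snd b))) \/
  (snd a = snd b /\ (fst b = S (fst a) \/ fst a = S (fst b))).

(** * Triangulated discs *)

Module Discs.
Import all_boot.
Set Implicit Arguments.
Unset Strict Implicit.
Unset Printing Implicit Defensive.
Local Open Scope nat_scope.

(** * Edges and paths as 1-chains mod 2 *)

Definition edge (T : eqType) (u v a b : T) : bool :=
  ((a == u) && (b == v)) || ((a == v) && (b == u)).

(** The 1-chain of a path, as a sum mod 2: an edge traversed twice cancels, and statements about
    boundaries become boolean identities. *)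
Fixpoint chain (T : eqType) (p : seq T) (a b : T) : bool :=
  match p with
  | u :: (v :: _) as q => edge u v a b (+) chain q a b
  | _ => false
  end.

Section EdgeTheory.
Variable T : eqType.
Implicit Types (a b c u v w : T) (p q : seq T).

Lemma edgeC u v a b : edge u v a b = edge u v b a.
Proof. by rewrite /edge orbC [in LHS]andbC [X in _ || X]andbC. Qed.

Lemma edge_sym u v a b : edge u v a b = edge v u a b.
Proof. by rewrite /edge orbC. Qed.

Lemma edge_refl u v : edge u v u v.
Proof. by rewrite /edge !eqxx. Qed.

Lemma edgeP u v a b : reflect ((a = u /\ b = v) \/ (a = v /\ b = u)) (edge u v a b).
Proof.
apply: (iffP orP) => -[].
- by case/andP=> /eqP-> /eqP->; left.
- by case/andP=> /eqP-> /eqP->; right.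
- by case=> -> ->; rewrite !eqxx; left.
- by case=> -> ->; rewrite !eqxx; right.
Qed.

Lemma edge_diag u v a : u != v -> edge u v a a = false.
Proof. by move=> uv; apply/edgeP => -[[-> E]|[-> E]]; move: uv; rewrite E eqxx. Qed.

Lemma chainC p a b : chain p a b = chain p b a.
Proof. by elim: p => [|u [|v q] IH] //=; rewrite edgeC; congr (_ (+) _). Qed.

Lemma chain_cons u v q a b : chain (u :: v :: q) a b = edge u v a b (+) chain (v :: q) a b.
Proof. by []. Qed.

Lemma chain_mem p a b : chain p a b -> (a \in p) && (b \in p).
Proof.
elim: p => [|u [|v q] IH] //.
rewrite chain_cons; case E: (edge u v a b) => /=.
  move/edgeP: E => [[-> ->]|[-> ->]] _; by rewrite !inE !eqxx ?orbT.
by move/IH => /andP[Ha Hb]; rewrite inE Ha orbT inE Hb orbT.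
Qed.

Lemma chain_notin p a b : a \notin p -> chain p a b = false.
Proof. by move=> H; apply/negP => /chain_mem /andP[Ha _]; rewrite Ha in H. Qed.

Lemma chain_notin2 p a b : b \notin p -> chain p a b = false.
Proof. by rewrite chainC; exact: chain_notin. Qed.

Lemma chain_cat p1 u p2 a b :
  chain (p1 ++ u :: p2) a b = chain (rcons p1 u) a b (+) chain (u :: p2) a b.
Proof.
elim: p1 => [|c [|d p1] IH] //.
  by rewrite /= addbF.
rewrite !rcons_cons !cat_cons in IH *.
by rewrite !chain_cons IH addbA.
Qed.

Lemma chain_path (r : rel T) u q a b :
  path r u q -> chain (u :: q) a b -> r a b || r b a.
Proof.
elim: q u => [|v q IH] u //; rewrite chain_cons.
move=> /= /andP[ruv pq].
case E: (edge u v a b) => /=; last exact: IH.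
by move/edgeP: E => [[-> ->]|[-> ->]] _; rewrite ruv ?orbT.
Qed.

(** Without repetitions no other step of the path can cancel uv, because [v] does not occur before
    this step nor [u] after it. *)
Lemma chain_edge p1 u v p2 : uniq (p1 ++ u :: v :: p2) -> chain (p1 ++ u :: v :: p2) u v.
Proof.
move=> U; rewrite chain_cat chain_cons edge_refl.
move: U; rewrite cat_uniq => /and3P[_ H]; rewrite cons_uniq => /andP[].
rewrite inE negb_or => /andP[uv uP] _.
have H1 : u \notin v :: p2 by rewrite inE negb_or uv.
have H2 : v \notin rcons p1 u.
  rewrite mem_rcons inE negb_or eq_sym uv /=.
  by apply: contra H => /= vp; rewrite vp orbT.
by rewrite (chain_notin2 _ H2) (chain_notin _ H1).
Qed.

End EdgeTheory.

(** * Sums mod 2 over a finite type *)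

Section Sums.
Variable V : finType.
Implicit Types (a b c u v w x y : V) (p q : seq V).

Lemma sumb_eq1 (F : V -> bool) u : (forall v, v != u -> F v = false) ->
  \big[addb/false]_v F v = F u.
Proof. by move=> H; rewrite (bigD1 u) //= big1 ?addbF // => v /H. Qed.

Lemma sumb_pred1 u : \big[addb/false]_v (v == u) = true.
Proof. by rewrite (@sumb_eq1 _ u) ?eqxx // => v /negbTE. Qed.

Lemma sumb_ex (F : V -> bool) : \big[addb/false]_v F v -> exists v, F v.
Proof.
move=> H; apply/existsP; apply/contraT => /existsPn N.
by move: H; rewrite big1 // => v _; apply/negbTE/N.
Qed.

Lemma sumb_edge u v a : u != v ->
  \big[addb/false]_b edge u v a b = (a == u) (+) (a == v).
Proof.
move=> uv; rewrite -[RHS]addbF.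
transitivity (\big[addb/false]_b (((a == u) && (b == v)) (+) ((a == v) && (b == u)))).
  apply: eq_bigr => b _; rewrite /edge.
  by case: (a =P u) => [->|] //=; rewrite (negbTE uv) ?orbF ?addbF.
rewrite big_split /= addbF; congr (_ (+) _).
  by case: (a == u); rewrite /= ?sumb_pred1 ?big1.
by case: (a == v); rewrite /= ?sumb_pred1 ?big1.
Qed.

(** The handshake lemma: every unordered pair is counted twice. An arbitrary enumeration of the
    vertices selects one ordered representative of each pair. *)
Lemma sumb_sym (F : V -> V -> bool) : (forall a b, F a b = F b a) -> (forall a, F a a = false) ->
  \big[addb/false]_a \big[addb/false]_b F a b = false.
Proof.
move=> Fs Fd.
pose lt a b := (enum_rank a < enum_rank b)%N.
have -> : \big[addb/false]_a \big[addb/false]_b F a b =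
  (\big[addb/false]_a \big[addb/false]_b (lt a b && F a b)) (+)
  (\big[addb/false]_a \big[addb/false]_b (lt b a && F a b)).
  rewrite -big_split; apply: eq_bigr => a _; rewrite -big_split; apply: eq_bigr => b _ /=.
  rewrite /lt; case: ltngtP => //= [_|]; first by rewrite addbF.
  by move/ord_inj/enum_rank_inj => ->.
rewrite [X in _ (+) X]exchange_big /=.
rewrite [X in _ (+) X](_ : _ = \big[addb/false]_a \big[addb/false]_b (lt a b && F a b)) ?addbb //.
by apply: eq_bigr => a _; apply: eq_bigr => b _; rewrite Fs.
Qed.

(** The boundary of a path is the sum of its two ends. Vertices may repeat, provided consecutive
    ones differ. *)
Lemma sumb_chain u q a : path (fun c d => c != d) u q ->
  \big[addb/false]_b chain (u :: q) a b = (a == u) (+) (a == last u q).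
Proof.
elim: q u => [|v q IH] u; first by rewrite /= big1 // addbb.
move=> /= /andP[uv pq]; rewrite big_split /= sumb_edge // IH //.
by rewrite -addbA addKb.
Qed.

Lemma uniq_path_neq u q : uniq (u :: q) -> path (fun c d : V => c != d) u q.
Proof.
elim: q u => [|v q IH] u //= /andP[]; rewrite inE negb_or => /andP[-> _] /=.
exact: IH.
Qed.

End Sums.

(** * Complexes, boundaries and discs *)

Section Complex.
Variable V : finType.
Implicit Types (a b c d u v w x y : V) (p q : seq V) (X Y D S : V -> V -> V -> bool).

(** A 2-chain mod 2. Two transpositions generate all permutations of a triple, so one diagonal
    condition excludes every degenerate triangle. *)
Definition tri X := [/\ forall a b c, X a b c = X b a c,
  forall a b c, X a b c = X a c b & forall a b, X a a b = false].

Definition bd X a b := \big[addb/false]_c X a b c.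

(** The 1-skeleton. The base edge is added separately because a disc without triangles still has
    it. *)
Definition gr D x y a b := [exists c, D a b c] || edge x y a b.

Definition cyclic (z : V -> V -> bool) := [/\ forall a b, z a b = z b a,
  forall a, z a a = false & forall a, \big[addb/false]_b z a b = false].

(* A complex is the symmetric relation "abc is a triangle"; chains mod 2 are boolean functions.  The boundary of a
   disc is the path x :: q together with the base edge xy; for q = [:: y] they cancel and the disc has no triangle. *)
Record disc D x y q : Prop := Disc {
  d_tri : tri D;
  d_le2 : forall a b c1 c2 c3, D a b c1 -> D a b c2 -> D a b c3 ->
     c1 != c2 -> c1 != c3 -> c2 = c3;
  d_bd : forall a b, bd D a b = chain (x :: q) a b (+) edge x y a b;
  d_uniq : uniq (x :: q);
  d_last : last x q = y;
  d_neq : x != y;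
  d_cyc : forall z, cyclic z -> (forall a b, z a b -> gr D x y a b) ->
     exists X, [/\ tri X, forall a b c, X a b c -> D a b c & forall a b, bd X a b = z a b];
  d_inj : forall X, tri X -> (forall a b c, X a b c -> D a b c) ->
     (forall a b, bd X a b = false) -> forall a b c, X a b c = false }.

Section Tri.
Variables (X : V -> V -> V -> bool) (tX : tri X).

Lemma tri12 a b c : X a b c = X b a c. Proof. by case: tX. Qed.
Lemma tri23 a b c : X a b c = X a c b. Proof. by case: tX. Qed.
Lemma tri13 a b c : X a b c = X c b a. Proof. by rewrite tri12 tri23 tri12. Qed.
Lemma tri_rot a b c : X a b c = X b c a. Proof. by rewrite tri12 tri23. Qed.
Lemma tri_aa a b : X a a b = false. Proof. by case: tX. Qed.
Lemma tri_aba a b : X a b a = false. Proof. by rewrite tri23 tri_aa. Qed.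
Lemma tri_abb a b : X a b b = false. Proof. by rewrite tri12 tri_aba. Qed.

Lemma tri_neq a b c : X a b c -> [/\ a != b, a != c & b != c].
Proof.
move=> H; split; apply: contraTneq H => ->; by rewrite ?tri_aa ?tri_aba ?tri_abb.
Qed.

Lemma bdC a b : bd X a b = bd X b a.
Proof. by apply: eq_bigr => c _; rewrite tri12. Qed.

Lemma bd_diag a : bd X a a = false.
Proof. by rewrite /bd big1 // => c _; rewrite tri_aa. Qed.

(** The boundary of a boundary vanishes, by the handshake lemma in the link of [a]. *)
Lemma bd_bd a : \big[addb/false]_b bd X a b = false.
Proof. by apply: sumb_sym => [b c|b]; rewrite ?tri_abb // tri23. Qed.

Lemma bd_cyclic : cyclic (bd X).
Proof. by split; [exact: bdC|exact: bd_diag|exact: bd_bd]. Qed.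

Lemma bd_ex a b : bd X a b -> exists c, X a b c.
Proof. exact: sumb_ex. Qed.

End Tri.

Lemma eq_bd X Y : (forall a b c, X a b c = Y a b c) -> forall a b, bd X a b = bd Y a b.
Proof. by move=> H a b; apply: eq_bigr => c _. Qed.

Lemma bdD X Y a b : bd (fun a b c => X a b c (+) Y a b c) a b = bd X a b (+) bd Y a b.
Proof. by rewrite /bd big_split. Qed.

Lemma triD X Y : tri X -> tri Y -> tri (fun a b c => X a b c (+) Y a b c).
Proof.
move=> tX tY; split=> [a b c|a b c|a b]; last by rewrite ?(tri_aa tX) ?(tri_aa tY).
  by rewrite (tri12 tX) (tri12 tY).
by rewrite (tri23 tX) (tri23 tY).
Qed.

Lemma triI X Y : tri X -> tri Y -> tri (fun a b c => X a b c && Y a b c).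
Proof.
move=> tX tY; split=> [a b c|a b c|a b]; last by rewrite ?(tri_aa tX) ?(tri_aa tY).
  by rewrite (tri12 tX) (tri12 tY).
by rewrite (tri23 tX) (tri23 tY).
Qed.

Lemma triB X Y : tri X -> tri Y -> tri (fun a b c => X a b c && ~~ Y a b c).
Proof.
move=> tX tY; split=> [a b c|a b c|a b]; last by rewrite ?(tri_aa tX) ?(tri_aa tY).
  by rewrite (tri12 tX) (tri12 tY).
by rewrite (tri23 tX) (tri23 tY).
Qed.

Lemma bdIB X Y a b : bd X a b =
  bd (fun a b c => X a b c && Y a b c) a b (+) bd (fun a b c => X a b c && ~~ Y a b c) a b.
Proof.
rewrite /bd -big_split; apply: eq_bigr => c _ /=.
by case: (X a b c) (Y a b c) => [] [].
Qed.

Lemma cyclicD z1 z2 : cyclic z1 -> cyclic z2 -> cyclic (fun a b => z1 a b (+) z2 a b).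
Proof.
move=> [s1 d1 c1] [s2 d2 c2]; split=> [a b|a|a]; first by rewrite s1 s2.
  by rewrite d1 d2.
by rewrite big_split /= c1 c2.
Qed.

Lemma chain_diag u q a : path (fun c d => c != d) u q -> chain (u :: q) a a = false.
Proof.
elim: q u => [|v q IH] u // /andP[uv pq]; by rewrite chain_cons edge_diag // IH.
Qed.

Lemma cyclic_closed_chain u q v : path (fun c d => c != d) u q -> last u q = v -> u != v ->
  cyclic (fun a b => chain (u :: q) a b (+) edge u v a b).
Proof.
move=> pq lq uv; split=> [a b|a|a]; first by rewrite chainC edgeC.
  by rewrite chain_diag // edge_diag.
by rewrite big_split /= sumb_chain // sumb_edge // lq addbb.
Qed.

Section DiscTheory.
Variables (D : V -> V -> V -> bool) (x y : V) (q : seq V) (HD : disc D x y q).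
Let tD := d_tri HD.

Lemma gr_sym a b : gr D x y a b = gr D x y b a.
Proof.
rewrite /gr edgeC; congr (_ || _).
by apply: eq_existsb => c; rewrite (tri12 tD).
Qed.

Lemma gr_irr a : gr D x y a a = false.
Proof.
rewrite /gr edge_diag ?(d_neq HD) // orbF.
by apply/existsP => -[c]; rewrite (tri_aa tD).
Qed.

Lemma gr_tri a b c : D a b c -> gr D x y a b.
Proof. by move=> H; apply/orP; left; apply/existsP; exists c. Qed.

(** Parity together with the bound of two triangles per edge gives exact counts: a boundary edge
    lies in one triangle and, by [not_bd_other], any other edge lies in none or in two. *)
Lemma bd_unique a b c c' : bd D a b -> D a b c -> D a b c' -> c' = c.
Proof.
move=> B Hc Hc'; apply/eqP/contraT => ne; move: B.
rewrite /bd (bigD1 c) //= (bigD1 c') //= big1 ?Hc ?Hc' // => d /andP[dc dc'].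
apply/negP => Hd; case/negP: dc'; apply/eqP; apply: (d_le2 HD Hc Hd Hc'); by rewrite eq_sym.
Qed.

Lemma not_bd_other a b c : bd D a b = false -> D a b c -> exists2 c', c' != c & D a b c'.
Proof.
move=> B Hc; apply/exists_inP; apply/contraT => /exists_inPn N; move: B.
by rewrite /bd (bigD1 c) //= big1 ?Hc // => d /N/negbTE.
Qed.

Lemma chain_gr a b : chain (x :: q) a b -> gr D x y a b.
Proof.
move=> H; rewrite /gr; case E: (edge x y a b); first by rewrite orbT.
have : bd D a b by rewrite (d_bd HD) H E.
by case/(bd_ex) => c Hc; rewrite orbF; apply/existsP; exists c.
Qed.

Lemma mem_last_q : y \in x :: q.
Proof. by rewrite -(d_last HD) mem_last. Qed.

Lemma bd_mem a b : bd D a b -> (a \in x :: q) && (b \in x :: q).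
Proof.
rewrite (d_bd HD); case E: (edge x y a b); last by rewrite addbF => /chain_mem.
move=> _; by case/edgeP: E => -[-> ->]; rewrite mem_head mem_last_q.
Qed.

End DiscTheory.
End Complex.

(** * Connectedness of vertex links *)

Section Link.
Variable V : finType.
Implicit Types (a b d u v w : V) (X : V -> V -> V -> bool).
Variables (D : V -> V -> V -> bool) (x y : V) (q : seq V) (HD : disc D x y q).
Let tD := d_tri HD.

Lemma boundary_path : path (gr D x y) x q.
Proof.
suff H q2 p1 u : x :: q = p1 ++ u :: q2 -> path (gr D x y) u q2 by exact: (H q [::]).
elim: q2 p1 u => [|v q2 IH] p1 u E //=; apply/andP; split; last first.
  by apply: (IH (rcons p1 u)); rewrite cat_rcons.
by apply: (chain_gr HD); rewrite E; apply: chain_edge; rewrite -E (d_uniq HD).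
Qed.

Variable c : V.
Let r a b := [&& gr D x y a b, a != c & b != c].

Let r_sym : connect_sym r.
Proof.
by apply: sym_connect_sym => a b; rewrite /r (gr_sym HD) [X in _ && X]andbC.
Qed.

Lemma segment_connect h t f g : path (gr D x y) h t -> c \notin h :: t ->
  f \in h :: t -> g \in h :: t -> connect r f g.
Proof.
move=> P C; suff H : {subset h :: t <= connect r h}.
  by move=> /H Hf /H Hg; apply: connect_trans Hg; rewrite r_sym.
apply: path_connect; elim: t h P C => [|k t IH] h //= /andP[hk kt].
rewrite !inE !negb_or => /and3P[ch ck ct].
by rewrite IH // ?inE ?negb_or ?ck // /r hk ![_ == c]eq_sym ch ck.
Qed.

(** Closed up by the base edge, the boundary is a cycle, and a cycle minus one vertex is connected:
    the pieces of the path before and after [c] are joined through xy. *)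
Lemma boundary_connect f g : f \in x :: q -> g \in x :: q -> f != c -> g != c ->
  connect r f g.
Proof.
move=> Hf Hg fc gc; have P := boundary_path.
case Cin: (c \in x :: q); last by apply: segment_connect P _ Hf Hg; rewrite Cin.
have [p1 [p2 E]] : exists p1 p2, x :: q = p1 ++ c :: p2.
  exists (take (index c (x :: q)) (x :: q)), (drop (index c (x :: q)).+1 (x :: q)).
  by rewrite -drop_index // cat_take_drop.
have U := d_uniq HD; have L := d_last HD.
rewrite E in Hf Hg U.
have [P1 P2] : (if p1 is h :: t then path (gr D x y) h t else true) /\
               (if p2 is h :: t then path (gr D x y) h t else true).
  have : path (gr D x y) (head x (p1 ++ c :: p2)) (behead (p1 ++ c :: p2)) by rewrite -E.
  case: (p1) => [|h t] /=; last rewrite cat_path /= => /and3P[-> _].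
    by case: (p2) => [|h t] //= /andP[].
  by case: (p2) => [|h' t'] //= /andP[].
move: U; rewrite cat_uniq => /and3P[_]; rewrite /= negb_or => /andP[C1 _] /andP[C2 _].
have S1 a b : a \in p1 -> b \in p1 -> connect r a b.
  by case: (p1) P1 C1 => [|h t] // P1 C1; apply: segment_connect.
have S2 a b : a \in p2 -> b \in p2 -> connect r a b.
  by case: (p2) P2 C2 => [|h t] // P2 C2; apply: segment_connect.
have S12 a b : a \in p1 -> b \in p2 -> connect r a b.
  move=> Ha Hb.
  have xp1 : x \in p1 by case: (p1) Ha E => [|h t] //= _ [-> _]; rewrite mem_head.
  have yp2 : y \in p2.
    have -> : y = last x (x :: q) by rewrite /= L.
    by rewrite E last_cat /=; case: (p2) Hb => [|h t] //= _; rewrite mem_last.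
  apply: connect_trans (S1 _ _ Ha xp1) (connect_trans (connect1 _) (S2 _ _ yp2 Hb)).
  rewrite /r /gr edge_refl orbT /=; apply/andP; split.
    by apply: contraNneq C1 => <-.
  by apply: contraNneq C2 => <-.
move: Hf Hg; rewrite !mem_cat !inE (negbTE fc) (negbTE gc) /=.
case/orP=> Hf /orP[] Hg; [exact: S1|exact: S12| |exact: S2].
by rewrite r_sym; apply: S12.
Qed.

Lemma path_avoid u s : path r u s -> u != c -> c \notin u :: s.
Proof.
elim: s u => [|b s IH] u /=; first by rewrite inE eq_sym => _ /negbTE->.
by case/andP=> /and3P[_ uc bc] /IH H _; rewrite inE negb_or eq_sym uc H.
Qed.

Lemma connect_avoid u v : connect r u v -> u != c -> v != c.
Proof.
case/connectP=> s Ps -> /(path_avoid Ps) H.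
by apply: contraNneq H => <-; rewrite mem_last.
Qed.

(** If the component of [u] in the complex without [c] missed the boundary, the triangles with a
    vertex in it would form a nonempty 2-chain without boundary: an edge touching the component
    carries the same triangles as in [D], and an edge not touching it carries none of them. *)
Lemma component_meets_boundary u w : D c u w -> exists2 f, f \in x :: q & connect r u f.
Proof.
move=> Du; apply/exists_inP; apply/contraT => /exists_inPn N.
have [cu _ _] := tri_neq tD Du; rewrite eq_sym in cu.
pose S a b d := D a b d && [|| connect r u a, connect r u b | connect r u d].
have tS : tri S.
  split=> [a b d|a b d|a b]; rewrite /S; last by rewrite (tri_aa tD).
    by rewrite (tri12 tD) orbCA.
  by rewrite (tri23 tD); congr (_ && (_ || _)); rewrite orbC.
have bS a b : bd S a b = false.
  case Kab: (connect r u a || connect r u b).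
    rewrite -(_ : bd D a b = bd S a b); last first.
      by apply: eq_bigr => d _; rewrite /S orbA Kab andbT.
    apply: contraTF Kab => /(bd_mem HD) /andP[aq bq].
    by rewrite negb_or !N.
  rewrite /bd big1 // => d _; rewrite /S orbA Kab /=.
  apply/negP => /andP[Dabd Kd].
  have dc := connect_avoid Kd cu.
  have [ab ad bd] := tri_neq tD Dabd.
  case/negP: (negbT Kab); have [ac|ac] := eqVneq a c.
    have bc : b != c by rewrite -ac eq_sym.
    apply/orP; right; apply: connect_trans Kd (connect1 _).
    by rewrite /r dc bc !andbT; apply: (@gr_tri _ _ _ _ _ _ a); rewrite (tri13 tD).
  apply/orP; left; apply: connect_trans Kd (connect1 _).
  by rewrite /r dc ac !andbT; apply: (@gr_tri _ _ _ _ _ _ b); rewrite (tri_rot tD).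
have := d_inj HD tS _ bS c u w; rewrite /S Du connect0 orbT; move=> H.
by have: true = false by apply: H => a b d /andP[].
Qed.

(* The triangles at c form a single fan: a class of them closed under sharing an edge at c is everything.
   Otherwise either some cycle through c meets the class in an odd number of triangles,
   or c cuts off a piece of the complex without boundary. *)
Lemma link_connected (A : V -> V -> bool) u0 w0 :
  (forall u w, A u w -> D c u w) -> (forall u w, A u w = A w u) ->
  (forall u w w', A u w -> D c u w' -> A u w') -> A u0 w0 ->
  forall u w, D c u w -> A u w.
Proof.
move=> AD As Ac A0 u1 w1 D1; apply: contraT => NA1.
have D0 := AD _ _ A0.
have u01 : u0 != u1 by apply: contraNneq NA1 => E; apply: Ac D1; rewrite -E; exact: A0.
have [c0 _ _] := tri_neq tD D0; have [c1 _ _] := tri_neq tD D1.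
have [/connectP[s Ps Ls]|NC] := boolP (connect r u0 u1).
  have Pn : path (fun a b => a != b) u0 s.
    apply: sub_path Ps => a b /and3P[H _ _]; apply: contraTneq H => ->; by rewrite (gr_irr HD).
  have Cs : c \notin u0 :: s by apply: path_avoid Ps _; rewrite eq_sym.
  pose z a b := chain (u0 :: s) a b (+) (edge c u0 a b (+) edge c u1 a b).
  have zc : cyclic z.
    split=> [a b|a|a]; rewrite /z ?chain_diag ?edge_diag //.
      by rewrite chainC !(edgeC _ _ a).
    rewrite !big_split /= sumb_chain // !sumb_edge // -Ls.
    by case: (a == u0) (a == u1) (a == c) => [] [] [].
  have zg a b : z a b -> gr D x y a b.
    have g0 := gr_tri x y D0; have g1 := gr_tri x y D1.
    rewrite /z; case E0: (edge c u0 a b).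
      by move=> _; case/edgeP: E0 => -[-> ->]; rewrite // (gr_sym HD).
    case E1: (edge c u1 a b).
      by move=> _; case/edgeP: E1 => -[-> ->]; rewrite // (gr_sym HD).
    rewrite addFb addbF => /(chain_path Ps) /orP[] /and3P[] //; by rewrite (gr_sym HD).
  have [X [tX XD bX]] := d_cyc HD zc zg.
  have A1 w : A u1 w = false by apply/negP => H; case/negP: NA1; exact: Ac H D1.
  (* Handshake lemma for the graph of the pairs uw of the class with cuw in [X]. A vertex [u] of the
     class has there the parity of [z] on the edge cu, which is odd only for [u0], since [u1] is
     outside the class. *)
  have : \big[addb/false]_u \big[addb/false]_w (A u w && X c u w) = false.
    by apply: sumb_sym => [u w|u]; rewrite ?(tri_abb tX) ?andbF // As (tri23 tX).
  rewrite (@sumb_eq1 _ _ u0) => [|u uu0].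
    rewrite (_ : \big[addb/false]_w _ = z c u0); last first.
      rewrite -bX; apply: eq_bigr => w _; case Xw: (X c u0 w); last by rewrite andbF.
      by rewrite (Ac _ _ _ A0 (XD _ _ _ Xw)).
    by rewrite /z chain_notin // edge_refl /edge eqxx (negbTE u01) (negbTE c1).
  have [/existsP[w Aw]|/existsPn N] := boolP [exists w, A u w]; last first.
    by rewrite big1 // => w _; rewrite (negbTE (N w)).
  rewrite (_ : \big[addb/false]_w' _ = z c u); last first.
    rewrite -bX; apply: eq_bigr => w' _; case Xw: (X c u w'); last by rewrite andbF.
    by rewrite (Ac _ _ _ Aw (XD _ _ _ Xw)).
  have uu1 : u != u1 by apply: contraTneq Aw => ->; rewrite A1.
  by rewrite /z chain_notin // /edge eqxx (negbTE uu0) (negbTE uu1) (negbTE c1) (negbTE c0).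
(* If [c] separates [u0] from [u1], both components still reach the boundary, which remains
   connected without [c]. *)
have [f fq uf] := component_meets_boundary D0.
have [g gq ug] := component_meets_boundary D1.
case/negP: NC; apply: (connect_trans uf); rewrite r_sym; apply: (connect_trans ug).
rewrite r_sym; apply: boundary_connect => //.
  by apply: connect_avoid uf _; rewrite eq_sym.
by apply: connect_avoid ug _; rewrite eq_sym.
Qed.
End Link.

(** * Attaching and removing one triangle *)

Local Ltac split_eq a b := case: (a =P b) => ?; try (exfalso; congruence).

Section Moves.
Variable V : finType.
Implicit Types (a b c d u v w x y : V) (p q : seq V) (X Y D S : V -> V -> V -> bool).

(** The triangle uvw as a 2-chain. Written as a sum mod 2 it yields its boundary [bdt] term by term;
    [tinP] recovers the list of six permutations. *)
Definition tin u v w a b c := (edge u v a b && (c == w)) (+) ((edge v w a b && (c == u))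
  (+) (edge u w a b && (c == v))).

Definition bdt u v w a b := edge u v a b (+) (edge v w a b (+) edge u w a b).

Lemma bd_tin u v w a b : bd (tin u v w) a b = bdt u v w a b.
Proof.
have H e d : \big[addb/false]_c (e && (c == d)) = e.
  by case: e; rewrite /= ?sumb_pred1 ?big1.
by rewrite /bd /tin !big_split /= !H.
Qed.

Lemma tinP u v w a b c : u != v -> v != w -> u != w ->
  tin u v w a b c = [|| [&& a == u, b == v & c == w], [&& a == u, b == w & c == v],
    [&& a == v, b == u & c == w], [&& a == v, b == w & c == u],
    [&& a == w, b == u & c == v] | [&& a == w, b == v & c == u]].
Proof.
move=> /eqP uv /eqP vw /eqP uw; rewrite /tin /edge.
by split_eq a u; split_eq a v; split_eq a w; split_eq b u; split_eq b v; split_eq b w;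
  split_eq c u; split_eq c v; split_eq c w.
Qed.

Section Tin.
Variables (u v w : V).
Hypotheses (uv : u != v) (vw : v != w) (uw : u != w).

Lemma tri_tin : tri (tin u v w).
Proof.
split=> [a b c|a b c|a b].
- rewrite !tinP //; move/eqP: uv => Huv; move/eqP: vw => Hvw; move/eqP: uw => Huw.
  by split_eq a u; split_eq a v; split_eq a w; split_eq b u; split_eq b v; split_eq b w;
  split_eq c u; split_eq c v; split_eq c w.
- rewrite !tinP //; move/eqP: uv => Huv; move/eqP: vw => Hvw; move/eqP: uw => Huw.
  by split_eq a u; split_eq a v; split_eq a w; split_eq b u; split_eq b v; split_eq b w;
  split_eq c u; split_eq c v; split_eq c w.
rewrite tinP //; have [->|au] := eqVneq a u; first by rewrite (negbTE uv) (negbTE uw).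
by have [->|av] := eqVneq a v; rewrite ?(negbTE vw) /= ?andbF ?orbF.
Qed.

Lemma tin_refl : tin u v w u v w.
Proof. by rewrite tinP // !eqxx. Qed.

Lemma tin_cases a b c : tin u v w a b c ->
  [\/ [/\ a = u, b = v & c = w], [/\ a = u, b = w & c = v],
    [/\ a = v, b = u & c = w] | [\/ [/\ a = v, b = w & c = u],
    [/\ a = w, b = u & c = v] | [/\ a = w, b = v & c = u]]].
Proof.
rewrite tinP //; case/or4P; [| | |case/or3P]; case/and3P=> /eqP-> /eqP-> /eqP->; 
 [constructor 1|constructor 2|constructor 3|constructor 4;constructor 1|constructor 4;constructor 2|
 constructor 4; constructor 3]; by [].
Qed.

Lemma tin_val X a b c : tri X -> tin u v w a b c -> X a b c = X u v w.
Proof.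
move=> tX /tin_cases[] => [[-> -> ->]|[-> -> ->]|[-> -> ->]|[] [-> -> ->]] //.
- by rewrite (tri23 tX).
- by rewrite (tri12 tX).
- by rewrite -(tri_rot tX).
- by rewrite (tri_rot tX).
by rewrite (tri13 tX).
Qed.

Lemma tin_sub X a b c : tri X -> X u v w -> tin u v w a b c -> X a b c.
Proof. by move=> tX H T; rewrite (tin_val tX T). Qed.

Lemma tin_third a b c c' : tin u v w a b c -> tin u v w a b c' -> c' = c.
Proof.
move=> H /tin_cases H'.
have := H; rewrite tinP //.
case: H' => [[-> -> ->]|[-> -> ->]|[-> -> ->]|[] [-> -> ->]];
rewrite ?eqxx ?(negbTE uv) ?(negbTE vw) ?(negbTE uw)
  ?[v == u]eq_sym ?[w == u]eq_sym ?[w == v]eq_sym ?(negbTE uv) ?(negbTE vw) ?(negbTE uw) /= ?orbF; 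
by move/eqP.
Qed.

Lemma tin_edge a b c : tin u v w a b c -> [|| edge u v a b, edge v w a b | edge u w a b].
Proof. by rewrite /tin; do 3!case: edge. Qed.

End Tin.
End Moves.

Section Moves2.
Variable V : finType.
Implicit Types (a b c d u v w x y : V) (p q : seq V) (X Y D S : V -> V -> V -> bool).

Lemma bdt_in u v w a b : bdt u v w a b -> [|| edge u v a b, edge v w a b | edge u w a b].
Proof. by rewrite /bdt; do 3!case: edge. Qed.

(** Gluing a triangle on the outside with uv a new edge. Either vw is an old edge and the triangle
    fills a corner, or [v] is a new vertex. The sides vw and uw must have room for one more
    triangle. *)
Lemma disc_attach D x y q q' u v w : disc D x y q ->
  u != v -> v != w -> u != w ->
  ~~ gr D x y u v ->
  (forall c c', D v w c -> D v w c' -> c = c') ->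
  (forall c c', D u w c -> D u w c' -> c = c') ->
  gr D x y u w -> gr D x y v w \/ (forall b, ~~ gr D x y v b) ->
  uniq (x :: q') -> last x q' = y ->
  (forall a b, chain (x :: q') a b = chain (x :: q) a b (+) bdt u v w a b) ->
  disc (fun a b c => D a b c || tin u v w a b c) x y q'.
Proof.
move=> HD uv vw uw Guv Nvw Nuw Guw Gvw Uq' Lq' Eq'.
have tD := d_tri HD; have tT := tri_tin uv vw uw.
have Nuv c : D u v c = false by apply: contraNF Guv => /gr_tri.
have DT a b c : D a b c && tin u v w a b c = false.
  by apply/negP => /andP[H T]; move: H; rewrite (tin_val uv vw uw tD T) Nuv.
have EX a b c : D a b c || tin u v w a b c = D a b c (+) tin u v w a b c.
  by move: (DT a b c); case: (D a b c) (tin u v w a b c) => [] [].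
have tD' : tri (fun a b c => D a b c || tin u v w a b c).
  by have [h1 h2 h3] := triD tD tT; split=> *; rewrite !EX.
have Done a b c c1 c2 : tin u v w a b c -> D a b c1 -> D a b c2 -> c1 = c2.
  move=> /tin_edge /or3P[] /edgeP[] [-> ->]; rewrite ?Nuv //.
  - by rewrite (tri12 tD) Nuv.
  - exact: Nvw.
  - by rewrite !(tri12 tD w v); exact: Nvw.
  - exact: Nuw.
  by rewrite !(tri12 tD w u); exact: Nuw.
split=> //; [| |exact: d_neq HD| |].
- move=> a b c1 c2 c3 /orP[] H1 /orP[] H2 /orP[] H3 n12 n13.
  + exact: (d_le2 HD H1 H2 H3 n12 n13).
  + by move: n12; rewrite (Done _ _ _ _ _ H3 H1 H2) eqxx.
  + by move: n13; rewrite (Done _ _ _ _ _ H2 H1 H3) eqxx.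
  + by rewrite (tin_third uv vw uw H2 H3).
  + exact: (Done _ _ _ _ _ H1 H2 H3).
  + by move: n13; rewrite (tin_third uv vw uw H1 H3) eqxx.
  + by move: n12; rewrite (tin_third uv vw uw H1 H2) eqxx.
  + by rewrite (tin_third uv vw uw H2 H3).
- move=> a b; rewrite (eq_bd EX) bdD bd_tin (d_bd HD) Eq'.
  by rewrite addbAC.
- move=> z zc zg.
  (* Adding the boundary of the new triangle removes uv from the cycle. *)
  pose z' a b := z a b (+) (z u v && bdt u v w a b).
  have zc' : cyclic z'.
    apply: cyclicD => //; case: (z u v) => /=; last by split=> // a; rewrite big1.
    have [h1 h2 h3] := bd_cyclic tT.
    split=> [a b|a|a]; rewrite -?bd_tin //.
    by apply: etrans (h3 a); apply: eq_bigr => b _; rewrite bd_tin.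
  have z'uv : z' u v = false.
    have -> : z' u v = z u v (+) (z u v && true).
      by rewrite /z' /bdt edge_refl /edge ?(negbTE uv) ?(negbTE vw) ?(negbTE uw) /= ?andbF.
    by rewrite andbT addbb.
  have inz a b : z' a b -> [|| gr D x y a b, edge u v a b, edge v w a b | edge u w a b].
    rewrite /z'; case E : (bdt u v w a b); first by move/bdt_in: E => ->; rewrite orbT.
    rewrite andbF addbF => /zg; rewrite /gr.
    case/orP=> [/existsP[c /orP[Hc|Hc]]|->]; last by rewrite orbT.
      by apply/orP; left; apply/orP; left; apply/existsP; exists c.
    by rewrite (tin_edge Hc) orbT.
  (* When [v] is new, uv and vw are the only edges at [v], so a cycle that avoids uv avoids vw as
     well. *)
  have z'vw : z' v w -> gr D x y v w.
    case: Gvw => // N z'w; case: zc' => [s d e].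
    suff : z' v w = false by rewrite z'w.
    move: (e v); rewrite (@sumb_eq1 _ _ w) // => b bw.
    apply/negP => /[dup] Hb /inz /or4P[||/edgeP[] []|/edgeP[] []].
    + by apply/negP; exact: N.
    + case/edgeP=> -[E1 E2]; first by move: uv; rewrite E1 eqxx.
      by move: Hb; rewrite E2 s z'uv.
    + by move=> _ E; rewrite E eqxx in bw.
    + by move=> E; rewrite E eqxx in vw.
    + by move=> E; rewrite E eqxx in uv.
    by move=> E; rewrite E eqxx in vw.
  have zg' a b : z' a b -> gr D x y a b.
    move=> /[dup] Hz /inz /or4P[|||] // /edgeP[] [E1 E2]; subst a b => //.
    + by move: Hz; rewrite z'uv.
    + by case: zc' => s _ _; move: Hz; rewrite s z'uv.
    + exact: z'vw.
    + by rewrite (gr_sym HD); apply: z'vw; case: zc' => <-.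
    by rewrite (gr_sym HD).
  have [X [tX XD bX]] := d_cyc HD zc' zg'.
  exists (fun a b c => X a b c (+) (z u v && tin u v w a b c)); split.
  + apply: triD => //; case: (z u v) => //=; by split.
  + move=> a b c; case E: (X a b c); first by rewrite (XD _ _ _ E).
    by case/andP=> _ ->; rewrite orbT.
  move=> a b; rewrite bdD bX /z' -addbA.
  rewrite (_ : bd _ a b = z u v && bdt u v w a b) ?addbb ?addbF //.
  by case: (z u v); rewrite -?bd_tin // /bd big1.
move=> X tX XD bX; apply: (d_inj HD tX _ bX).
(* The edge uv lies in the new triangle only, so a 2-chain without boundary cannot contain that
   triangle. *)
have Xuvw : X u v w = false.
  rewrite -(bX u v) /bd (@sumb_eq1 _ _ w) // => c cw; apply/negP => /XD.
  rewrite Nuv => /= /(tin_third uv vw uw (tin_refl uv vw uw)) E.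
  by rewrite E eqxx in cw.
move=> a b c Xabc; case/orP: (XD _ _ _ Xabc) => // T.
by rewrite (tin_val uv vw uw tX T) Xuvw in Xabc.
Qed.

(** An elementary collapse: uvw is the only triangle on uv. A cycle of the smaller complex does not
    use uv, so its filling in [D] avoids the triangle. The new boundary is given only through its
    chain, which covers both the loss of a vertex and the exposure of an interior one. *)
Lemma disc_remove D x y q q' u v w : disc D x y q -> D u v w -> bd D u v ->
  ~~ edge x y u v -> uniq (x :: q') -> last x q' = y ->
  (forall a b, chain (x :: q') a b = chain (x :: q) a b (+) bdt u v w a b) ->
  disc (fun a b c => D a b c && ~~ tin u v w a b c) x y q'.
Proof.
move=> HD Duvw Buv Nxy Uq' Lq' Eq'.
have tD := d_tri HD; have [uv uw vw] := tri_neq tD Duvw.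
have tT := tri_tin uv vw uw.
have TD a b c : tin u v w a b c -> D a b c by apply: tin_sub.
have EX a b c : D a b c && ~~ tin u v w a b c = D a b c (+) tin u v w a b c.
  move: (TD a b c); case: (D a b c) (tin u v w a b c) => [] [] // H; by rewrite H.
split=> //; [exact: triB| | |exact: d_neq HD| |].
- by move=> a b c1 c2 c3 /andP[H1 _] /andP[H2 _] /andP[H3 _]; exact: (d_le2 HD H1 H2 H3).
- move=> a b; rewrite (eq_bd EX) bdD bd_tin (d_bd HD) Eq'.
  by rewrite addbAC.
- move=> z zc zg.
  have zg' a b : z a b -> gr D x y a b.
    move/zg; rewrite /gr => /orP[/existsP[c /andP[Hc _]]|->]; last by rewrite orbT.
    by apply/orP; left; apply/existsP; exists c.
  have [X [tX XD bX]] := d_cyc HD zc zg'; exists X; split=> // a b c Xabc.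
  rewrite (XD _ _ _ Xabc); apply/negP => T.
  have Xuvw : X u v w by rewrite -(tin_val uv vw uw tX T).
  have : z u v.
    rewrite -bX /bd (@sumb_eq1 _ _ w) // => c' cw; apply/negP => /XD H.
    by move: cw; rewrite (bd_unique HD Buv Duvw H) eqxx.
  move/zg; rewrite /gr (negbTE Nxy) orbF => /existsP[c' /andP[Hc]].
  by rewrite (bd_unique HD Buv Duvw Hc) tin_refl.
move=> X tX XD bX; apply: (d_inj HD tX _ bX) => a b c /XD /andP[] //.
Qed.

End Moves2.

(** * Cutting a disc along a chord *)

Section Split.
Variable V : finType.
Implicit Types (a b c d u v w x y : V) (p q s : seq V) (X Y D S T : V -> V -> V -> bool).

(** [T] meets the other triangles along the edge vw at most. Fill a cycle of [T] in [D]: the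
    triangles of the filling outside [T] have their boundary inside that single edge, which carries
    no nonzero cycle, so there are none by injectivity of the boundary. *)
Lemma cycles_in_part D x y q T v w t1 t2 : disc D x y q -> tri T ->
  (forall a b c, T a b c -> D a b c) -> v != w ->
  (forall a b c c', T a b c -> D a b c' -> ~~ T a b c' -> edge v w a b) ->
  (forall a b c', edge t1 t2 a b -> D a b c' -> ~~ T a b c' -> edge v w a b) ->
  gr D x y t1 t2 ->
  forall z, cyclic z -> (forall a b, z a b -> gr T t1 t2 a b) ->
  exists X, [/\ tri X, forall a b c, X a b c -> T a b c & forall a b, bd X a b = z a b].
Proof.
move=> HD tT TD vw shared base g12 z zc zg; have tD := d_tri HD.
have zg' a b : z a b -> gr D x y a b.
  move/zg => /orP[/existsP[c /TD]|]; first exact: gr_tri.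
  by case/edgeP=> -[-> ->] //; rewrite (gr_sym HD).
have [X [tX XD bX]] := d_cyc HD zc zg'; exists X; split=> //.
pose Y a b c := X a b c && ~~ T a b c.
have tY : tri Y by apply: triB.
have bY a b : bd Y a b -> edge v w a b.
  move=> /[dup] H /bd_ex[c /andP[/XD Dc NT]].
  have := bX a b; rewrite (bdIB X T) H.
  case E: (bd _ a b); last first.
    by move/esym/zg => /orP[/existsP[c' Tc']|E']; [exact: shared Tc' Dc NT|exact: base E' Dc NT].
  by case/bd_ex: E => c' /andP[_ Tc'] _; exact: shared Tc' Dc NT.
have [sY dY eY] := bd_cyclic tY.
have bYvw : bd Y v w = false.
  rewrite -[RHS](eY v) (@sumb_eq1 _ _ w) // => b bw; apply/negP => /bY /edgeP[] [E1 E2].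
    by rewrite E2 eqxx in bw.
  by rewrite E1 eqxx in vw.
have bY0 a b : bd Y a b = false.
  by apply/negP => /[dup] H /bY /edgeP[] [E1 E2]; subst; rewrite ?bYvw // sY bYvw in H.
have Y0 := d_inj HD tY (fun a b c h => XD a b c (proj1 (andP h))) bY0.
by move=> a b c Xc; move: (Y0 a b c); rewrite /Y Xc => /negbFE.
Qed.

(** [S] is the filling of the cycle made of the boundary segment from [v] to [w] and the chord vw;
    the chord becomes the base edge of [S], while the rest keeps xy. The last clause says that the
    two parts share no vertex except the ends of the chord. *)
Lemma disc_split D x y v s w r c0 : disc D x y (v :: s ++ w :: r) -> D v w c0 ->
  exists S, [/\ tri S, forall a b c, S a b c -> D a b c, disc S v w (rcons s w),
    disc (fun a b c => D a b c && ~~ S a b c) x y (v :: w :: r) &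
    forall c u1 w1 u2 w2, S c u1 w1 -> D c u2 w2 -> ~~ S c u2 w2 -> c = v \/ c = w].
Proof.
move=> HD Dvw; have tD := d_tri HD; have [vw vc0 wc0] := tri_neq tD Dvw.
have Gvw := gr_tri x y Dvw.
have Ul := d_uniq HD; have Ll := d_last HD.
have [Us Ur Usr xvsw] : [/\ uniq (v :: rcons s w), uniq [:: x, v, w & r],
   (forall a, a \in v :: rcons s w -> a \in w :: r -> a = w) & x \notin v :: rcons s w].
  have E : v :: s ++ w :: r = (v :: rcons s w) ++ r by rewrite cat_cons cat_rcons.
  move: Ul; rewrite E cons_uniq mem_cat negb_or cat_uniq => /andP[/andP[H1 H2] /and3P[H3 /hasPn H4 H5]].
  have nr a : a \in v :: rcons s w -> a \notin r by move=> H; apply/negP => /H4; rewrite /= H.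
  have wv : w \in v :: rcons s w by rewrite inE mem_rcons inE eqxx orbT.
  split=> //; last first.
    by move=> a /nr; rewrite inE; case: eqP => //= _ /negbTE ->.
  rewrite /= !inE !negb_or (negbTE (nr _ wv)) (negbTE (nr v (mem_head _ _))) H2 H5 vw !andbT.
  by apply/andP; split; apply: contraNneq H1 => ->; rewrite // mem_head.
have Pvw : path (fun a b => a != b) v (rcons s w) by apply: uniq_path_neq.
have Lvw : last v (rcons s w) = w by rewrite last_rcons.
have xv : x != v by apply: contraNneq xvsw => ->; rewrite mem_head.
have xw : x != w by apply: contraNneq xvsw => ->; rewrite inE mem_rcons inE eqxx orbT.
have yin : y \in w :: r by rewrite -Ll /= last_cat /= mem_last.
have yv : y != v.
  apply/eqP => E; have /= := Usr v (mem_head _ _); rewrite -E yin => /(_ isT) E'.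
  by rewrite -E E' eqxx in vw.
have Ech a b : chain (x :: v :: s ++ w :: r) a b =
    edge x v a b (+) (chain (v :: rcons s w) a b (+) chain (w :: r) a b).
  by rewrite chain_cons -[v :: s ++ _]cat_cons chain_cat.
have zc := cyclic_closed_chain Pvw Lvw vw.
have [S [tS SD bS]] : exists S, [/\ tri S, forall a b c, S a b c -> D a b c &
    forall a b, bd S a b = chain (v :: rcons s w) a b (+) edge v w a b].
  apply: (d_cyc HD zc) => a b.
  case Evw: (edge v w a b); first by move=> _; case/edgeP: Evw => -[-> ->]; rewrite // (gr_sym HD).
  rewrite addbF; have := boundary_path HD; rewrite /= -cat_rcons cat_path => /andP[_ /andP[P _]].
  by case/(chain_path P)/orP; rewrite // (gr_sym HD).
have bdxy : bd D x y.
  rewrite (d_bd HD) edge_refl Ech !(@chain_notin _ _ x y) //.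
    by rewrite /edge (negbTE yv) (negbTE xv) !andbF.
  by move: Ur; rewrite /= !inE !negb_or => /andP[/and3P[_ -> ->]].
(* An edge with a triangle on each side is interior in [D] but lies in the boundary of [S]. It
   cannot be on the segment from [v] to [w], which is part of the boundary of [D], hence it is the
   chord. *)
have shared a b c c' : S a b c -> D a b c' -> ~~ S a b c' -> edge v w a b.
  move=> Sc Dc' NS; have Dc := SD _ _ _ Sc.
  have cc' : c != c' by apply: contraNneq NS => <-.
  have ND : bd D a b = false.
    by apply/negP => B; move: cc'; rewrite (bd_unique HD B Dc Dc') eqxx.
  have : bd S a b.
    rewrite /bd (@sumb_eq1 _ _ c) // => d dc; apply/negP => Sd.
    case/negP: NS; rewrite -(d_le2 HD Dc (SD _ _ _ Sd) Dc') // eq_sym //.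
  rewrite bS; case: (edge v w a b) => //; rewrite addbF => Cab.
  move: ND; rewrite (d_bd HD) Ech Cab; case/andP: (chain_mem Cab) => Ha Hb.
  have xa : a != x by apply: contraNneq xvsw => <-.
  have xb : b != x by apply: contraNneq xvsw => <-.
  have e d : edge x d a b = false by rewrite /edge (negbTE xa) (negbTE xb) andbF.
  rewrite !e; case E: (chain (w :: r) a b) => // _; case/andP: (chain_mem E) => Ha' Hb'.
  by have [] := tri_neq tD Dc; rewrite (Usr _ Ha Ha') (Usr _ Hb Hb') eqxx.
(* The base edge is not in the boundary of [S], so a triangle of [S] on it would come with a second
   one, whereas [D] has only one there. *)
have baseR a b c' : edge x y a b -> S a b c' -> False.
  wlog [-> ->] : a b / a = x /\ b = y.
    move=> H /[dup] E /edgeP[] [Ea Eb]; first exact: H.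
    by rewrite (tri12 tS); apply: H => //; rewrite edgeC.
  move=> _ Sc; have : bd S x y = false.
    by rewrite bS chain_notin // /edge (negbTE xv) (negbTE xw).
  case/not_bd_other/(_ Sc) => c'' ne /SD Dc''.
  by move: ne; rewrite (bd_unique HD bdxy (SD _ _ _ Sc) Dc'') eqxx.
have tR : tri (fun a b c => D a b c && ~~ S a b c) by apply: triB.
exists S; split=> //.
- split=> //.
  + by move=> a b c1 c2 c3 /SD H1 /SD H2 /SD H3; exact: (d_le2 HD H1 H2 H3).
  + apply: (cycles_in_part HD (v := v) (w := w)) => // a b c' E _ _; exact: E.
  by move=> X tX XS; apply: (d_inj HD tX) => a b c /XS /SD.
- split=> //; [| |by rewrite -Ll /= last_cat|exact: d_neq HD| |].
  + by move=> a b c1 c2 c3 /andP[H1 _] /andP[H2 _] /andP[H3 _]; exact: (d_le2 HD H1 H2 H3).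
  + move=> a b; have := bdIB D S a b; rewrite (d_bd HD) Ech.
    rewrite (_ : bd (fun a b c => D a b c && S a b c) a b = bd S a b); last first.
      by apply: eq_bd => a' b' c'; case E: (S a' b' c'); rewrite ?andbF // (SD _ _ _ E).
    rewrite bS !chain_cons.
    move: (chain (v :: rcons s w) a b) (chain (w :: r) a b) (bd _ a b) => m1 m2 m3.
    by case: (edge x v a b) (edge v w a b) (edge x y a b) m1 m2 m3 => [] [] [] [] [] [].
  + apply: (cycles_in_part HD (v := v) (w := w)) => //.
    * by move=> a b c /andP[].
    * move=> a b c c' /andP[Dc NS] Dc'; rewrite Dc' negbK => Sc'; exact: shared Sc' Dc NS.
    * by move=> a b c' E Dc'; rewrite Dc' negbK => /(baseR _ _ _ E).
    by rewrite /gr edge_refl orbT.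
  by move=> X tX XS; apply: (d_inj HD tX) => a b c /XS /andP[].
(* At a vertex that is not an end of the chord, the triangles of [S] are closed under sharing an
   edge, so by connectedness of the link they are all the triangles there. *)
move=> c u1 w1 u2 w2 S1 D2 N2; have [->|cv] := eqVneq c v; first by left.
have [->|cw] := eqVneq c w; first by right.
case/negP: N2; move: u2 w2 D2; apply: (link_connected HD (A := S c)) S1.
- exact: SD.
- by move=> u w'; rewrite (tri23 tS).
move=> u w' w'' Su Du; apply/contraT => NS.
by case/edgeP: (shared _ _ _ _ Su Du NS) => -[E _]; rewrite E eqxx in cv cw.
Qed.
End Split.

(** * Canonical orderings of discs *)

Section Stack.
Variable V : finType.
Implicit Types (a b c d u v w x y : V) (p q s : seq V) (D S : V -> V -> V -> bool).

Lemma app_cat p q : List.app p q = p ++ q.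
Proof. by elim: p => //= a p ->. Qed.

Lemma stackedA p1 u w p2 ord E v : ~ List.In v ord -> stacked (p1 ++ u :: w :: p2) ord E ->
  stacked (p1 ++ u :: v :: w :: p2) (v :: ord) (fun a b => E a b \/ joins v u a b \/ joins v w a b).
Proof. by rewrite -!app_cat; apply: stacked_add. Qed.

Lemma stackedF p1 v w0 w1 p2 ord E : stacked (p1 ++ v :: w0 :: w1 :: p2) (v :: ord) E ->
  stacked (p1 ++ v :: w1 :: p2) (v :: ord) (fun a b => E a b \/ joins v w1 a b).
Proof. by rewrite -!app_cat; apply: stacked_fill. Qed.

Lemma joinsP u v a b : reflect (joins u v a b) (edge u v a b).
Proof. exact: edgeP. Qed.

(** Six times the number of triangles; only its decrease is used. *)
Definition vol D := #|[pred t : V * V * V | D t.1.1 t.1.2 t.2]|.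

Lemma vol_lt D S a b c : (forall a b c, S a b c -> D a b c) -> D a b c -> ~~ S a b c ->
  vol S < vol D.
Proof.
move=> SD Dabc NS; apply/proper_card/properP; split.
  by apply/subsetP => -[[a' b'] c']; rewrite !inE => /SD.
by exists (a, b, c); rewrite !inE.
Qed.

Lemma boundary_edge D x y q p1 u v p2 : disc D x y q -> x :: q = p1 ++ u :: v :: p2 ->
  ~~ edge x y u v -> bd D u v.
Proof.
by move=> HD E N; rewrite (d_bd HD) (negbTE N) E chain_edge // -E (d_uniq HD).
Qed.

(** Removing a vertex [v] without chords. The triangle vlc on the boundary edge vl is taken away
    repeatedly; absence of chords makes [c] an interior vertex, now exposed, unless it is [x], and
    then [v] is gone. Read backwards, [v] is stacked on the last pair and [stacked_fill] buries the
    exposed vertices one after the other. *)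
Lemma peel n D x y v l rest : vol D < n -> disc D x y (v :: l :: rest) ->
  (forall w c, w \in rest -> D v w c = false) ->
  exists D' q', [/\ disc D' x y q', vol D' < vol D, forall a b c, D' a b c -> D a b c,
    forall a b, D' v a b = false &
    forall p1 p2 ord E, stacked (p1 ++ (x :: q') ++ p2) ord E -> ~ List.In v ord -> E x y ->
      (forall a b c, D' a b c -> E a b) ->
      exists E', [/\ stacked (p1 ++ (x :: v :: l :: rest) ++ p2) (v :: ord) E',
        forall a b, E a b -> E' a b & forall a b c, D a b c -> E' a b]].
Proof.
elim: n D l rest => // n IH D l rest Dn HD NC.
have tD := d_tri HD; have U := d_uniq HD; have L := d_last HD.
have [xv xl xr] : [/\ x != v, x != l & x \notin rest].
  by move: U; rewrite /= !inE !negb_or => /andP[/and3P[]].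
have [vl vr lr] : [/\ v != l, v \notin rest & l \notin rest].
  by move: U; rewrite /= !inE !negb_or => /and4P[_ /andP[-> ->] ->].
have Ur : uniq rest by move: U; rewrite /= => /and4P[].
have yin : y \in l :: rest by rewrite -L /= mem_last.
have yv : y != v by apply: contraTneq yin => ->; rewrite inE negb_or vl.
have xyv a : edge x y v a = false by rewrite /edge ![v == _]eq_sym (negbTE xv) (negbTE yv).
have Bvl : bd D v l by apply: (@boundary_edge _ _ _ _ [:: x] v l rest HD); rewrite ?xyv.
have [c Dc] := bd_ex Bvl; have [_ vc lc] := tri_neq tD Dc.
have lv : l != v by rewrite eq_sym.
have Nlt : tin v l c v l c by apply: tin_refl.
have TD a b d : tin v l c a b d -> D a b d by apply: tin_sub.
pose D1 a b d := D a b d && ~~ tin v l c a b d.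
have D1D a b d : D1 a b d -> D a b d by case/andP.
have V1 : vol D1 < vol D by apply: (@vol_lt D D1 v l c) => //; rewrite /D1 Nlt andbF.
have [cx|cx] := eqVneq c x.
  subst c.
  have H1 : disc D1 x y (l :: rest).
    apply: (disc_remove HD Dc Bvl); rewrite ?xyv //.
      by rewrite /= inE negb_or xl xr lr Ur.
    move=> a b; rewrite !chain_cons /bdt [edge l x _ _]edge_sym [edge v x _ _]edge_sym.
    move: (chain (l :: rest) a b) => ch.
    by case: (edge x v a b) (edge v l a b) (edge x l a b) ch => [] [] [] [].
  exists D1, (l :: rest); split=> //.
    move=> a b; apply/negP => /andP[Dab]; apply/negP; rewrite negbK.
    (* Both edges vl and vx are now on the boundary, so this triangle has no neighbour at [v], and
       by connectedness of the link it is the only triangle at [v]. *)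
    apply: (link_connected HD (A := tin v l x v)) Nlt _ _ Dab => //.
    - exact: TD.
    - by move=> u w; rewrite (tri23 (tri_tin vl lc vc)).
    move=> u w w' Tu Du.
    suff -> : w' = w by [].
    have Dw := TD _ _ _ Tu.
    have [/(bd_unique HD)|Bu] := boolP (bd D v u); first exact.
    case/negP: Bu.
    case: (tin_cases vl lc vc Tu) => [[_ -> _]|[_ -> _]|[E _ _]|[[E _ _]|[E _ _]|[E _ _]]] //.
    + by rewrite bdC //; apply: (@boundary_edge _ _ _ _ [::] x v (l :: rest) HD); rewrite 1?edgeC ?xyv.
    + by rewrite E eqxx in vl.
    + by rewrite E eqxx in vl.
    + by rewrite E eqxx in vc.
    by rewrite E eqxx in vc.
  move=> p1 p2 ord E st nv Exy DE.
  exists (fun a b => E a b \/ joins v x a b \/ joins v l a b); split.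
  - exact: (@stackedA p1 x l (rest ++ p2)).
  - by left.
  have Es := stacked_sym _ _ _ st.
  have Exl : E x l.
    have [/joinsP[] [E1 E2]|N] := boolP (edge x y x l).
    + by rewrite E2.
    + by move: xl; rewrite E2 eqxx.
    have /bd_ex[d Dd] : bd D1 x l by apply: (@boundary_edge _ _ _ _ [::] x l rest H1).
    exact: DE Dd.
  move=> a b d Dab; have [T|NT] := boolP (tin v l x a b d).
    case/or3P: (tin_edge T) => /joinsP; [by right; right| |by right; left].
    by case=> -[-> ->]; left; [exact: Es|].
  by left; apply: (DE a b d); rewrite /D1 Dab.
have cr : c \notin rest by apply/negP => /(NC _ l); rewrite (tri23 tD) Dc.
have H1 : disc D1 x y (v :: c :: l :: rest).
  apply: (disc_remove HD Dc Bvl); rewrite ?xyv //.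
    by rewrite /= !inE !negb_or xv (eq_sym x) cx xl xr vc vl vr (eq_sym c) lc cr lr Ur.
  move=> a b; rewrite !chain_cons /bdt [edge l c _ _]edge_sym.
  move: (chain (l :: rest) a b) => ch.
  by case: (edge x v a b) (edge v l a b) (edge v c a b) (edge c l a b) ch => [] [] [] [] [].
have V1n : vol D1 < n by apply: leq_trans V1 _.
have NC1 w d : w \in l :: rest -> D1 v w d = false.
  rewrite inE => /orP[/eqP->|/(NC _ d)]; last by rewrite /D1 => ->.
  apply/negP => /andP[Dd]; rewrite (bd_unique HD Bvl Dc Dd).
  by rewrite Nlt.
have [D' [q' [Hq' V' D'D1 vD' K]]] := IH _ _ _ V1n H1 NC1.
exists D', q'; split=> //; first exact: (ltn_trans V' V1). by move=> a b d /D'D1 /D1D.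
move=> p1 p2 ord E st nv Exy DE.
have [E' [st' EE' D1E']] := K p1 p2 ord E st nv Exy DE.
exists (fun a b => E' a b \/ joins v l a b); split.
- have := @stackedF (p1 ++ [:: x]) v c l (rest ++ p2) ord E'.
  by rewrite -!catA; apply.
- by left; exact: EE'.
have Es := stacked_sym _ _ _ st'.
have cy : y != c.
  by apply: contraTneq yin => ->; rewrite inE negb_or cr andbT eq_sym.
have Evc : E' v c.
  have /bd_ex[d Dd] : bd D1 v c by apply: (@boundary_edge _ _ _ _ [:: x] v c (l :: rest) H1); rewrite ?xyv.
  exact: D1E' Dd.
have Ecl : E' c l.
  have /bd_ex[d Dd] : bd D1 c l.
    apply: (@boundary_edge _ _ _ _ [:: x; v] c l rest H1) => //.
    by rewrite /edge (negbTE cx) (eq_sym c) (negbTE cy).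
  exact: D1E' Dd.
move=> a b d Dab; have [T|NT] := boolP (tin v l c a b d).
  case/or3P: (tin_edge T) => /joinsP; first by right.
    by case=> -[-> ->]; left; [exact: Es|].
  by case=> -[-> ->]; left; [|exact: Es].
by left; apply: (D1E' a b d); rewrite /D1 Dab.
Qed.

(** The disc is erected on an edge xy of the upper boundary of a larger picture; this generality is
    what the chord case asks for. If the vertex [v] following [x] has no chord it is peeled off and
    stacked last. Otherwise the disc is cut along a chord vw: the part containing xy is built first,
    which puts vw on the upper boundary, and the other part is erected on vw. *)
Theorem disc_stacked D x y q : disc D x y q ->
  forall p1 p2 ord E, stacked (p1 ++ x :: y :: p2) ord E ->
    (forall c a b, D c a b -> c != x -> c != y -> ~ List.In c ord) -> E x y ->
  exists ord' E', [/\ stacked (p1 ++ (x :: q) ++ p2) ord' E', forall a b, E a b -> E' a b,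
    forall a b c, D a b c -> E' a b &
    forall a, List.In a ord' -> List.In a ord \/ exists b c, D a b c].
Proof.
have [n] := ubnP (vol D); elim: n => // n IH in D x y q *; rewrite ltnS => Dn HD p1 p2 ord E st fresh Exy.
have tD := d_tri HD; have U := d_uniq HD; have L := d_last HD; have xy := d_neq HD.
case: q => [|v q] in HD U L *; first by move: xy; rewrite -L /= eqxx.
case: q => [|l rest] in HD U L *.
  have D0 : forall a b c, D a b c = false.
    apply: (d_inj HD tD) => // a b.
    by rewrite (d_bd HD) -L chain_cons /= addbF addbb.
  by rewrite /= in L; subst v; exists ord, E; split=> // [a b c|a]; [rewrite D0|left].
have [xv xl xr] : [/\ x != v, x != l & x \notin rest].
  by move: U; rewrite /= !inE !negb_or => /andP[/and3P[]].
have [vl vr lr] : [/\ v != l, v \notin rest & l \notin rest].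
  by move: U; rewrite /= !inE !negb_or => /and4P[_ /andP[-> ->] ->].
have yin : y \in l :: rest by rewrite -L /= mem_last.
have yv : y != v by apply: contraTneq yin => ->; rewrite inE negb_or vl.
have xyv a : edge x y v a = false by rewrite /edge ![v == _]eq_sym (negbTE xv) (negbTE yv).
have [/existsP[w /andP[wr /existsP[c0 Dvw]]]|NC] :=
    boolP [exists w, (w \in rest) && [exists c, D v w c]]; last first.
  have NC' w c : w \in rest -> D v w c = false.
    move=> wr; apply/negP => Dc; case/negP: NC; apply/existsP; exists w; rewrite wr /=.
    by apply/existsP; exists c.
  have [D' [q' [H' V' D'D vD' K]]] := peel (ltnSn _) HD NC'.
  have V'n : vol D' < n by apply: leq_trans V' Dn.
  have [|ord' [E' [st' EE' D'E' ord'P]]] := IH _ _ _ _ V'n H' p1 p2 ord E st _ Exy.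
    by move=> c a b /D'D; exact: fresh.
  have /bd_ex[d Dd] : bd D v l.
    by apply: (@boundary_edge _ _ _ _ [:: x] v l rest HD); rewrite ?xyv.
  have nv : ~ List.In v ord'.
    case/ord'P => [|[b [c]]]; last by rewrite vD'.
    by apply: (fresh v l d Dd); rewrite eq_sym.
  have [E'' [st'' EE'' DE'']] := K p1 p2 ord' E' st' nv (EE' _ _ Exy) D'E'.
  exists (v :: ord'), E''; split=> //; first by move=> a b /EE' /EE''.
  move=> a [<-|/ord'P[|[b [c /D'D]]]]; first by right; exists l, d.
    by left.
  by right; exists b, c.
have [r1 [r2 Er]] : exists r1 r2, rest = r1 ++ w :: r2.
  exists (take (index w rest) rest), (drop (index w rest).+1 rest).
  by rewrite -drop_index // cat_take_drop.
subst rest; rewrite -cat_cons in HD.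
have [S [tS SD HS HR share]] := disc_split HD Dvw.
pose R a b c := D a b c && ~~ S a b c.
have RD a b c : R a b c -> D a b c by case/andP.
have vw : v != w by apply: contraNneq vr => ->; rewrite mem_cat mem_head orbT.
have xw : x != w by apply: contraNneq xr => ->; rewrite mem_cat mem_head orbT.
have lw : l != w by apply: contraNneq lr => ->; rewrite mem_cat mem_head orbT.
have /bd_ex[s Ss] : bd S v l.
  case: (r1) HS => [|l' r1'] HS.
    by apply: (@boundary_edge _ _ _ _ [::] v l [:: w] HS); rewrite // /edge eqxx (negbTE lw) (negbTE vw).
  by apply: (@boundary_edge _ _ _ _ [::] v l (rcons (l' :: r1') w) HS);
    rewrite // /edge eqxx (negbTE lw) (negbTE vw).
have /bd_ex[t Rt] : bd R x v.
  by apply: (@boundary_edge _ _ _ _ [::] x v (w :: r2) HR); rewrite // edgeC xyv.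
have VR : vol R < n.
  by apply: leq_trans Dn; apply: (vol_lt RD (SD _ _ _ Ss)); rewrite /R Ss andbF.
have VS : vol S < n.
  by apply: leq_trans Dn; apply: (vol_lt SD (RD _ _ _ Rt)); case/andP: Rt.
have [|ord1 [E1 [st1 EE1 RE1 ord1P]]] := IH _ _ _ _ VR HR p1 p2 ord E st _ Exy.
  by move=> c a b /RD; exact: fresh.
have E1vw : E1 v w.
  have /bd_ex[d] : bd R v w by apply: (@boundary_edge _ _ _ _ [:: x] v w r2 HR); rewrite ?xyv.
  exact: RE1.
have st1' : stacked ((p1 ++ [:: x]) ++ v :: w :: (r2 ++ p2)) ord1 E1 by rewrite -catA.
have [|ord2 [E2 [st2 EE2 SE2 ord2P]]] := IH _ _ _ _ VS HS _ _ _ _ st1' _ E1vw.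
  (* Freshness for the second part: except for [v] and [w] its vertices lie in no triangle of the
     first part. *)
  have noR c a b a' b' : S c a b -> c != v -> c != w -> R c a' b' -> False.
    move=> Sc cv cw /andP[Dc NS].
    by case: (share _ _ _ _ _ Sc Dc NS) => E0; rewrite E0 eqxx in cv cw.
  move=> c a b Sc cv cw /ord1P[|[b' [c']]]; last exact: (noR _ _ _ _ _ Sc).
  have /bd_ex[t' Rt'] : bd R x y.
    rewrite (d_bd HR) edge_refl chain_cons (@chain_notin _ _ x y).
      by rewrite /edge eqxx (negbTE yv) (negbTE xv).
    by move: (d_uniq HR); rewrite cons_uniq => /andP[].
  apply: (fresh c a b (SD _ _ _ Sc)).
    by apply/eqP => E0; subst c; exact: (noR _ _ _ _ _ Sc cv cw Rt).
  apply/eqP => E0; subst c; apply: (noR _ _ _ x t' Sc cv cw).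
  by move: Rt'; rewrite /R (tri12 tD) (tri12 tS).
exists ord2, E2; split.
- by move: st2; rewrite -cat_cons !rcons_cons -!catA /= -?catA /= cat_rcons.
- by move=> a b /EE1 /EE2.
- move=> a b c Dc; case Sc: (S a b c); first exact: SE2 Sc.
  by apply: EE2; apply: (RE1 a b c); rewrite /R Dc Sc.
move=> a /ord2P[/ord1P[|[b [c /RD]]]|[b [c /SD]]]; [by left| |]; by right; exists b, c.
Qed.
End Stack.

(** * Replacing a patch of triangles by a cone *)

Section Cone.
Variable V : finType.
Implicit Types (a b c d e u v w x y : V) (p q s : seq V) (D S X : V -> V -> V -> bool).

Lemma sumb_option (F : option V -> bool) :
  \big[addb/false]_o F o = F None (+) \big[addb/false]_v F (Some v).
Proof.
rewrite (bigD1 None) //=; congr (_ (+) _).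
rewrite (reindex_omap Some id) => [|[v|]] //.
by apply: eq_bigl => v /=; rewrite eqxx.
Qed.

Lemma sumb_two (F : V -> bool) u w : u != w -> (forall v, v != u -> v != w -> F v = false) ->
  \big[addb/false]_v F v = F u (+) F w.
Proof.
move=> uw H; rewrite (bigD1 u) //= (bigD1 w) 1?eq_sym //= big1 ?addbF // => v /andP[vu vw].
exact: H.
Qed.

(* The apex is None. *)
Definition cone (f : V -> V -> V -> bool) (l : V -> V -> bool) (s t o : option V) : bool :=
  match s, t, o with
  | Some a, Some b, Some c => f a b c
  | None, Some a, Some b | Some a, None, Some b | Some a, Some b, None => l a b
  | _, _, _ => false
  end.

Lemma tri_cone f l : tri f -> (forall a b, l a b = l b a) -> (forall a, l a a = false) -> tri (cone f l).
Proof.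
move=> [f1 f2 f3] l1 l2; split=> [[a|] [b|] [c|]|[a|] [b|] [c|]|[a|] [b|]] //=.
Qed.

Lemma bd_cone f l a b : bd (cone f l) (Some a) (Some b) = l a b (+) bd f a b.
Proof. by rewrite /bd sumb_option. Qed.

Lemma bd_cone0 f l a : bd (cone f l) None (Some a) = \big[addb/false]_b l a b.
Proof. by rewrite /bd sumb_option. Qed.

Lemma bd_cone0r f l a : bd (cone f l) (Some a) None = \big[addb/false]_b l a b.
Proof. by rewrite /bd sumb_option. Qed.

Lemma bd_cone00 f l : bd (cone f l) None None = false.
Proof. by rewrite /bd sumb_option big1. Qed.

Lemma cone_eta (X : option V -> option V -> option V -> bool) : tri X ->
  forall o1 o2 o3, X o1 o2 o3 = cone (fun a b c => X (Some a) (Some b) (Some c))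
    (fun a b => X None (Some a) (Some b)) o1 o2 o3.
Proof.
move=> tX [a|] [b|] [c|] //=.
- by rewrite (tri_rot tX) (tri_rot tX).
- by rewrite (tri12 tX).
- by rewrite (tri_abb tX).
- by rewrite (tri_aba tX).
- by rewrite (tri_aa tX).
by rewrite (tri_aa tX).
Qed.

Lemma edge_Some u v a b : edge (Some u) (Some v) (Some a) (Some b) = edge u v a b.
Proof. by []. Qed.

Lemma chain_map_Some p a b : chain (map Some p) (Some a) (Some b) = chain p a b.
Proof. by elim: p => [|u [|v p] IH] //; rewrite !map_cons !chain_cons -map_cons IH edge_Some. Qed.

(* The three conditions on bd S express that it is a single cycle. *)
Lemma disc_recone D x y q S : disc D x y q -> tri S -> (forall a b c, S a b c -> D a b c) ->
  (forall a b1 b2 b3, bd S a b1 -> bd S a b2 -> bd S a b3 -> b1 != b2 -> b1 != b3 -> b2 = b3) ->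
  (forall m, cyclic m -> (forall a b, m a b -> bd S a b) ->
     (forall a b, m a b = false) \/ (forall a b, m a b = bd S a b)) ->
  (forall t, \big[addb/false]_a t a = false -> (forall a, t a -> exists b, bd S a b) ->
     exists m, [/\ forall a b, m a b = m b a, forall a, m a a = false, forall a b, m a b -> bd S a b &
       forall a, \big[addb/false]_b m a b = t a]) ->
  (forall a b c, edge x y a b -> S a b c -> bd S a b) ->
  disc (cone (fun a b c => D a b c && ~~ S a b c) (bd S)) (Some x) (Some y) (map Some q).
Proof.
move=> HD tS SD deg2 cyc conn Nxy; have tD := d_tri HD.
pose f a b c := D a b c && ~~ S a b c.
have tf : tri f by apply: triB.
have [lC ld le] := bd_cyclic tS.
have fS a b c c' : bd S a b -> f a b c -> f a b c' -> c = c'.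
  move=> /bd_ex[s Ss] /andP[H1 N1] /andP[H2 N2].
  apply: (d_le2 HD (SD _ _ _ Ss) H1 H2); by [apply: contraNneq N1 => <-|apply: contraNneq N2 => <-].
have EX a b c : f a b c (+) S a b c = D a b c.
  by rewrite /f; move: (SD a b c); case: (D a b c) (S a b c) => [] [] // H; rewrite H.
have bf a b : bd f a b = bd D a b (+) bd S a b.
  by rewrite -(eq_bd EX) bdD -addbA addbb addbF.
split.
- exact: tri_cone.
- move=> [a|] [b|] [c1|] [c2|] [c3|] //=.
  + by move=> H1 H2 H3 n12 n13; congr Some; exact: (d_le2 HD (proj1 (andP H1)) (proj1 (andP H2)) (proj1 (andP H3))).
  + by move=> H1 H2 H3 n12 _; case/eqP: n12; congr Some; exact: fS H3 H1 H2.
  + by move=> H1 H2 H3 _ n13; case/eqP: n13; congr Some; exact: fS H2 H1 H3.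
  + by move=> H1 H2 H3 _ _; congr Some; exact: fS H1 H2 H3.
  + by move=> H1 H2 H3 n12 n13; congr Some; exact: (deg2 a c1).
  by move=> H1 H2 H3 n12 n13; congr Some; exact: (deg2 b c1).
- move=> [a|] [b|].
  + by rewrite bd_cone bf addbCA addbb addbF (d_bd HD) -map_cons chain_map_Some.
  + rewrite bd_cone0r le chain_notin2; last by apply/mapP => -[].
    by rewrite /edge !andbF.
  + rewrite bd_cone0 le chain_notin //; by apply/mapP => -[].
  by rewrite bd_cone00 chain_notin //; apply/mapP => -[].
- by rewrite -map_cons (map_inj_uniq Some_inj) (d_uniq HD).
- by rewrite last_map (d_last HD).
- exact: (d_neq HD).
- move=> z [zs zd ze] zg.
  have zl a : z None (Some a) -> exists b, bd S a b.
    by move/zg; rewrite /gr orbF => /existsP[[b|]] //= H; exists b.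
  (* The passage of the cycle through the apex is rerouted along the rim [bd S]: the degree of [m]
     is odd exactly at the neighbours of the apex on the cycle. *)
  have [m [mC md mS me]] : exists m, [/\ forall a b, m a b = m b a, forall a, m a a = false,
      forall a b, m a b -> bd S a b & forall a, \big[addb/false]_b m a b = z None (Some a)].
    by apply: conn zl; move: (ze None); rewrite sumb_option zd.
  pose z' a b := z (Some a) (Some b) (+) m a b.
  have z'c : cyclic z'.
    split=> [a b|a|a]; rewrite /z' ?zd ?md // ?(zs (Some a)) ?(mC a) //.
    rewrite big_split /= me; move: (ze (Some a)); rewrite sumb_option zs.
    by rewrite addbC.
  have z'g a b : z' a b -> gr D x y a b.
    rewrite /z'; case M: (m a b).
      by move=> _; case/bd_ex: (mS _ _ M) => c /SD; exact: gr_tri.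
    rewrite addbF => /zg; rewrite /gr edge_Some => /orP[|->]; last by rewrite orbT.
    case/existsP=> -[c|] /= H; apply/orP; left; apply/existsP.
      by exists c; case/andP: H.
    by case/bd_ex: H => c /SD; exists c.
  have [X [tX XD bX]] := d_cyc HD z'c z'g.
  (* The filling in [D] may use triangles of [S]. Edges inside the patch are absent from the
     rerouted cycle, so the used part of [S] has its boundary on the rim, and the cone over that
     boundary replaces it. *)
  pose XS a b c := X a b c && S a b c.
  have tXS : tri XS by apply: triI.
  have [sXS dXS eXS] := bd_cyclic tXS.
  have bXS a b : bd XS a b -> bd S a b.
    move=> B; apply: contraT => NS; case/bd_ex: (B) => c /andP[Xc Sc].
    have [c' cc' Sc'] := not_bd_other (negbTE NS) Sc.
    have Nf d : f a b d = false.
      apply/negP => /andP[Dd NSd].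
      have := d_le2 HD (SD _ _ _ Sc) (SD _ _ _ Sc') Dd.
      rewrite eq_sym cc' => /(_ isT) E.
      by move: (NSd); rewrite -E ?Sc' //; apply: contraNneq NSd => <-.
    have : bd X a b = false.
      rewrite bX /z' (contraNF (mS a b) NS) addbF; apply/negP => /zg.
      rewrite /gr edge_Some => /orP[/existsP[[d|]]|E] /=.
      - by rewrite -/(f a b d) Nf.
      - by rewrite (negbTE NS).
      by move: (Nxy _ _ c E Sc); rewrite (negbTE NS).
    rewrite (bdIB X S) -/XS B /= => /negbT; rewrite negbK => /bd_ex[d /andP[Xd NSd]].
    by move: (Nf d); rewrite /f (XD _ _ _ Xd) NSd.
  exists (cone (fun a b c => X a b c && ~~ S a b c) (fun a b => m a b (+) bd XS a b)); split.
  + apply: tri_cone; first exact: triB.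
      by move=> a b; rewrite mC sXS.
    by move=> a; rewrite md dXS.
  + have H a b : m a b (+) bd XS a b -> bd S a b.
      by case M: (m a b); [rewrite (mS _ _ M)|move/bXS].
    by move=> [a|] [b|] [c|] //=; [by case/andP=> /XD -> ->|exact: H|exact: H|exact: H].
  move=> [a|] [b|]; last by rewrite zd bd_cone00.
  + rewrite bd_cone -addbA -bdIB bX /z'.
    by rewrite addbCA addbb addbF.
  + by rewrite bd_cone0r big_split /= me eXS addbF zs.
  by rewrite bd_cone0 big_split /= me eXS addbF.
move=> X tX XD bX.
pose g a b c := X (Some a) (Some b) (Some c).
pose m a b := X None (Some a) (Some b).
have EXg := cone_eta tX.
have tg : tri g by case: tX => h1 h2 h3; split=> *; [exact: h1|exact: h2|exact: h3].
have gf a b c : g a b c -> f a b c by exact: (XD (Some a) (Some b) (Some c)).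
have ms a b : m a b = m b a by rewrite /m (tri23 tX).
have md a : m a a = false by rewrite /m (tri_abb tX).
have mS a b : m a b -> bd S a b by exact: (XD None (Some a) (Some b)).
have mc : cyclic m.
  by split=> // a; apply: etrans (bX None (Some a)); rewrite (eq_bd EXg) bd_cone0.
have bg a b : bd g a b = m a b.
  have E : m a b (+) bd g a b = false by rewrite -(bX (Some a) (Some b)) (eq_bd EXg) bd_cone.
  by rewrite -[LHS]addFb -E -addbA addbb addbF.
suff [g0 m0] : (forall a b c, g a b c = false) /\ (forall a b, m a b = false).
  by move=> o1 o2 o3; rewrite EXg; case: o1 o2 o3 => [a|] [b|] [c|] //=; first [exact: g0|exact: m0].
(* The rim edges coned off by [X] form a cycle, hence none or all of the rim. In the second case
   exchanging the cone for [S] gives a 2-chain of [D] without boundary. *)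
case: (cyc m mc mS) => [m0|mS'].
  split=> //; apply: (d_inj HD tg).
    by move=> a b c /gf /andP[].
  by move=> a b; rewrite bg m0.
pose h a b c := g a b c (+) S a b c.
have h0 : forall a b c, h a b c = false.
  apply: (d_inj HD (triD tg tS)).
    by move=> a b c; rewrite /h; case G: (g a b c); [case/andP: (gf _ _ _ G)|move/SD].
  by move=> a b; rewrite bdD bg mS' addbb.
have g0 a b c : g a b c = false.
  move: (h0 a b c); rewrite /h; case G: (g a b c) => //.
  by case/andP: (gf _ _ _ G) => _ /negbTE ->.
by split=> // a b; rewrite -bg /bd big1.
Qed.
End Cone.

(** * Subdividing an interior edge *)

Section Subdivide.
Variable V : finType.
Implicit Types (a b c d e u v w x y : V) (p q s : seq V) (D S X : V -> V -> V -> bool).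

(** The 4-cycle u, d, c, e, seen as the complete bipartite graph between {u, c} and {d, e}. It
    bounds the two triangles on the edge uc. *)
Definition bip u c d e a b :=
  ((a == u) || (a == c)) && ((b == d) || (b == e)) || ((a == d) || (a == e)) && ((b == u) || (b == c)).

Lemma bdt_bip u c d e a b : uniq [:: u; c; d; e] ->
  bdt u c d a b (+) bdt u c e a b = bip u c d e a b.
Proof.
rewrite /= !inE !negb_or andbT => /and3P[/and3P[/eqP uc /eqP ud /eqP ue] /andP[/eqP cd /eqP ce] /eqP de].
rewrite /bdt /bip /edge.
by split_eq a u; split_eq a c; split_eq a d; split_eq a e; split_eq b u; split_eq b c;
  split_eq b d; split_eq b e.
Qed.

(** The quadrilateral formed by the two triangles on uc is replaced by the cone over its boundary,
    whose apex is the midpoint of uc. The edge uc disappears, all other edges survive, and so do the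
    triangles not containing both [u] and [c]. *)
Lemma disc_subdivide D x y q u c d e : disc D x y q -> u \notin x :: q -> D u c d -> D u c e -> d != e ->
  exists D' : option V -> option V -> option V -> bool,
  [/\ disc D' (Some x) (Some y) (map Some q),
    forall a b, gr D x y a b -> ~~ edge u c a b -> gr D' (Some x) (Some y) (Some a) (Some b),
    forall a b, gr D' (Some x) (Some y) (Some a) (Some b) -> gr D x y a b && ~~ edge u c a b,
    forall a, gr D' (Some x) (Some y) None (Some a) -> a \in [:: u; c; d; e] &
    forall a b f, D a b f -> ~~ edge u c a b -> ~~ edge u c a f -> ~~ edge u c b f ->
       D' (Some a) (Some b) (Some f)].
Proof.
move=> HD up Dd De de; have tD := d_tri HD.
have [uc ud cd] := tri_neq tD Dd; have [_ ue ce] := tri_neq tD De.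
have U : uniq [:: u; c; d; e] by rewrite /= !inE !negb_or uc ud ue cd ce de.
pose S a b f := tin u c d a b f (+) tin u c e a b f.
have tS : tri S by apply: triD; apply: tri_tin.
have bS a b : bd S a b = bip u c d e a b by rewrite bdD !bd_tin bdt_bip.
have SD a b f : S a b f -> D a b f.
  have [T|/negbTE N] := boolP (tin u c d a b f); first by move=> _; apply: (tin_sub uc cd ud tD Dd T).
  by rewrite /S N => /= T; apply: (tin_sub uc ce ue tD De T).
have ux : u != x by apply: contraNneq up => ->; rewrite mem_head.
have uy : u != y by apply: contraNneq up => ->; exact: (mem_last_q HD).
have eucxy a b : edge u c a b -> edge x y a b = false.
  by case/edgeP=> -[-> ->]; rewrite /edge (negbTE ux) (negbTE uy) ?andbF.
have Buc : bd D u c = false by apply: contraNF up => /(bd_mem HD)/andP[].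
have Sf : forall f, S u c f = D u c f.
  move=> f; rewrite /S !tinP // !eqxx (negbTE uc) (negbTE ud) (negbTE ue) (negbTE cd) (negbTE ce) [c == u]eq_sym (negbTE uc) /= !orbF.
  have [->|fd] := eqVneq f d; first by rewrite (negbTE de) Dd.
  have [->|fe] := eqVneq f e; first by rewrite De.
  apply/esym/negP => Df; move: fe; rewrite (d_le2 HD Dd Df De) ?eqxx //; by rewrite eq_sym.
have Sedge a b f : S a b f -> bip u c d e a b \/ edge u c a b.
  have [T _|/negbTE N] := boolP (tin u c d a b f).
    case/or3P: (tin_edge T); first by right.
      by case/edgeP=> -[-> ->]; left; rewrite /bip !eqxx ?orbT.
    by case/edgeP=> -[-> ->]; left; rewrite /bip !eqxx ?orbT.
  rewrite /S N => /= T; case/or3P: (tin_edge T); first by right.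
    by case/edgeP=> -[-> ->]; left; rewrite /bip !eqxx ?orbT.
  by case/edgeP=> -[-> ->]; left; rewrite /bip !eqxx ?orbT.
have HR : disc (cone (fun a b f => D a b f && ~~ S a b f) (bd S)) (Some x) (Some y) (map Some q).
  apply: disc_recone => //.
  - move=> a b1 b2 b3; rewrite !bS /bip; move: U; rewrite /= !inE !negb_or andbT.
    move=> /and3P[/and3P[/eqP nuc /eqP nud /eqP nue] /andP[/eqP ncd /eqP nce] /eqP nde].
    move=> h1 h2 h3 /eqP n12 /eqP n13; move: h1 h2 h3.
    by split_eq a u; split_eq a c; split_eq a d; split_eq a e; split_eq b1 u; split_eq b1 c;
      split_eq b1 d; split_eq b1 e; split_eq b2 u; split_eq b2 c;
      split_eq b2 d; split_eq b2 e; split_eq b3 u; split_eq b3 c;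
      split_eq b3 d; split_eq b3 e; rewrite //= => *; congruence.
  (* Each corner of a 4-cycle has exactly two of its edges, so a cycle inside it takes all four
     edges or none. *)
  - move=> m [ms md me] mS.
    have mB a b : m a b -> bip u c d e a b by rewrite -bS; exact: mS.
    have [du cu ec dc] : [/\ d != u, c != u, e != c & d != c] by rewrite !(eq_sym d) (eq_sym c) (eq_sym e).
    have [eu ed] : e != u /\ e != d by rewrite !(eq_sym e).
    have E1 : m u d = m u e.
      move: (me u); rewrite (@sumb_two _ _ d e) //; first by case: (m u d) (m u e) => [] [].
      move=> v vd ve; apply/negP => /mB.
      by rewrite /bip eqxx (negbTE ud) (negbTE ue) (negbTE vd) (negbTE ve).
    have E2 : m c d = m c e.
      move: (me c); rewrite (@sumb_two _ _ d e) //; first by case: (m c d) (m c e) => [] [].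
      move=> v vd ve; apply/negP => /mB.
      by rewrite /bip eqxx (negbTE cd) (negbTE ce) (negbTE vd) (negbTE ve) !andbF.
    have E3 : m u d = m c d.
      rewrite (ms u) (ms c).
      move: (me d); rewrite (@sumb_two _ _ u c) //; first by case: (m d u) (m d c) => [] [].
      move=> v vu vc; apply/negP => /mB.
      by rewrite /bip eqxx (negbTE du) (negbTE dc) (negbTE vu) (negbTE vc) !andbF.
    have bipP a b : bip u c d e a b -> m a b = m u d.
      case/orP=> /andP[] /orP[] /eqP-> /orP[] /eqP->; rewrite ?(ms d) ?(ms e) -?E1 -?E2 -?E3 //.
    case Em: (m u d); [right|left] => a b.
      rewrite bS; case B: (bip u c d e a b); first by rewrite bipP.
      by apply/negP => /mB; rewrite B.
    by apply/negP => /[dup] /mB /bipP ->; rewrite Em.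
  - move=> t t0 tS'.
    have [du cu ec dc] : [/\ d != u, c != u, e != c & d != c] by rewrite !(eq_sym d) (eq_sym c) (eq_sym e).
    have [eu ed] : e != u /\ e != d by rewrite !(eq_sym e).
    have tB a : t a -> a \in [:: u; c; d; e].
      case/tS' => b; rewrite bS !inE => /orP[] /andP[] /orP[] /eqP-> _; by rewrite eqxx ?orbT.
    have t4 : t u (+) (t c (+) (t d (+) t e)) = false.
      apply: etrans t0; rewrite (bigD1 u) // (bigD1 c) //= (bigD1 d) /= ?du ?dc // (bigD1 e) /= ?eu ?ec ?ed //.
      rewrite big1 ?addbF // => v /andP[/andP[/andP[vu vc] vd] ve].
      by apply/negP => /tB; rewrite !inE (negbTE vu) (negbTE vc) (negbTE vd) (negbTE ve).
    (* Along the path u, d, c, e each edge carries the parity of the elements of [t] before it; on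
       the last edge this is [t e], because [t] has even size. *)
    exists (fun a b => (t u && edge u d a b) (+) (((t u (+) t d) && edge d c a b) (+) (t e && edge c e a b))).
    split.
    + by move=> a b; rewrite !(edgeC _ _ a).
    + by move=> a; rewrite !edge_diag ?andbF.
    + move=> a b; rewrite bS => H.
      have : [|| edge u d a b, edge d c a b | edge c e a b].
        by move: H; do 3!case: edge; rewrite ?andbF.
      by case/or3P=> /edgeP[] [-> ->]; rewrite /bip !eqxx ?orbT ?andbT ?orbT.
    move=> a; rewrite !big_split /=.
    have H k v w : v != w -> \big[addb/false]_b (k && edge v w a b) = k && ((a == v) (+) (a == w)).
      by move=> vw; case: k; rewrite /= ?sumb_edge // big1.
    rewrite !H //.
    have [->|au] := eqVneq a u; first by rewrite (negbTE ud) (negbTE uc) (negbTE ue) /= !andbF !addbF andbT.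
    have [->|ac] := eqVneq a c.
      rewrite (negbTE cd) (negbTE ce) /=; move: t4.
      by case: (t u) (t c) (t d) (t e) => [] [] [] [].
    have [->|ad] := eqVneq a d.
      rewrite (negbTE de) /=; by case: (t u) (t d) (t e) => [] [] [].
    have [->|ae] := eqVneq a e; first by rewrite /= !andbF andbT.
    rewrite /= !andbF; apply/esym/negP => /tB.
    by rewrite !inE (negbTE au) (negbTE ac) (negbTE ad) (negbTE ae).
  move=> a b f Exy /Sedge[]; first by rewrite bS.
  by move/eucxy; rewrite Exy.
exists (cone (fun a b f => D a b f && ~~ S a b f) (bd S)); split=> //.
- move=> a b; rewrite /gr edge_Some => /orP[/existsP[f Df]|->]; last by rewrite orbT.
  move=> nuc; apply/orP; left; apply/existsP; have [Sf'|NS] := boolP (S a b f).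
    by exists None => /=; rewrite bS; case: (Sedge _ _ _ Sf') => // E; rewrite E in nuc.
  by exists (Some f) => /=; rewrite Df NS.
- move=> a b; rewrite /gr edge_Some => /orP[/existsP[[f|]]|Exy] /=.
  + case/andP=> Df NS; apply/andP; split; first by apply/orP; left; apply/existsP; exists f.
    apply: contra NS => /edgeP[] [E1 E2]; subst; first by rewrite Sf.
    by rewrite (tri12 tS) Sf (tri12 tD).
  + move=> B; case/bd_ex: (B) => f /SD Df; apply/andP; split.
      by apply/orP; left; apply/existsP; exists f.
    apply: contraL B => /edgeP[] [-> ->]; rewrite bS /bip.
      by rewrite eqxx (negbTE cd) (negbTE ce) (negbTE ud) (negbTE ue).
    by rewrite !eqxx (negbTE cd) (negbTE ce) (negbTE ud) (negbTE ue) !andbF.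
  by rewrite Exy orbT /=; apply: contraTN Exy => /eucxy ->.
- move=> a; rewrite /gr orbF => /existsP[[b|]] //=; rewrite bS !inE.
  by case/orP=> /andP[] /orP[] /eqP-> _; rewrite eqxx ?orbT.
move=> a b f Df n1 n2 n3 /=; rewrite Df; apply/negP.
have H T : c != T -> u != T -> tin u c T a b f = false.
  move=> cT uT; apply/negP => /(tin_cases uc cT uT).
  case=> [[E1 E2 E3]|[E1 E2 E3]|[E1 E2 E3]|[] [E1 E2 E3]]; subst; 
    by move: n1 n2 n3; rewrite ?edge_refl ?(edgeC _ _ c u) ?edge_refl.
by rewrite /S !H.
Qed.
End Subdivide.

(** * Contracting an interior edge *)

Section Contract.
Variable V : finType.
Implicit Types (a b c d e x y : V) (p q s : seq V) (D S X : V -> V -> V -> bool).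

(** The four faces would form a nonzero 2-chain without boundary. *)
Lemma no_tetrahedron D x y q u v b c : disc D x y q ->
  D u v b -> D u v c -> D u b c -> D v b c -> False.
Proof.
move=> HD H1 H2 H3 H4; have tD := d_tri HD.
have [uv ub vb] := tri_neq tD H1; have [_ uc vc] := tri_neq tD H2; have [_ _ bc] := tri_neq tD H3.
pose S a e f := (tin u v b a e f (+) tin u v c a e f) (+) (tin u b c a e f (+) tin v b c a e f).
have tS : tri S by do 2!apply: triD; apply: tri_tin.
have SD a e f : S a e f -> D a e f.
  have [T|/negbTE N1] := boolP (tin u v b a e f); first by move=> _; apply: (tin_sub uv vb ub tD H1 T).
  have [T|/negbTE N2] := boolP (tin u v c a e f); first by move=> _; apply: (tin_sub uv vc uc tD H2 T).
  have [T|/negbTE N3] := boolP (tin u b c a e f); first by move=> _; apply: (tin_sub ub bc uc tD H3 T).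
  by rewrite /S N1 N2 N3 => /= T; apply: (tin_sub vb bc vc tD H4 T).
have bS a e : bd S a e = false.
  transitivity ((bd (tin u v b) a e (+) bd (tin u v c) a e) (+) (bd (tin u b c) a e (+) bd (tin v b c) a e)).
    by rewrite -!bdD.
  rewrite !bd_tin /bdt.
  by case: (edge u v a e) (edge v b a e) (edge u b a e) (edge v c a e) (edge u c a e) (edge b c a e) => [] [] [] [] [] [].
have := d_inj HD tS SD bS u v b; rewrite /S.
have sy a e : a != e -> e == a = false by rewrite eq_sym => /negbTE.
by rewrite tin_refl // !tinP // !eqxx ?(negbTE uv) ?(negbTE ub) ?(negbTE uc) ?(negbTE vb) ?(negbTE vc)
  ?(negbTE bc) ?(sy _ _ uv) ?(sy _ _ ub) ?(sy _ _ uc) ?(sy _ _ vb) ?(sy _ _ vc) ?(sy _ _ bc).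
Qed.

Section Nice.
Variables (D : V -> V -> V -> bool) (x y : V) (q : seq V) (HD : disc D x y q) (u v : V).
Hypotheses (up : u \notin x :: q) (vp : v \notin x :: q) (Guv : gr D x y u v).
Hypothesis nice : forall c, gr D x y u c -> gr D x y v c -> D u v c.
Let tD := d_tri HD.

Let uv : u != v. Proof. by apply: contraTneq Guv => ->; rewrite (gr_irr HD). Qed.
Let vu : v != u. Proof. by rewrite eq_sym uv. Qed.

(** The image of a 2-chain under the simplicial map sending [v] to [u], with degenerate images
    dropped; [push1] does the same for 1-chains. Taking images mod 2 is what makes [push] commute
    with the boundary. *)
Definition push X a b c := [&& a != v, b != v, c != v, a != b, a != c, b != c &
  X a b c (+) (((a == u) && X v b c) (+) (((b == u) && X a v c) (+) ((c == u) && X a b v)))].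

Definition push1 (z : V -> V -> bool) a b := [&& a != v, b != v, a != b &
  z a b (+) (((a == u) && z v b) (+) ((b == u) && z a v))].

Lemma tri_push X : tri X -> tri (push X).
Proof.
move=> tX; split=> [a b c|a b c|a b]; rewrite /push.
- rewrite (eq_sym b a) (tri12 tX b a c) (tri12 tX v a c) (tri12 tX b v c) (tri12 tX b a v).
  case: (a != v) (b != v) (c != v) (a != b) (a != c) (b != c) => [] [] [] [] [] [] //=.
  by congr (_ (+) _); rewrite addbCA.
- rewrite (eq_sym c b) (tri23 tX a c b) (tri23 tX v c b) (tri23 tX a v b) (tri23 tX a c v).
  case: (a != v) (b != v) (c != v) (a != b) (a != c) (b != c) => [] [] [] [] [] [] //=.
  by congr (_ (+) (_ (+) _)); rewrite addbC.
by rewrite eqxx !andbF.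
Qed.

Lemma bd_push_u X b : tri X -> b != v -> b != u -> bd (push X) u b = bd X u b (+) bd X v b.
Proof.
move=> tX bv bu.
have E : (\big[addb/false]_c ((c == v) && X u b v) (+) \big[addb/false]_c ((c == u) && X v b u)) = false.
  rewrite (@sumb_eq1 _ _ v) => [|c /negbTE-> //]; rewrite (@sumb_eq1 _ _ u) => [|c /negbTE-> //].
  by rewrite !eqxx (tri13 tX v) addbb.
rewrite -[RHS]addbF -E /bd -!big_split; apply: eq_bigr => c _ /=.
rewrite /push uv bv (eq_sym u b) bu eqxx (negbTE bu) /=.
have [->|cv] := eqVneq c v; first by rewrite ?eqxx (negbTE vu) (tri_aba tX) /= ?andbF !addbF addbb.
have [->|cu] := eqVneq c u; first by rewrite (tri_aba tX) /= addbb.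
rewrite /= !addbF.
by have [->|_] := eqVneq b c; rewrite ?(tri_abb tX).
Qed.

Lemma bd_push X a b : tri X -> bd (push X) a b = push1 (bd X) a b.
Proof.
move=> tX; rewrite /push1.
have [->|av] := eqVneq a v; first by rewrite /bd big1 // => c _; rewrite /push eqxx.
have [->|bv] := eqVneq b v; first by rewrite /bd big1 // => c _; rewrite /push eqxx andbF.
have [->|ab] := eqVneq a b; first by rewrite /bd big1 // => c _; rewrite /push eqxx !andbF.
rewrite /=; have [au|au] := eqVneq a u.
  have bu : b != u by rewrite -au eq_sym.
  by subst a; rewrite bd_push_u // (negbTE bu) /= addbF.
have [bu|bu] := eqVneq b u.
  by subst b; rewrite (bdC (tri_push tX)) bd_push_u //= bdC // (bdC tX v).
rewrite /= addbF.
have E : (\big[addb/false]_c ((c == v) && X a b v) (+) \big[addb/false]_c ((c == u) && X a b v)) = false.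
  rewrite (@sumb_eq1 _ _ v) => [|c /negbTE-> //]; rewrite (@sumb_eq1 _ _ u) => [|c /negbTE-> //].
  by rewrite !eqxx addbb.
rewrite -[RHS]addbF -E /bd -!big_split; apply: eq_bigr => c _ /=.
rewrite /push av bv ab (negbTE au) (negbTE bu) /=.
have [->|cv] := eqVneq c v; first by rewrite (negbTE vu) /= addbF addbb.
have [E'|ac] := eqVneq a c; first by subst c; rewrite (tri_aba tX) /= (negbTE au).
have [E'|bc] := eqVneq b c; first by subst c; rewrite (tri_abb tX) /= (negbTE bu).
by rewrite /=; case: (c == u); case: (X a b v); case: (X a b c).
Qed.

Let D' := push D.
Let tD' : tri D'. Proof. exact: tri_push. Qed.

(** Otherwise [b] and [c] are common neighbours of [u] and [v], and [nice] completes a tetrahedron.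
    Hence the contraction never identifies two triangles, and nothing cancels in [push D]. *)
Let not_both b c : D u b c && D v b c = false.
Proof.
apply/negP => /andP[H1 H2]; apply: (no_tetrahedron HD _ _ H1 H2); apply: nice.
- exact: gr_tri H1.
- exact: gr_tri H2.
- by apply: (@gr_tri _ _ _ _ _ _ b); rewrite (tri23 tD).
by apply: (@gr_tri _ _ _ _ _ _ b); rewrite (tri23 tD).
Qed.

Let phi a := if a == v then u else a.

Let phi_id a : a != v -> phi a = a. Proof. by rewrite /phi => /negbTE->. Qed.

Let pushP X a b c : push X a b c -> exists a' b' c', [/\ X a' b' c', phi a' = a, phi b' = b & phi c' = c].
Proof.
case/andP=> av /and5P[bv cv ab ac /andP[bc]]; have pv : phi v = u by rewrite /phi eqxx.
case E: (X a b c); first by exists a, b, c; rewrite !phi_id.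
case: eqP => [au|_]; first case Ea: (X v b c).
- by exists v, b, c; split=> //; rewrite ?pv ?phi_id.
- case: eqP => [bu|_]; first by rewrite au bu eqxx in ab.
  by case: eqP => [cu|_] //; rewrite au cu eqxx in ac.
case: eqP => [bu|_]; first case Eb: (X a v c).
- by exists a, v, c; split=> //; rewrite ?pv ?phi_id.
- by case: eqP => [cu|_] //; rewrite bu cu eqxx in bc.
case: eqP => [cu|_] //= Ec.
by exists a, b, v; split=> //; rewrite ?pv ?phi_id.
Qed.

Let D'_D a b c : a \notin [:: u; v] -> b \notin [:: u; v] -> c \notin [:: u; v] -> D' a b c = D a b c.
Proof.
rewrite !inE !negb_or => /andP[au av] /andP[bu bv] /andP[cu cv].
rewrite /D' /push av bv cv (negbTE au) (negbTE bu) (negbTE cu) /= addbF.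
have [->|ab] := eqVneq a b; first by rewrite (tri_aa tD).
have [->|ac] := eqVneq a c; first by rewrite (tri_aba tD).
by have [->|bc] := eqVneq b c; first by rewrite (tri_abb tD).
Qed.

Let D'_u b c : b \notin [:: u; v] -> c \notin [:: u; v] -> D' u b c = D u b c || D v b c.
Proof.
rewrite !inE !negb_or => /andP[bu bv] /andP[cu cv].
rewrite /D' /push uv bv cv eqxx (negbTE bu) (negbTE cu) /= addbF ![u == _]eq_sym (negbTE bu) (negbTE cu) /=.
have [->|bc] := eqVneq b c; first by rewrite !(tri_abb tD).
by have := not_both b c; case: (D u b c) (D v b c) => [] [].
Qed.

Let D'_neqv a b c : D' a b c -> [/\ a != v, b != v & c != v].
Proof. by case/andP=> av /and5P[bv cv _ _ _]. Qed.

Let uvP d : d \in [:: u; v] -> phi d = u.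
Proof. by rewrite !inE /phi => /orP[/eqP->|/eqP->]; rewrite ?eqxx ?(negbTE uv). Qed.

Let nuvP d : d \notin [:: u; v] -> phi d = d.
Proof. by rewrite !inE negb_or /phi => /andP[_ /negbTE->]. Qed.

Let phi_eq e d : phi e = phi d -> e != d -> (e \in [:: u; v]) && (d \in [:: u; v]).
Proof.
have [e1|e1] := boolP (e \in _); have [d1|d1] := boolP (d \in _);
rewrite ?(uvP e1) ?(uvP d1) ?(nuvP e1) ?(nuvP d1) // => E.
- by rewrite -E inE eqxx in d1.
- by rewrite E inE eqxx in e1.
by rewrite E eqxx.
Qed.

Let D'_phi a b c : D a b c -> phi a != phi b -> phi a != phi c -> phi b != phi c ->
  D' (phi a) (phi b) (phi c).
Proof.
have W d e f : D d e f -> d \in [:: u; v] -> e \notin [:: u; v] -> f \notin [:: u; v] -> D' u e f.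
  by move=> H d1 e1 f1; rewrite D'_u //; move: d1 H; rewrite !inE => /orP[/eqP->|/eqP->] ->; rewrite ?orbT.
move=> H.
have [a1|a1] := boolP (a \in [:: u; v]); have [b1|b1] := boolP (b \in [:: u; v]);
have [c1|c1] := boolP (c \in [:: u; v]);
rewrite ?(uvP a1) ?(uvP b1) ?(uvP c1) ?(nuvP a1) ?(nuvP b1) ?(nuvP c1) ?eqxx // => _ _ _.
- exact: (W a).
- by rewrite (tri12 tD'); apply: (W b) => //; rewrite (tri12 tD).
- by rewrite (tri_rot tD') (tri_rot tD'); apply: (W c) => //; rewrite (tri_rot tD).
by rewrite D'_D.
Qed.

(** The hypothesis [nice] is the link condition: the common neighbours of [u] and [v] are the
    vertices opposite to uv. Both homological conditions are proved by lifting chains from the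
    contracted complex to [D], the freedom at the edge uv being used to correct parities. *)
Lemma disc_contract_nice : disc D' x y q /\
  forall a b, gr D x y a b -> phi a != phi b -> gr D' x y (phi a) (phi b).
Proof.
have px a : a \in x :: q -> phi a = a /\ a \notin [:: u; v].
  move=> ap; have av : a != v by apply: contraNneq vp => <-.
  have au : a != u by apply: contraNneq up => <-.
  by rewrite phi_id // !inE negb_or au av.
have [phx uvx] := px x (mem_head _ _).
have [phy uvy] := px y (mem_last_q HD).
have guv a b : a \in [:: u; v] -> edge x y a b = false.
  rewrite /edge => H; apply/negP => /orP[] /andP[/eqP E _]; by [rewrite -E H in uvx|rewrite -E H in uvy].
have bD0 a b : a \in [:: u; v] -> bd D a b = false.
  by move=> H; apply/negP => /(bd_mem HD)/andP[/px[_]]; rewrite H.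
have uin : u \in [:: u; v] by rewrite inE eqxx.
have vin : v \in [:: u; v] by rewrite !inE eqxx orbT.
split; last first.
  move=> a b /orP[/existsP[c Dc]|E] ne; last first.
    by apply/orP; right; case/edgeP: E => -[-> ->]; rewrite phx phy ?edge_refl // edgeC edge_refl.
  suff [d [Dd n1 n2]] : exists d, [/\ D a b d, phi a != phi d & phi b != phi d].
    exact: gr_tri (D'_phi Dd ne n1 n2).
  (* If the third vertex collapses onto an end of the edge, the triangle on the other side is used;
     it exists because [u] and [v] are interior. *)
  have other e f d : D e f d -> phi e != phi f -> phi e = phi d ->
      exists d', [/\ D e f d', phi e != phi d' & phi f != phi d'].
    move=> Dd nef Eed; have [ef ed fd] := tri_neq tD Dd.
    have /andP[ein din] := phi_eq Eed ed.
    have fnin : f \notin [:: u; v] by apply: contra nef => fin; rewrite !uvP.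
    have [d' dd' Dd'] := not_bd_other (bD0 e f ein) Dd.
    have [_ ed' fd'] := tri_neq tD Dd'.
    have d'n : d' \notin [:: u; v].
      move: ein din ed ed' dd'; rewrite !inE => /orP[] /eqP-> /orP[] /eqP->; rewrite ?eqxx // => _;
      by rewrite negb_or eq_sym => -> ->.
    exists d'; split=> //; rewrite (nuvP d'n); last by rewrite (nuvP fnin).
    by rewrite (uvP ein); apply: contraNneq d'n => <-.
  have [Ea|na] := eqVneq (phi a) (phi c); first exact: other Dc ne Ea.
  have [Eb|nb] := eqVneq (phi b) (phi c); last by exists c.
  have [||d' [Dd' n1 n2]] := other b a c _ _ Eb; [by rewrite (tri12 tD)|by rewrite eq_sym|].
  by exists d'; rewrite (tri12 tD).
have sp (F : V -> bool) : \big[addb/false]_c F c =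
    F u (+) (F v (+) \big[addb/false]_c ((c \notin [:: u; v]) && F c)).
  rewrite (bigD1 u) //=; congr (_ (+) _); rewrite (bigD1 v) //=; congr (_ (+) _).
  rewrite [LHS]big_mkcond; apply: eq_bigr => c _.
  by rewrite !inE negb_or; case: (c != u); case: (c != v).
have D'_u1 b c : b \notin [:: u; v] -> c \notin [:: u; v] -> D' u b c = D u b c (+) D v b c.
  by move=> b1 c1; rewrite D'_u //; move: (not_both b c); case: (D u b c) (D v b c) => [] [].
have nn b : b \notin [:: u; v] -> (b == u = false) * (b == v = false).
  by rewrite !inE negb_or => /andP[/negbTE-> /negbTE->].
have nD'v a b : D' v a b = false by rewrite /D' /push eqxx.
have ngv b : gr D' x y v b = false.
  rewrite /gr (guv v) // orbF; by apply/existsP => -[c]; rewrite nD'v.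
split=> //; [| |exact: d_uniq HD|exact: d_last HD|exact: d_neq HD| |].
- have nu a b c : a \notin [:: u; v] -> D' u a b -> D' u a c -> [/\ b \notin [:: u; v] & c \notin [:: u; v]].
    move=> an H1 H2; have [_ _ bv] := D'_neqv H1; have [_ _ cv] := D'_neqv H2.
    have [_ ub _] := tri_neq tD' H1; have [_ uc _] := tri_neq tD' H2.
    by rewrite !inE !negb_or bv cv eq_sym ub eq_sym uc.
  (* If triangles from both ua and va survive, [a] is a common neighbour, so uva is a triangle and
     takes one of the two places at ua and at va. One triangle is left on each side. *)
  have Hu a c1 c2 c3 : a \notin [:: u; v] -> D' u a c1 -> D' u a c2 -> D' u a c3 ->
      c1 != c2 -> c1 != c3 -> c2 = c3.
    move=> an H1 H2 H3 n12 n13; have [N1 N2] := nu _ _ _ an H1 H2; have [_ N3] := nu _ _ _ an H1 H3.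
    move: H1 H2 H3; rewrite !D'_u //.
    have uniqP k k' d d' : k' \in [:: u; v] -> D k a k' -> d \notin [:: u; v] ->
        d' \notin [:: u; v] -> D k a d -> D k a d' -> d = d'.
      move=> k'n Hk dn d'n H H'; apply: (d_le2 HD Hk H H').
        by apply: contraNneq dn => <-.
      by apply: contraNneq d'n => <-.
    have mixed d d' : D u a d -> D v a d' -> D u v a.
      by move=> H H'; apply: nice; [exact: gr_tri H|exact: gr_tri H'].
    have PP d d' e : d \notin [:: u; v] -> d' \notin [:: u; v] -> D u a d -> D u a d' -> D v a e -> d = d'.
      move=> dn d'n Hd Hd' He; apply: (uniqP u v) => //.
      by rewrite (tri23 tD); exact: (mixed _ _ Hd He).
    have QQ d d' e : d \notin [:: u; v] -> d' \notin [:: u; v] -> D v a d -> D v a d' -> D u a e -> d = d'.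
      move=> dn d'n Hd Hd' He; apply: (uniqP v u) => //.
      by rewrite -(tri_rot tD); exact: (mixed _ _ He Hd).
    move=> /orP[] H1 /orP[] H2 /orP[] H3.
    - exact: (d_le2 HD H1 H2 H3).
    - by move: n12; rewrite (PP _ _ _ N1 N2 H1 H2 H3) eqxx.
    - by move: n13; rewrite (PP _ _ _ N1 N3 H1 H3 H2) eqxx.
    - exact: (QQ _ _ _ N2 N3 H2 H3 H1).
    - exact: (PP _ _ _ N2 N3 H2 H3 H1).
    - by move: n13; rewrite (QQ _ _ _ N1 N3 H1 H3 H2) eqxx.
    - by move: n12; rewrite (QQ _ _ _ N1 N2 H1 H2 H3) eqxx.
    exact: (d_le2 HD H1 H2 H3).
  have inuv d : d \in [:: u; v] -> d != v -> d = u by rewrite !inE => /orP[/eqP->|/eqP->]; rewrite ?eqxx.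
  move=> a b c1 c2 c3 H1 H2 H3 n12 n13.
  have [av bv _] := D'_neqv H1.
  have [an|an] := boolP (a \in [:: u; v]).
    have Ea := inuv _ an av; subst a.
    have bn : b \notin [:: u; v].
      by apply/negP => bn; move: H1; rewrite (inuv _ bn bv) (tri_aa tD').
    exact: (Hu b c1 c2 c3).
  have [bn|bn] := boolP (b \in [:: u; v]).
    have Eb := inuv _ bn bv; subst b.
    by apply: (Hu a c1 c2 c3) => //; rewrite (tri12 tD').
  have lift c : D' a b c -> exists2 c', D a b c' & phi c' = c.
    case/pushP=> a1 [b1 [c' [Dc Ea Eb Ec]]]; exists c' => //.
    have Ea1 : a1 = a.
      apply/eqP; apply: contraT => ne; have := phi_eq (etrans Ea (esym (nuvP an))) ne.
      by rewrite (negbTE an) andbF.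
    have Eb1 : b1 = b.
      apply/eqP; apply: contraT => ne; have := phi_eq (etrans Eb (esym (nuvP bn))) ne.
      by rewrite (negbTE bn) andbF.
    by rewrite -Ea1 -Eb1.
  have [d1 D1 E1] := lift _ H1; have [d2 D2 E2] := lift _ H2; have [d3 D3 E3] := lift _ H3.
  rewrite -E2 -E3; congr phi; apply: (d_le2 HD D1 D2 D3).
    by apply: contraNneq n12 => E; rewrite -E1 -E2 E.
  by apply: contraNneq n13 => E; rewrite -E1 -E3 E.
- move=> a b; rewrite bd_push // -(d_bd HD) /push1 (bD0 v b vin) (bdC tD a v) (bD0 v a vin) !andbF addbF.
  have [->|av] := eqVneq a v; first by rewrite bD0.
  have [->|bv] := eqVneq b v; first by rewrite bdC // bD0.
  by have [->|_] := eqVneq a b; rewrite /= ?addbF ?(bd_diag tD).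
- move=> z [zs zd ze] zg.
  have zv b : z v b = false by apply: contraFF (ngv b) => /zg.
  have zv' b : z b v = false by rewrite zs.
  (* Lifting a cycle: an edge ub is lifted to ub when [D] has it and to vb otherwise. The
     coefficient [r] of uv restores even degree at [u], and then at [v] as well. *)
  pose r := \big[addb/false]_b ((b \notin [:: u; v]) && (z u b && gr D x y u b)).
  pose z' a b :=
    if a == u then (if b == v then r else z u b && gr D x y u b)
    else if a == v then (if b == u then r else z u b && ~~ gr D x y u b)
    else if b == u then z u a && gr D x y u a
    else if b == v then z u a && ~~ gr D x y u a
    else z a b.
  have z'n a b : a \notin [:: u; v] -> b \notin [:: u; v] -> z' a b = z a b.
    by move=> /nn[au av] /nn[bu bv]; rewrite /z' au av bu bv.
  have z'u b : b \notin [:: u; v] -> z' u b = z u b && gr D x y u b.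
    by move=> /nn[bu bv]; rewrite /z' eqxx bv.
  have z'v b : b \notin [:: u; v] -> z' v b = z u b && ~~ gr D x y u b.
    by move=> /nn[bu bv]; rewrite /z' eqxx (negbTE vu) bu.
  have z'uv : z' u v = r by rewrite /z' !eqxx.
  have z'vu : z' v u = r by rewrite /z' !eqxx (negbTE vu).
  have z'd a : z' a a = false.
    rewrite /z'; have [->|au] := eqVneq a u; first by rewrite (negbTE uv) zd.
    by have [->|av] := eqVneq a v; rewrite ?zv' ?(negbTE vu) //.
  have z's a b : z' a b = z' b a.
    rewrite /z'; case: (eqVneq a u) => [Ea|_]; case: (eqVneq b u) => [Eb|_]; rewrite ?Ea ?Eb //.
    by case: (eqVneq a v) => [Ea|_]; case: (eqVneq b v) => [Eb|_]; rewrite ?Ea ?Eb // zs.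
  have zc : cyclic z'.
    split=> // a; rewrite sp.
    have [an|an] := boolP (a \in [:: u; v]).
      move: an; rewrite !inE => /orP[] /eqP->.
        rewrite z'd z'uv addFb /r -big_split /= big1 // => b _.
        by case: (boolP (b \in _)) => //= bn; rewrite z'u // addbb.
      rewrite z'd z'vu addFb; apply: etrans (ze u); rewrite [RHS]sp zd zv' !addFb /r -big_split /=.
      apply: eq_bigr => b _; case: (boolP (b \in _)) => //= bn; rewrite z'v //.
      by case: (z u b) (gr D x y u b) => [] [].
    rewrite (z's a u) (z's a v) z'u // z'v // addbA.
    rewrite (_ : (_ && _) (+) (_ && _) = z a u); last by rewrite (zs a); case: (z u a) (gr D x y u a) => [] [].
    apply: etrans (ze a); rewrite [RHS]sp zv' addFb; congr (_ (+) _).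
    by apply: eq_bigr => b _; case: (boolP (b \in _)) => //= bn; rewrite z'n.
  have gruv b : b \notin [:: u; v] -> z u b -> gr D x y u b || gr D x y v b.
    move=> bn /zg; rewrite /gr (guv u) // orbF (guv v) // !orbF => /existsP[c].
    move=> Dc; have cn : c \notin [:: u; v].
      have [_ _ cv] := D'_neqv Dc; have [_ uc _] := tri_neq tD' Dc.
      by rewrite !inE negb_or cv eq_sym uc.
    by move: Dc; rewrite D'_u // => /orP[] H; apply/orP; [left|right]; apply/existsP; exists c.
  have z'g a b : z' a b -> gr D x y a b.
    wlog bn : a b / (b \notin [:: u; v]) => [H|].
      case: (boolP (b \in [:: u; v])) => bn; last exact: H.
      case: (boolP (a \in [:: u; v])) => an; last by rewrite z's (gr_sym HD); exact: H.
      move: an bn; rewrite !inE => /orP[] /eqP-> /orP[] /eqP->; rewrite ?z'd // (gr_sym HD) //.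
    case: (boolP (a \in [:: u; v])) => an.
      move: an; rewrite !inE => /orP[] /eqP->; first by rewrite z'u // => /andP[].
      by rewrite z'v // => /andP[/(gruv _ bn)/orP[->|]].
    rewrite z'n // => /zg; rewrite /gr => /orP[/existsP[c /pushP[a1 [b1 [c1 [Dc Ea Eb _]]]]]|->]; last by rewrite orbT.
    have Ea1 : a1 = a.
      apply/eqP; apply: contraT => ne; have := phi_eq (etrans Ea (esym (nuvP an))) ne.
      by rewrite (negbTE an) andbF.
    have Eb1 : b1 = b.
      apply/eqP; apply: contraT => ne; have := phi_eq (etrans Eb (esym (nuvP bn))) ne.
      by rewrite (negbTE bn) andbF.
    by apply/orP; left; apply/existsP; exists c1; rewrite -Ea1 -Eb1.
  have [X [tX XD bX]] := d_cyc HD zc z'g.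
  exists (push X); split; first exact: tri_push.
    move=> a b c /[dup] H /pushP[a1 [b1 [c1 [Xc Ea Eb Ec]]]].
    have [n1 n2 n3] := tri_neq (tri_push tX) H.
    by rewrite -Ea -Eb -Ec; apply: D'_phi; rewrite ?Ea ?Eb ?Ec //; exact: XD.
  move=> a b; rewrite bd_push // /push1 !bX.
  have [->|av] := eqVneq a v; first by rewrite zv.
  have [->|bv] := eqVneq b v; first by rewrite zv'.
  have [->|ab] := eqVneq a b; first by rewrite zd.
  have nin c : c != u -> c != v -> c \notin [:: u; v] by rewrite !inE negb_or => -> ->.
  have [Ea|au] := eqVneq a u.
    have bu : b != u by rewrite -Ea eq_sym.
    rewrite Ea (negbTE bu) z'u ?z'v ?nin //=; by case: (z u b) (gr D x y u b) => [] [].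
  have [Eb|bu] := eqVneq b u; last by rewrite /= addbF z'n ?nin.
  have an := nin a au av; rewrite Eb /= (z's a u) (z's a v) (z'u a an) (z'v a an) (zs a u).
  by case: (z u a) (gr D x y u a) => [] [].
move=> X tX XD bX.
have Xv b c : X v b c = false by apply/negP => /XD; rewrite nD'v.
have Xbv b c : X b v c = false by rewrite (tri12 tX).
have Xbcv b c : X b c v = false by rewrite (tri23 tX).
(* Lifting a 2-chain: triangles not containing both [u] and [v] inherit their coefficient, and [t w]
   is the coefficient of uvw that cancels the boundary at uw. It also works at vw because the
   boundary of [X] vanishes at uw, and the edge uv is settled by [bd_bd]. *)
pose t w := \big[addb/false]_d ((d \notin [:: u; v]) && (D u w d && X u w d)).
pose T a b c := ((a \notin [:: u; v]) && t a) (+) (((b \notin [:: u; v]) && t b) (+) ((c \notin [:: u; v]) && t c)).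
pose both a b c := [|| a == u, b == u | c == u] && [|| a == v, b == v | c == v].
pose Y a b c := D a b c && (if both a b c then T a b c else X (phi a) (phi b) (phi c)).
have both12 a b c : both a b c = both b a c by rewrite /both orbCA [X in _ && X]orbCA.
have both23 a b c : both a b c = both a c b by rewrite /both [(b == u) || _]orbC [(b == v) || _]orbC.
have T12 a b c : T a b c = T b a c by rewrite /T addbCA.
have T23 a b c : T a b c = T a c b by rewrite /T [X in _ (+) X]addbC.
have tY : tri Y.
  split=> [a b c|a b c|a b]; rewrite /Y ?(tri_aa tD) //.
    by rewrite (tri12 tD) (tri12 tX) both12 T12.
  by rewrite (tri23 tD) (tri23 tX) both23 T23.
have both1 a b c : b \notin [:: u; v] -> c \notin [:: u; v] -> both a b c = false.
  move=> /nn[bu bv] /nn[cu cv]; rewrite /both bu bv cu cv !orbF.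
  by apply/negP => /andP[/eqP-> /eqP E]; have := uv; rewrite E eqxx.
have Y1 b c : b \notin [:: u; v] -> c \notin [:: u; v] -> Y u b c = D u b c && X u b c.
  by move=> bn cn; rewrite /Y both1 // (uvP uin) !nuvP.
have Y2 b c : b \notin [:: u; v] -> c \notin [:: u; v] -> Y v b c = D v b c && X u b c.
  by move=> bn cn; rewrite /Y both1 // (uvP vin) !nuvP.
have Y0 a b c : a \notin [:: u; v] -> b \notin [:: u; v] -> c \notin [:: u; v] -> Y a b c = X a b c.
  move=> an bn cn; rewrite /Y both1 // !nuvP //; case Xc: (X a b c); last by rewrite andbF.
  by move/XD: Xc; rewrite D'_D // => ->.
have Y3 b : b \notin [:: u; v] -> Y u b v = D u v b && t b.
  move=> bn; rewrite /Y /T /both !eqxx orbT bn uin vin /= !orbT addbF.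
  by rewrite (tri23 tD).
have Y4 b : b \notin [:: u; v] -> Y v b u = D u v b && t b.
  by move=> bn; rewrite (tri13 tY) Y3.
have XDo b c : b \notin [:: u; v] -> c \notin [:: u; v] -> X u b c = (D u b c && X u b c) (+) (D v b c && X u b c).
  move=> bn cn; case Xc: (X u b c); last by rewrite !andbF.
  by move/XD: Xc; rewrite D'_u1 // !andbT.
have sX b : b \notin [:: u; v] -> \big[addb/false]_c ((c \notin [:: u; v]) && X u b c) = false.
  by move=> bn; rewrite -[RHS](bX u b) [RHS]sp Xbcv (tri_aba tX) !addFb.
have t0 b : b \notin [:: u; v] -> D u v b = false -> t b = false.
  move=> bn Nb; case gu: (gr D x y u b); last first.
    rewrite /t big1 // => c _; case Dc: (D u b c); last by rewrite andbF.
    by rewrite (gr_tri x y Dc) in gu.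
  rewrite -(sX b bn); apply: eq_bigr => c _; case: (boolP (c \in _)) => //= cn.
  rewrite [RHS]XDo //; case Dc: (D v b c); last by rewrite addbF.
  by rewrite (nice gu (gr_tri x y Dc)) in Nb.
have bYu b : b \notin [:: u; v] -> bd Y u b = false.
  move=> bn; rewrite /bd sp (tri_aba tY) Y3 // addFb.
  rewrite (_ : \big[addb/false]_c _ = t b); last first.
    by apply: eq_bigr => c _; case: (boolP (c \in _)) => //= cn; rewrite Y1.
  by case Nb: (D u v b); [rewrite addbb|rewrite (t0 b)].
have bYv b : b \notin [:: u; v] -> bd Y v b = false.
  move=> bn; rewrite /bd sp (tri_aba tY) Y4 // addFb.
  rewrite (_ : \big[addb/false]_c _ = t b).
    by case Nb: (D u v b); [rewrite addbb|rewrite (t0 b)].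
  apply/esym; rewrite -[LHS]addbF -[X in _ (+) X](sX b bn) /t -big_split; apply: eq_bigr => c _ /=.
  case: (boolP (c \in _)) => //= cn; rewrite Y2 //.
  by rewrite [X in _ (+) X]XDo // addKb.
have bY0 a b : a \notin [:: u; v] -> b \notin [:: u; v] -> bd Y a b = false.
  move=> an bn; rewrite -[RHS](bX a b) /bd [LHS]sp [RHS]sp Xbcv addFb addbA; congr (_ (+) _).
    rewrite (tri_rot tY a b u) (tri_rot tY a b v) (tri_rot tX a b u).
    rewrite (tri_rot tY b u a) (tri_rot tY b v a) (tri_rot tX b u a).
    by rewrite Y1 // Y2 // -XDo.
  by apply: eq_bigr => c _; case: (boolP (c \in _)) => //= cn; rewrite Y0.
have bYn a b : b \notin [:: u; v] -> bd Y a b = false.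
  move=> bn; have [|an] := boolP (a \in [:: u; v]); last exact: bY0.
  by rewrite !inE => /orP[] /eqP->; [exact: bYu|exact: bYv].
have bYuv : bd Y u v = false.
  have := bd_bd tY u; rewrite sp (bd_diag tY) addFb big1 ?addbF // => b _.
  by case: (boolP (b \in _)) => //= bn; exact: bYn.
have bY a b : bd Y a b = false.
  have [|bn] := boolP (b \in [:: u; v]); last exact: bYn.
  have [|an] := boolP (a \in [:: u; v]); last by move=> _; rewrite bdC // bYn.
  rewrite !inE => /orP[] /eqP-> /orP[] /eqP->; rewrite ?(bd_diag tY) //.
  by rewrite bdC.
have YF := d_inj HD tY (fun a b c (h : Y a b c) => proj1 (andP h)) bY.
have Xu b c : X u b c = false.
  apply/negP => Xc; have [bu cu _] := tri_neq tX Xc; have [_ bv cv] := D'_neqv (XD _ _ _ Xc).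
  have bn : b \notin [:: u; v] by rewrite !inE negb_or eq_sym bu.
  have cn : c \notin [:: u; v] by rewrite !inE negb_or eq_sym cu.
  move/XD: (Xc); rewrite D'_u // => /orP[] H.
    by move: (YF u b c); rewrite Y1 // H Xc.
  by move: (YF v b c); rewrite Y2 // H Xc.
move=> a b c; have [|an] := boolP (a \in [:: u; v]).
  by rewrite !inE => /orP[] /eqP->; rewrite ?Xu ?Xv.
have [|bn] := boolP (b \in [:: u; v]).
  by rewrite !inE => /orP[] /eqP->; rewrite (tri12 tX) ?Xu ?Xv.
have [|cn] := boolP (c \in [:: u; v]).
  by rewrite !inE => /orP[] /eqP->; rewrite (tri13 tX) ?Xu ?Xv.
by rewrite -Y0.
Qed.
End Nice.
End Contract.

Definition merge (V : eqType) (u v a : V) := if a == v then u else a.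

(* A common neighbour c of u and v that is not opposite to uv would give a double edge: the edge uc is
   subdivided first. *)
Lemma disc_contract (V : finType) (D : V -> V -> V -> bool) x y q u v : disc D x y q ->
  u \notin x :: q -> v \notin x :: q -> gr D x y u v ->
  exists (V' : finType) (i : V -> V') (D' : V' -> V' -> V' -> bool),
    [/\ injective i, disc D' (i x) (i y) (map i q) &
      forall a b, gr D x y a b -> merge u v a != merge u v b ->
        gr D' (i x) (i y) (i (merge u v a)) (i (merge u v b))].
Proof.
pose bad (V : finType) (D : V -> V -> V -> bool) x y u v :=
  [pred c | [&& gr D x y u c, gr D x y v c & ~~ D u v c]].
have [n] := ubnP #|bad V D x y u v|; elim: n => // n IH in V D x y q u v * => Bn HD up vp Guv.
have tD := d_tri HD.
have [c|N] := pickP (bad V D x y u v); last first.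
  have nice c : gr D x y u c -> gr D x y v c -> D u v c.
    by move=> H1 H2; move: (N c); rewrite /= H1 H2 /= => /negbFE.
  have [H1 H2] := disc_contract_nice HD up vp Guv nice.
  by exists V, id, (push u v D); split=> //; rewrite map_id.
move=> /and3P[Guc Gvc Nuvc].
have uv : u != v by apply: contraTneq Guv => ->; rewrite (gr_irr HD).
have vc : v != c by apply: contraTneq Gvc => ->; rewrite (gr_irr HD).
have uc : u != c by apply: contraTneq Guc => ->; rewrite (gr_irr HD).
have Buc : bd D u c = false by apply: contraNF up => /(bd_mem HD) /andP[].
have ux : u != x by apply: contraNneq up => ->; rewrite mem_head.
have uy : u != y by apply: contraNneq up => ->; exact: (mem_last_q HD).
have [d Dd] : exists d, D u c d.
  by case/orP: Guc => [/existsP|/edgeP[] [E _]] //; rewrite E eqxx in ux uy.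
have [e ed De] := not_bd_other Buc Dd.
rewrite eq_sym in ed.
have [D1 [H1 g1 g2 g3 g4]] := disc_subdivide HD up Dd De ed.
have ueuc a b : a != u -> b != u -> edge u c a b = false.
  by move=> /negbTE au /negbTE bu; rewrite /edge au bu andbF.
have Guv1 : gr D1 (Some x) (Some y) (Some u) (Some v).
  by apply: g1 => //; rewrite /edge eqxx (negbTE vc) (negbTE uc).
have sp w : w \notin x :: q -> Some w \notin Some x :: map Some q.
  by rewrite -map_cons (mem_map Some_inj).
have [|V' [i [D' [ii H' G']]]] := IH _ D1 (Some x) (Some y) (map Some q) (Some u) (Some v) _ H1 (sp _ up) (sp _ vp) Guv1.
  rewrite -ltnS; apply: leq_trans Bn; rewrite ltnS.
  (* The new vertex is adjacent only to [u], [c], [d], [e], and [v] is none of them since uvc is not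
     a triangle. So no bad vertex is created, while [c] ceases to be one. *)
  have -> : #|bad (option V) D1 (Some x) (Some y) (Some u) (Some v)| =
     #|[pred a | bad (option V) D1 (Some x) (Some y) (Some u) (Some v) (Some a)]|.
    pose B1 := [pred a | bad (option V) D1 (Some x) (Some y) (Some u) (Some v) (Some a)].
    transitivity #|image Some B1|; last exact: (card_image Some_inj).
    apply: eq_card => -[a|].
      by rewrite (mem_image Some_inj) inE.
    rewrite [RHS](_ : _ = false); last by apply/negP => /imageP[].
    apply/negP => /and3P[_ Gv _].
    have := g3 v; rewrite (gr_sym H1) => /(_ Gv); rewrite !inE (negbTE vc) ![v == u]eq_sym (negbTE uv) /=.
    by move=> /orP[] /eqP E; move: Nuvc; rewrite E (tri23 tD) ?Dd ?De.
  apply: proper_card; apply/properP; split.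
    apply/subsetP => a; rewrite !inE => /and3P[Ga Gb NE].
    have /andP[-> ea] := g2 _ _ Ga; have /andP[-> eb] := g2 _ _ Gb => /=.
    apply: contra NE => Da; apply: g4 => //.
    by rewrite /edge eqxx (negbTE vc) (negbTE uc).
  exists c; first by rewrite !inE Guc Gvc Nuvc.
  by rewrite !inE; apply/negP => /andP[/g2]; rewrite edge_refl andbF.
exists V', (i \o Some), D'; split.
- by move=> a b /ii [].
- by rewrite map_comp.
have ms a : merge (Some u) (Some v) (Some a) = Some (merge u v a).
  by rewrite /merge; case: (eqVneq a v) => [->|ne]; rewrite ?eqxx //; case: eqP => // -[E]; rewrite E eqxx in ne.
move=> a b Gab ne /=; rewrite -!ms.
(* The subdivided edge uc is lost, but vc survives and takes its place once [u] and [v] are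
   merged. *)
have Gu : gr D' (i (Some x)) (i (Some y)) (i (merge (Some u) (Some v) (Some u))) (i (merge (Some u) (Some v) (Some c))).
  have := G' (Some v) (Some c); rewrite !ms /merge eqxx (negbTE uv) ![c == v]eq_sym (negbTE vc).
  apply; first by apply: g1 => //; rewrite ueuc // 1?eq_sym // eq_sym.
  by apply: contra uc => /eqP [->].
have [/edgeP[] [-> ->]|Ne] := boolP (edge u c a b); first exact: Gu.
  by rewrite (gr_sym H'); exact: Gu.
by apply: G'; [exact: g1|rewrite !ms; apply: contra ne => /eqP [->]].
Qed.

Definition classrel (V : finType) (W : eqType) (D : V -> V -> V -> bool) x y (lab : V -> option W) w : rel V :=
  fun a b => [&& gr D x y a b, lab a == Some w & lab b == Some w].

(** Every class is contracted to a point, one edge at a time; each contraction lowers the number of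
    labelled vertices. Labels stay off the boundary so that only interior edges are contracted. The
    last clause keeps an edge leaving each class, which later shows that the class is placed even
    when it is adjacent to no other class. *)
Lemma disc_minor (W : eqType) (V : finType) (D : V -> V -> V -> bool) x y q (lab : V -> option W) :
  disc D x y q -> (forall a, a \in x :: q -> lab a = None) ->
  (forall w a b, lab a = Some w -> lab b = Some w -> connect (classrel D x y lab w) a b) ->
  exists (V' : finType) (D' : V' -> V' -> V' -> bool) x' y' q' (lab' : V' -> option W),
    [/\ disc D' x' y' q',
      forall a b w, lab' a = Some w -> lab' b = Some w -> a = b,
      forall a w, lab a = Some w -> exists a', lab' a' = Some w,
      forall a b w w', gr D x y a b -> lab a = Some w -> lab b = Some w' -> w <> w' ->
        exists a' b', [/\ gr D' x' y' a' b', lab' a' = Some w & lab' b' = Some w'] &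
      forall a b w, gr D x y a b -> lab a = Some w -> lab b <> Some w ->
        exists a' b', gr D' x' y' a' b' /\ lab' a' = Some w].
Proof.
have [n] := ubnP #|[pred a | isSome (lab a)]|; elim: n => // n IH in V D x y q lab * => Ln HD lbd conn.
have [/existsP[u /existsP[b /and3P[ub lu /eqP lub]]]|N] :=
  boolP [exists a, exists b, [&& a != b, isSome (lab a) & lab a == lab b]]; last first.
  exists V, D, x, y, q, lab; split=> //.
  - move=> a b w la lb; apply/eqP; apply: contraNT N => ne.
    by apply/existsP; exists a; apply/existsP; exists b; rewrite ne la lb eqxx.
  - by move=> a w la; exists a.
  - by move=> a b w w' Gab la lb _; exists a, b.
  by move=> a b w Gab la _; exists a, b.
case lu': (lab u) lu => [w|] // _; rewrite lu' in lub.
have [v [Guv lv]] : exists v, gr D x y u v /\ lab v = Some w.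
  case/connectP: (conn w u b lu' (esym lub)) => -[|v s] /=; first by move=> _ E; rewrite E eqxx in ub.
  by case/andP=> /and3P[G _ /eqP lv] _ _; exists v.
have uv : u != v by apply: contraTneq Guv => ->; rewrite (gr_irr HD).
have up : u \notin x :: q by apply/negP => /lbd; rewrite lu'.
have vp : v \notin x :: q by apply/negP => /lbd; rewrite lv.
have [V1 [i [D1 [ii H1 G1]]]] := disc_contract HD up vp Guv.
(* Vertices created by subdivisions are unlabelled, and so is the image of [v], whose role is taken
   over by [u]. *)
pose lab1 o := if [pick a | (i a == o) && (a != v)] is Some a then lab a else None.
have l1 a : a != v -> lab1 (i a) = lab a.
  move=> av; rewrite /lab1; case: pickP => [c /andP[/eqP/ii -> _] //|/(_ a)].
  by rewrite eqxx av.
have l1ex o w' : lab1 o = Some w' -> exists a, [/\ o = i a, a != v & lab a = Some w'].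
  by rewrite /lab1; case: pickP => // a /andP[/eqP <- av] la; exists a.
have lm a : lab (merge u v a) = lab a.
  by rewrite /merge; case: eqP => // ->; rewrite lu' lv.
have mv a : merge u v a != v by rewrite /merge; case: (eqVneq a v).
have l1m a : lab1 (i (merge u v a)) = lab a by rewrite l1 // lm.
have mid a : a != v -> merge u v a = a by rewrite /merge => /negbTE->.
have [| | |V' [D' [x' [y' [q' [lab' [H' P1 P2 P3 P4]]]]]]] := IH V1 D1 (i x) (i y) (map i q) lab1 _ H1.
- rewrite -ltnS; apply: leq_trans Ln; rewrite ltnS.
  apply: (@leq_ltn_trans #|[pred a | (a != v) && lab a]|).
    rewrite -(card_image ii); apply/subset_leq_card/subsetP => o; rewrite inE.
    case lo: (lab1 o) => [w'|] // _; have [a [-> av la]] := l1ex _ _ lo.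
    by rewrite (mem_image ii) inE av la.
  apply: proper_card; apply/properP; split; first by apply/subsetP => a; rewrite !inE => /andP[].
  by exists v; rewrite !inE ?lv ?eqxx.
- move=> o; rewrite -map_cons => /mapP[a ap ->]; rewrite l1 ?lbd //.
  by apply: contraNneq vp => <-.
- move=> w' o1 o2 /l1ex[a [-> av la]] /l1ex[c [-> cv lc]].
  rewrite -(mid a av) -(mid c cv).
  case/connectP: (conn w' a c la lc) => s Ps ->.
  elim: s a {av la} Ps => [|d s IHs] a /=; first by move=> _; exact: connect0.
  case/andP=> /and3P[Gad /eqP la /eqP ld] /IHs; apply: connect_trans.
  have [->|ne] := eqVneq (merge u v a) (merge u v d); first exact: connect0.
  by apply: connect1; rewrite /classrel !l1m la ld !eqxx !andbT G1.
exists V', D', x', y', q', lab'; split=> //.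
- by move=> a w' la; apply: (P2 (i (merge u v a))); rewrite l1m.
- move=> a c w1 w2 Gac la lc ww.
  apply: (P3 (i (merge u v a)) (i (merge u v c))) => //; rewrite ?l1m //.
  apply: G1 => //; apply: contra_notN ww => /eqP E.
  by apply: Some_inj; rewrite -la -lc -lm E lm.
move=> a c w1 Gac la lc.
apply: (P4 (i (merge u v a)) (i (merge u v c))) => //; rewrite ?l1m //.
by apply: G1 => //; apply: contra_notN lc => /eqP E; rewrite -lm -E lm.
Qed.

(** * Building discs row by row *)

Section Grid.
Variable V : finType.
Implicit Types (a b c u v w x y : V) (p q l : seq V) (D : V -> V -> V -> bool).

Lemma disc_empty x y : x != y -> disc (fun _ _ _ => false) x y [:: y].
Proof.
move=> xy; split=> //.
- by move=> a b; rewrite /bd big1 //= addbF addbb.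
- by rewrite /= inE xy.
2: by move=> X tX XD _ a b c; apply/negP => /XD.
move=> z [zs zd ze] zg; exists (fun _ _ _ => false); split=> // a b.
have zg' c d : z c d -> edge x y c d by move/zg; rewrite /gr => /orP[/existsP[]|].
have zxy : z x y = false.
  rewrite -[RHS](ze x) (@sumb_eq1 _ _ y) // => d dy; apply/negP => /zg' /edgeP[] [E1 E2].
    by rewrite E2 eqxx in dy.
  by rewrite E1 eqxx in xy.
rewrite /bd big1 //; apply/esym/negP => /[dup] H /zg' /edgeP[] [E1 E2]; subst; last rewrite zs in H.
  by rewrite zxy in H.
by rewrite zxy in H.
Qed.

(** The exceptional case is that of the base edge. The boundary path then consists of xy alone, so
    the boundary of [D] is zero and [D] is empty. *)
Lemma consecutive_unique D x y q l1 u w l2 : disc D x y q -> x :: q = l1 ++ u :: w :: l2 ->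
  forall c c', D u w c -> D u w c' -> c = c'.
Proof.
move=> HD E c c' H H'; have tD := d_tri HD.
have [B|N] := boolP (edge x y u w); last first.
  exact: (bd_unique HD (boundary_edge HD E N) H' H).
have U := d_uniq HD; rewrite E in U.
have Ew : x = u /\ y = w.
  case: l1 E U => [[]|a l1] //=.
    move=> Ex _ /andP[uq _]; case/edgeP: B => -[E1 E2]; first by rewrite E1 E2.
    by rewrite E2 Ex inE eqxx in uq.
  case=> Ex _ /andP[]; rewrite mem_cat !inE !negb_or => /and4P[_ /negbTE xu /negbTE xw _] _.
  by move: B; rewrite /edge Ex ![_ == a]eq_sym xu xw andbF.
case: Ew => Ex Ey; have q1 : q = [:: y].
  case: l1 E U => [[]|a l1] //=.
    move=> _ Eq; have L := d_last HD; rewrite Eq /= in L.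
    case: l2 Eq L => [|b l2] Eq L; first by rewrite Eq Ey.
    rewrite /= => /and3P[_]; rewrite -Ey -L /=.
    by move=> /negP[]; rewrite mem_last.
  by case=> Ea _ /andP[]; rewrite -Ea Ex mem_cat mem_head orbT.
have := d_inj HD tD (fun a b c h => h); rewrite q1 in HD => D0.
by move: H; rewrite D0 // => a b; rewrite (d_bd HD) /= addbF addbb.
Qed.

(** With [disc_fill], the two uses of [disc_attach]; they are the counterparts for discs of
    [stacked_add] and [stacked_fill]. *)
Lemma disc_add D x y q l1 u w l2 v : disc D x y q -> x :: q = l1 ++ u :: w :: l2 ->
  v \notin x :: q -> (forall b c, D v b c = false) ->
  exists q', x :: q' = l1 ++ u :: v :: w :: l2 /\ disc (fun a b c => D a b c || tin u v w a b c) x y q'.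
Proof.
move=> HD E vp vD; have tD := d_tri HD.
exists (behead (l1 ++ u :: v :: w :: l2)).
have Eq' : x :: behead (l1 ++ u :: v :: w :: l2) = l1 ++ u :: v :: w :: l2.
  by case: l1 E => [|a l1] [-> _].
split=> //.
have U := d_uniq HD; rewrite E in U vp.
have [uv wv] : u != v /\ w != v.
  by split; apply: contraNneq vp => <-; rewrite mem_cat !inE eqxx ?orbT.
have uw : u != w.
  by move: U; rewrite cat_uniq /= => /and3P[_ _ /andP[]]; rewrite inE negb_or => /andP[].
have Nv b : ~~ gr D x y v b.
  rewrite /gr; apply/norP; split; first by apply/existsP => -[c]; rewrite vD.
  by apply: contra vp => /edgeP[] [-> _]; rewrite -E ?mem_head // (mem_last_q HD).
apply: (disc_attach HD uv) => //; rewrite 1?eq_sym //.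
- by rewrite (gr_sym HD).
- by move=> c c'; rewrite vD.
- exact: consecutive_unique HD E.
- by apply: (chain_gr HD); rewrite E; exact: chain_edge.
- by right.
- rewrite Eq'; move: U vp; rewrite !cat_uniq /= !mem_cat !inE !negb_or => /and5P[-> /and3P[-> -> ->] /andP[-> ->] -> ->].
  by move=> /and4P[-> vu vw ->]; rewrite eq_sym vu vw.
- have Lq p : last x p = last x (x :: p) by [].
  by move: (d_last HD); rewrite (Lq q) (Lq (behead _)) Eq' E !last_cat.
move=> a b; rewrite Eq' E !chain_cat !chain_cons /bdt [edge v w a b]edge_sym.
move: (chain _ _ _) (chain _ _ _) => m1 m2.
by case: (edge u v a b) (edge w v a b) (edge u w a b) m1 m2 => [] [] [] [] [].
Qed.

Lemma disc_fill D x y q l1 v w0 w1 l2 : disc D x y q -> x :: q = l1 ++ v :: w0 :: w1 :: l2 ->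
  ~~ gr D x y v w1 ->
  exists q', x :: q' = l1 ++ v :: w1 :: l2 /\ disc (fun a b c => D a b c || tin v w1 w0 a b c) x y q'.
Proof.
move=> HD E Nv; have tD := d_tri HD.
exists (behead (l1 ++ v :: w1 :: l2)).
have Eq' : x :: behead (l1 ++ v :: w1 :: l2) = l1 ++ v :: w1 :: l2.
  by case: l1 E => [|a l1] [-> _].
split=> //.
have U := d_uniq HD; rewrite E in U.
have [v0 v1 w01] : [/\ v != w0, v != w1 & w0 != w1].
  move: U; rewrite cat_uniq /= => /and5P[_ _]; rewrite !inE !negb_or => /and3P[-> -> _].
  by case/andP=> ->.
have E' : x :: q = rcons l1 v ++ w0 :: w1 :: l2 by rewrite cat_rcons.
apply: (disc_attach HD v1 _ v0 Nv); rewrite 1?eq_sym //.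
- by move=> c c'; rewrite !(tri12 tD w1); exact: consecutive_unique HD E' c c'.
- exact: consecutive_unique HD E.
- by apply: (chain_gr HD); rewrite E; exact: chain_edge.
- by left; rewrite (gr_sym HD); apply: (chain_gr HD); rewrite E'; apply: chain_edge; rewrite -E' E.
- rewrite Eq'; apply: subseq_uniq U; rewrite cat_subseq //= eqxx.
  exact: (subseq_cons (w1 :: l2) w0).
- have Lq p : last x p = last x (x :: p) by [].
  by move: (d_last HD); rewrite (Lq q) (Lq (behead _)) Eq' E !last_cat.
move=> a b; rewrite Eq' E !chain_cat !chain_cons /bdt [edge w1 w0 a b]edge_sym.
move: (chain _ _ _) (chain _ _ _) => m1 m2.
by case: (edge v w0 a b) (edge w0 w1 a b) (edge v w1 a b) m1 m2 => [] [] [] [] [].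
Qed.

Lemma gr_or_tin D T x y a b : gr D x y a b -> gr (fun a b c => D a b c || T a b c) x y a b.
Proof.
rewrite /gr => /orP[/existsP[c H]|->]; last by rewrite orbT.
by apply/orP; left; apply/existsP; exists c; rewrite H.
Qed.

Lemma tin_notin u v w a b c : u != v -> v != w -> u != w -> a \notin [:: u; v; w] -> tin u v w a b c = false.
Proof.
move=> uv vw uw; rewrite !inE !negb_or => /and3P[/negbTE au /negbTE av /negbTE aw].
by rewrite tinP // au av aw.
Qed.

(** A new row is zipped onto the old one. With [u] the last new vertex and [o], [nx] the next two of
    the old boundary, [n] is erected on the edge from [u] to [o], and then the corner n, o, nx is
    filled; [y] serves as [nx] at the end of the row. *)
Lemma disc_row x y os ns l1 u D q : size os = size ns -> disc D x y q ->
  x :: q = l1 ++ u :: os ++ [:: y] -> uniq ns ->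
  (forall v, v \in ns -> v \notin x :: q /\ forall b c, D v b c = false) ->
  exists D' q', [/\ disc D' x y q', x :: q' = l1 ++ u :: ns ++ [:: y],
    forall a b, gr D x y a b -> gr D' x y a b,
    (forall k, k < size ns -> gr D' x y (nth y ns k) (nth y os k)) /\ path (gr D' x y) u ns &
    forall v, v \notin ns -> v \notin x :: q -> (forall b c, D v b c = false) -> forall b c, D' v b c = false].
Proof.
elim: os ns l1 u D q => [|o os IH] [|n ns] l1 u D q //=.
  by move=> _ HD E _ _; exists D, q.
move=> [Sz] HD E /andP[nns Uns] fresh; have [nq nD] := fresh n (mem_head _ _).
have tD := d_tri HD.
have [nx [l2 El2]] : exists nx l2, os ++ [:: y] = nx :: l2.
  by case: (os) => [|o' os']; [exists y, [::]|exists o', (os' ++ [:: y])].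
rewrite El2 in E.
have [q1 [Eq1 H1]] := disc_add HD E nq nD.
have U := d_uniq HD; rewrite E in U nq.
have [un no nnx] : [/\ u != n, n != o & n != nx].
  by move: nq; rewrite mem_cat !inE !negb_or => /and5P[_ nu -> -> _]; rewrite eq_sym.
have [uo unx onx] : [/\ u != o, u != nx & o != nx].
  move: U; rewrite cat_uniq /= => /and5P[_ _]; rewrite !inE !negb_or => /and3P[-> -> _].
  by case/andP=> ->.
have on : o != n by rewrite eq_sym.
have E1 : x :: q1 = rcons l1 u ++ n :: o :: nx :: l2 by rewrite cat_rcons.
have exy b : edge x y n b = false.
  apply/negP => /edgeP[] [En _]; case/negP: nq; rewrite -E En ?mem_head //; exact: (mem_last_q HD).
(* So far [n] has only the neighbours [u] and [o]. *)
have N1 : ~~ gr (fun a b c => D a b c || tin u n o a b c) x y n nx.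
  rewrite /gr exy orbF; apply/existsP => -[c]; rewrite nD /= => /(tin_cases un no uo).
  by case=> [[E2 E3 _]|[E2 E3 _]|[E2 E3 _]|[] [E2 E3 _]]; move: un no nnx unx onx; rewrite ?E2 ?E3 ?eqxx.
have [q2 [Eq2 H2]] := disc_fill H1 E1 N1.
set D1 := fun a b c => _ in H1 N1 H2; set D2 := fun a b c => _ in H2.
have E2 : x :: q2 = (rcons l1 u) ++ n :: os ++ [:: y] by rewrite El2.
have fresh2 v : v \in ns -> v \notin x :: q2 /\ forall b c, D2 v b c = false.
  move=> vns; have [|vq vD] := fresh v; first by rewrite inE vns orbT.
  have vn : v != n by apply: contraNneq nns => <-.
  have /and5P[v1 v2 v3 v4 v5] : [&& v \notin l1, v != u, v != o, v != nx & v \notin l2].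
    by move: vq; rewrite E mem_cat !inE !negb_or.
  split; first by rewrite Eq2 mem_cat mem_rcons !inE !negb_or v1 v2 vn v4 v5.
  by move=> b c; rewrite /D2 /D1 vD !tin_notin // 1?eq_sym // !inE !negb_or ?v2 ?vn ?v3 ?v4.
have [D' [q' [HD' Eq' gr' [adj pth] iso]]] := IH ns (rcons l1 u) n D2 q2 Sz H2 E2 Uns fresh2.
have g01 a b : gr D x y a b -> gr D' x y a b by move=> G; apply/gr'/gr_or_tin/gr_or_tin.
have gT a b c : tin u n o a b c -> gr D' x y a b.
  by move=> T; apply/gr'/gr_or_tin/(@gr_tri _ _ _ _ _ _ c); rewrite T orbT.
exists D', q'; split=> //.
- by rewrite Eq' cat_rcons.
- split.
    case=> [_|k]; last exact: adj.
    by apply: (gT _ _ u); rewrite tinP // !eqxx !orbT.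
  by rewrite pth andbT; apply: (gT _ _ o); exact: tin_refl.
move=> v; rewrite inE negb_or => /andP[vn vns] vq vD; apply: iso => //.
  move: vq; rewrite E Eq2 !mem_cat mem_rcons !inE !negb_or => /and5P[-> -> _ -> ->].
  by rewrite vn.
move: vq; rewrite E mem_cat !inE !negb_or => /and5P[v1 v2 v3 v4 v5] b c.
by rewrite /D2 /D1 vD !tin_notin // 1?eq_sym // !inE !negb_or ?v2 ?vn ?v3 ?v4.
Qed.

(** The first row is a fan of triangles at [y]. *)
Lemma disc_first_row x y ns l1 u D q : disc D x y q ->
  x :: q = l1 ++ u :: [:: y] -> uniq ns ->
  (forall v, v \in ns -> v \notin x :: q /\ forall b c, D v b c = false) ->
  exists D' q', [/\ disc D' x y q', x :: q' = l1 ++ u :: ns ++ [:: y],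
    forall a b, gr D x y a b -> gr D' x y a b, path (gr D' x y) u ns &
    forall v, v \notin ns -> v \notin x :: q -> (forall b c, D v b c = false) -> forall b c, D' v b c = false].
Proof.
elim: ns l1 u D q => [|n ns IH] l1 u D q /=.
  by move=> HD E _ _; exists D, q.
move=> HD E /andP[nns Uns] fresh; have [nq nD] := fresh n (mem_head _ _).
have [q1 [Eq1 H1]] := disc_add HD E nq nD.
have U := d_uniq HD; rewrite E in U nq.
have [un ny] : u != n /\ n != y.
  by move: nq; rewrite mem_cat !inE !negb_or => /and3P[_ nu ->]; rewrite eq_sym.
have uy : u != y.
  by move: U; rewrite cat_uniq /= => /and3P[_ _ /andP[]]; rewrite inE.
have E1 : x :: q1 = rcons l1 u ++ n :: [:: y] by rewrite cat_rcons.
set D1 := fun a b c => _ in H1.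
have fresh1 v : v \in ns -> v \notin x :: q1 /\ forall b c, D1 v b c = false.
  move=> vns; have [|vq vD] := fresh v; first by rewrite inE vns orbT.
  have vn : v != n by apply: contraNneq nns => <-.
  have /and3P[v1 v2 v3] : [&& v \notin l1, v != u & v != y].
    by move: vq; rewrite E mem_cat !inE !negb_or.
  split; first by rewrite Eq1 mem_cat !inE !negb_or v1 v2 vn v3.
  by move=> b c; rewrite /D1 vD tin_notin // !inE !negb_or v2 vn v3.
have [D' [q' [HD' Eq' gr' pth iso]]] := IH (rcons l1 u) n D1 q1 H1 E1 Uns fresh1.
exists D', q'; split=> //.
- by rewrite Eq' cat_rcons.
- by move=> a b G; apply/gr'/gr_or_tin.
- by rewrite pth andbT; apply/gr'/(@gr_tri _ _ _ _ _ _ y); rewrite /D1 tin_refl // orbT.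
move=> v; rewrite inE negb_or => /andP[vn vns] vq vD; apply: iso => //.
  move: vq; rewrite E Eq1 !mem_cat !inE !negb_or => /and3P[-> -> ->].
  by rewrite vn.
move: vq; rewrite E mem_cat !inE !negb_or => /and3P[v1 v2 v3] b c.
by rewrite /D1 vD tin_notin // !inE !negb_or v2 vn v3.
Qed.
End Grid.

(** * The square grid as a disc *)

Section HostGrid.
Variable M : nat.
(** Besides the cells there are two poles, the ends of the base edge, standing at the left and right
    ends of the rows. *)
Definition gridT : finType := ('I_M.+1 * 'I_M.+1 + bool)%type.

Definition cell (i j : nat) : gridT := inl (inord i, inord j).

Definition row (i : nat) : seq gridT := [seq cell i j | j <- iota 0 M.+1].

Lemma cell_inj i j i' j' : i <= M -> j <= M -> i' <= M -> j' <= M ->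
  cell i j = cell i' j' -> i = i' /\ j = j'.
Proof.
move=> h1 h2 h3 h4 [E1 E2]; split.
  by rewrite -(inordK h1) -(inordK h3) E1.
by rewrite -(inordK h2) -(inordK h4) E2.
Qed.

Lemma row_uniq i : i <= M -> uniq (row i).
Proof.
move=> iM; rewrite map_inj_in_uniq ?iota_uniq // => j j'; rewrite !mem_iota !add0n !ltnS /=.
by move=> h h' /cell_inj[].
Qed.

Lemma mem_row i c : reflect (exists2 j, j <= M & c = cell i j) (c \in row i).
Proof.
apply: (iffP mapP) => -[j h ->]; exists j => //; move: h; by rewrite mem_iota add0n ltnS.
Qed.

Lemma nth_row d i j : j <= M -> nth d (row i) j = cell i j.
Proof. by move=> jM; rewrite (nth_map 0) ?size_iota ?ltnS // nth_iota ?ltnS. Qed.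

Lemma disc_grid k : k <= M ->
  exists (D : gridT -> gridT -> gridT -> bool) q,
  [/\ disc D (inr false) (inr true) q,
    inr false :: q = inr false :: row k ++ [:: inr true],
    forall i j, i <= k -> j < M -> gr D (inr false) (inr true) (cell i j) (cell i j.+1),
    forall i j, i < k -> j <= M -> gr D (inr false) (inr true) (cell i j) (cell i.+1 j) &
    forall i j, k < i <= M -> j <= M -> forall b c, D (cell i j) b c = false].
Proof.
have path_row (r : rel gridT) u i : path r u (row i) -> forall j, j < M -> r (cell i j) (cell i j.+1).
  move=> /(pathP u) P j jM.
  have := P j.+1; rewrite size_map size_iota ltnS => /(_ jM).
  by rewrite [nth u (u :: _) _]/= !nth_row // ltnW.
elim: k => [|k IH] kM.
  have E0 : inr false != inr true :> gridT by [].
  have fr v : v \in row 0 -> v \notin [:: inr false; inr true : gridT] /\ forall b c : gridT, false = false.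
    by case/mem_row=> j _ ->.
  have [D [q [HD Eq _ P iso]]] := @disc_first_row _ (inr false) (inr true : gridT) (row 0) [::] (inr false)
    _ _ (disc_empty E0) erefl (row_uniq (leq0n M)) fr.
  exists D, q; split=> //.
    by move=> i j; rewrite leqn0 => /eqP->; exact: (path_row _ _ _ P).
  move=> i j /andP[i0 iM] jM; apply: iso => //.
  apply/negP => /mem_row[j' j'M /cell_inj[] // E _]; by rewrite E in i0.
have kM' := ltnW kM; have [D [q [HD Eq HH HV iso]]] := IH kM'.
have fr v : v \in row k.+1 -> v \notin inr false :: q /\ forall b c, D v b c = false.
  case/mem_row=> j jM ->; split; last by apply: iso => //; rewrite ltnSn.
  rewrite Eq !inE mem_cat !inE /= orbF; apply/negP => /mem_row[j' j'M /cell_inj[] // E _].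
  by move: (ltnSn k); rewrite -{1}E ltnn.
have Sz : size (row k) = size (row k.+1) by rewrite !size_map.
have [D' [q' [HD' Eq' gr' [adj P] iso']]] := @disc_row _ (inr false) (inr true : gridT) (row k) (row k.+1) [::] (inr false)
    _ _ Sz HD Eq (row_uniq kM) fr.
exists D', q'; split=> //.
- move=> i j; rewrite leq_eqVlt => /orP[/eqP->|]; first exact: (path_row _ _ _ P).
  by rewrite ltnS => ik jM; apply: gr'; exact: HH.
- move=> i j; rewrite ltnS leq_eqVlt => /orP[/eqP->|ik] jM; last by apply: gr'; exact: HV.
  rewrite (gr_sym HD'); have := adj j; rewrite size_map size_iota ltnS => /(_ jM).
  by rewrite !nth_row.
move=> i j /andP[ki iM] jM; apply: iso'.
- apply/negP => /mem_row[j' j'M /cell_inj[] // E _]; by rewrite E ltnn in ki.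
- rewrite Eq !inE mem_cat !inE /= orbF; apply/negP => /mem_row[j' j'M /cell_inj[] // E _].
  by rewrite E ltnNge leqnSn in ki.
by apply: iso => //; rewrite iM andbT ltnW.
Qed.
End HostGrid.

(** Labels are the vertices of the graph and label classes are connected sets of cells. After
    contraction [f] sends each label to the single vertex of the disc that carries it. *)
Theorem grid_minor_stacked (M : nat) (lab : nat * nat -> option nat) :
  (forall c v, lab c = Some v -> lt (fst c) M /\ lt (snd c) M) ->
  (forall c c' v, lab c = Some v -> lab c' = Some v ->
     clos_refl_trans _ (fun a b => adj4 a b /\ lab a = Some v /\ lab b = Some v) c c') ->
  exists (T : Type) (p ord : list T) (E : T -> T -> Prop) (f : nat -> T),
    stacked p ord E /\
    (forall u v c c', lab c = Some u -> lab c' = Some v -> f u = f v -> u = v) /\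
    (forall v c, lab c = Some v -> List.In (f v) ord) /\
    (forall u v c c', lab c = Some u -> lab c' = Some v -> adj4 c c' -> u <> v -> E (f u) (f v)).
Proof.
move=> bnd0 conn.
have bnd c v : lab c = Some v -> (c.1 < M)%N /\ (c.2 <= M)%N.
  by case/bnd0 => /ltP h1 /ltP h2; split=> //; exact: ltnW.
have [D [q [HD Eq HH HV _]]] := disc_grid (leqnn M).
set x : gridT M := inr false in HD Eq HH HV; set y : gridT M := inr true in HD Eq HH HV.
pose labG (g : gridT M) := if g is inl c then lab (nat_of_ord c.1, nat_of_ord c.2) else None.
pose cl (c : nat * nat) : gridT M := cell M c.1 c.2.
have labE c : c.1 <= M -> c.2 <= M -> labG (cl c) = lab c.
  by case: c => i j /= iM jM; rewrite !inordK.
have labS c v : lab c = Some v -> labG (cl c) = Some v.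
  by move=> h; have [h1 h2] := bnd _ _ h; rewrite labE // ltnW.
have labX g v : labG g = Some v -> exists2 c, g = cl c & lab c = Some v.
  case: g => [[i j]|//] /= h; exists (nat_of_ord i, nat_of_ord j) => //.
  by rewrite /cl /cell /= !inord_val.
have adjG c c' v v' : adj4 c c' -> lab c = Some v -> lab c' = Some v' -> gr D x y (cl c) (cl c').
  case: c c' => [i j] [i' j'] A /bnd /= [iM jM] /bnd /= [iM' jM'].
  case: A => /= -[-> [E|E]]; subst.
  - by apply: HH => //; exact: ltnW.
  - by rewrite (gr_sym HD); apply: HH => //; exact: ltnW.
  - exact: HV.
  by rewrite (gr_sym HD); exact: HV.
(* The boundary consists of the poles and the last row, which the strict bound on the indices leaves
   unlabelled. *)
have lbd a : a \in x :: q -> labG a = None.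
  rewrite Eq inE mem_cat mem_seq1 => /orP[/eqP->//|/orP[/mem_row[j jM ->]|/eqP->//]].
  case E : (labG _) => [v|//]; move: E; rewrite (labE (M, j)) // => /bnd[].
  by rewrite ltnn.
have connG w a b : labG a = Some w -> labG b = Some w -> connect (classrel D x y labG w) a b.
  move=> /labX[c -> lc] /labX[c' -> lc'].
  elim: (conn c c' w lc lc') => {lc lc' c c'} [c c' [A [l1 l2]]|c|c c' c'' _ H1 _ H2].
  - by apply: connect1; rewrite /classrel (adjG _ _ _ _ A l1 l2) (labS _ _ l1) (labS _ _ l2) !eqxx.
  - exact: connect0.
  exact: connect_trans H1 H2.
have [V [D' [x' [y' [q' [lab' [H' P1 P2 P3 P4]]]]]]] := disc_minor HD lbd connG.
have xy' := d_neq H'.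
have st0 : stacked ([::] ++ x' :: y' :: [::]) [:: y'; x'] (joins x' y').
  by apply: stacked_base => E; rewrite E eqxx in xy'.
have [|ord [E [st EE DE _]]] := disc_stacked H' st0 _ (or_introl (conj erefl erefl)).
  by move=> c a b _ /eqP cx /eqP cy [E|[E|//]]; [apply: cy|apply: cx].
have grE a b : gr D' x' y' a b -> E a b.
  by case/orP=> [/existsP[c]|/joinsP]; [exact: DE|exact: EE].
have ordE a b : E a b -> List.In a ord by case: (stacked_mem _ _ _ st) => _; apply.
pose f v := if [pick a | lab' a == Some v] is Some a then a else x'.
have fP v c : lab c = Some v -> lab' (f v) = Some v.
  move=> /labS/P2[a la]; rewrite /f; case: pickP => [b /eqP//|/(_ a)].
  by rewrite la eqxx.
have fE v a : lab' a = Some v -> a = f v.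
  move=> la; rewrite /f; case: pickP => [b /eqP lb|/(_ a)]; first exact: P1 la lb.
  by rewrite la eqxx.
exists V, ([::] ++ (x' :: q') ++ [::]), ord, E, f; split; [exact: st|split; [|split]].
- by move=> u v c c' lu lv E0; apply: Some_inj; rewrite -(fP _ _ lu) -(fP _ _ lv) E0.
- move=> v c lc.
  (* From the last cell of the class in some column one leaves the class by going one row further,
     which is still in the grid. So [f v] is an end of an edge, hence a placed vertex. *)
  have [i [j [lij mx]]] : exists i j, lab (i, j) = Some v /\ lab (i.+1, j) != Some v.
    case: c lc => i j lc.
    have [m Pm mx] : exists2 m, lab (m, j) == Some v & forall m', lab (m', j) == Some v -> m' <= m.
      have exP : exists m, lab (m, j) == Some v by exists i; rewrite lc.
      have ub m : lab (m, j) == Some v -> m <= M by move=> /eqP/bnd[/ltnW].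
      by case: (ex_maxnP exP ub) => m Pm mx; exists m.
    exists m, j; split; first exact/eqP.
    by apply/negP => /mx; rewrite ltnn.
  have [iM jM] := bnd _ _ lij.
  have [a [b [G la]]] : exists a b, gr D' x' y' a b /\ lab' a = Some v.
    apply: (P4 (cl (i, j)) (cl (i.+1, j))).
    - exact: HV.
    - exact: labS.
    by rewrite labE //; apply/eqP.
  by rewrite -(fE _ _ la); apply: (ordE a b); exact: grE.
move=> u v c c' lu lv A uv.
have [a [b [G la lb]]] := P3 _ _ _ _ (adjG _ _ _ _ A lu lv) (labS _ _ lu) (labS _ _ lv) uv.
by rewrite -(fE _ _ la) -(fE _ _ lb); exact: grE.
Qed.

End Discs.

(** * Drawings with prescribed heights *)

(** Twice the signed area of abc. When [a] is to the left of [b], it is positive if [c] lies above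
    the line ab. *)
Definition orient (a b c : point) : R :=
  (fst b - fst a) * (snd c - snd a) - (fst c - fst a) * (snd b - snd a).

Definition consec {T : Type} (p : list T) (u w : T) : Prop := exists p1 p2, p = p1 ++ u :: w :: p2.

Definition within (a b r : point) : Prop := fst a <= fst r <= fst b.

Definition drawn {T : Type} (ord : list T) (E : T -> T -> Prop) (pos : T -> point) (r : point) : Prop :=
  (exists w, In w ord /\ r = pos w) \/ (exists u v, E u v /\ on_segment (pos u) (pos v) r).

(** The first clause keeps [r] in the horizontal range of the boundary, where the second one is not
    vacuous. *)
Definition below {T : Type} (p : list T) (pos : T -> point) (r : point) : Prop :=
  (exists u w, consec p u w /\ within (pos u) (pos w) r) /\
  (forall u w, consec p u w -> within (pos u) (pos w) r -> orient (pos u) (pos w) r <= 0).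

(** The invariant of the construction: besides being plane, the drawing has an upper boundary that
    is monotone in the abscissa and has everything drawn on or below it. Whatever is added above can
    then meet the old picture only on this boundary. *)
Record planar_picture {T : Type} (p ord : list T) (E : T -> T -> Prop) (pos : T -> point) : Prop := {
  pic_inj : forall u v, In u ord -> In v ord -> pos u = pos v -> u = v;
  pic_off : forall u v w, E u v -> In w ord -> w <> u -> w <> v -> ~ on_segment (pos u) (pos v) (pos w);
  pic_cross : forall u v x y r, E u v -> E x y -> ~ joins u v x y ->
     on_segment (pos u) (pos v) r -> on_segment (pos x) (pos y) r ->
     exists w, (w = u \/ w = v) /\ (w = x \/ w = y) /\ r = pos w;
  pic_below : forall r, drawn ord E pos r -> below p pos r;
  pic_incr : forall p1 u p2, p = p1 ++ u :: p2 -> forall w, In w p2 -> fst (pos u) < fst (pos w) }.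

Lemma on_segment_sym (a b r : point) : on_segment a b r -> on_segment b a r.
Proof. intros (t & Ht & H1 & H2); exists (1 - t); repeat split; lra. Qed.

Lemma on_segment_left (a b : point) : on_segment a b a.
Proof. exists 0; repeat split; lra. Qed.

Lemma on_segment_right (a b : point) : on_segment a b b.
Proof. exists 1; repeat split; lra. Qed.

Lemma orient_segment (a b c d r : point) t : fst r = fst c + t * (fst d - fst c) ->
  snd r = snd c + t * (snd d - snd c) -> orient a b r = (1 - t) * orient a b c + t * orient a b d.
Proof. unfold orient; intros -> ->; ring. Qed.

Lemma orient_rot (a b c : point) : orient a b c = orient b c a.
Proof. unfold orient; ring. Qed.

Lemma orient_aab (a b : point) : orient a b a = 0.
Proof. unfold orient; ring. Qed.

Lemma orient_abb (a b : point) : orient a b b = 0.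
Proof. unfold orient; ring. Qed.

Lemma point_eq (a b : point) : fst a = fst b -> snd a = snd b -> a = b.
Proof. destruct a, b; simpl; intros; subst; reflexivity. Qed.

Lemma segment_left_end (a b r : point) : fst a < fst b -> on_segment a b r -> fst r <= fst a -> r = a.
Proof. intros H (t & Ht & H1 & H2) H3; assert (t = 0) by nra; subst t; apply point_eq; lra. Qed.

Lemma segment_right_end (a b r : point) : fst a < fst b -> on_segment a b r -> fst b <= fst r -> r = b.
Proof. intros H (t & Ht & H1 & H2) H3; assert (t = 1) by nra; subst t; apply point_eq; lra. Qed.

Lemma segment_within (a b r : point) : fst a < fst b -> on_segment a b r -> within a b r.
Proof. intros H (t & Ht & H1 & H2); unfold within; nra. Qed.

Lemma on_segment_orient (a b r : point) : on_segment a b r -> orient a b r = 0.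
Proof.
intros (t & Ht & H1 & H2); rewrite (orient_segment _ _ _ _ _ _ H1 H2), orient_aab, orient_abb; ring.
Qed.

(** Here [b] lies under ac, and so do both sides of the angle at [b]. The asserted inequality is the
    claim multiplied by the positive width of the strip; the same holds for the next lemma. *)
Lemma below_upper_side_left (a b c r : point) : fst a < fst b < fst c -> 0 < orient a b c ->
  within a b r -> orient a b r <= 0 -> orient a c r <= 0.
Proof.
unfold orient, within; intros [H1 H2] H3 [H4 H5] H6.
set (x := fst b - fst a) in *; set (y := fst c - fst a) in *; set (z := fst r - fst a) in *.
set (p := snd b - snd a) in *; set (q := snd c - snd a) in *; set (s := snd r - snd a) in *.
assert (0 < x /\ x < y /\ 0 <= z /\ z <= x) by (unfold x, y, z; lra).
assert (x * (y * s - z * q) <= 0) by nra.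
nra.
Qed.

Lemma below_upper_side_right (a b c r : point) : fst a < fst b < fst c -> 0 < orient a b c ->
  within b c r -> orient b c r <= 0 -> orient a c r <= 0.
Proof.
unfold orient, within; intros [H1 H2] H3 [H4 H5] H6.
set (x := fst c - fst b) in *; set (y := fst c - fst a) in *; set (z := fst c - fst r) in *.
set (p := snd c - snd b) in *; set (q := snd c - snd a) in *; set (s := snd c - snd r) in *.
assert (0 < x /\ x < y /\ 0 <= z /\ z <= x) by (unfold x, y, z; lra).
replace (fst b - fst a) with (y - x) in H3 by (unfold x, y; ring).
replace (snd b - snd a) with (q - p) in H3 by (unfold q, p; ring).
replace (snd r - snd b) with (p - s) in H6 by (unfold s, p; ring).
replace (fst r - fst b) with (x - z) in H6 by (unfold x, z; ring).
replace (snd r - snd a) with (q - s) by (unfold s, q; ring).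
replace (fst r - fst a) with (y - z) by (unfold y, z; ring).
assert (x * (z * q - y * s) <= 0) by nra.
nra.
Qed.

(** Now the apex [c] lies above ab, so that ab runs under ac in this strip and under cb in the other
    one. *)
Lemma below_apex_left (a b c r : point) : fst a < fst c < fst b -> 0 < orient a b c ->
  within a c r -> orient a b r <= 0 -> orient a c r <= 0.
Proof.
unfold orient, within; intros [H1 H2] H3 [H4 H5] H6.
set (y := fst b - fst a) in *; set (x := fst c - fst a) in *; set (z := fst r - fst a) in *.
set (q := snd b - snd a) in *; set (p := snd c - snd a) in *; set (s := snd r - snd a) in *.
assert (0 < x /\ x < y /\ 0 <= z /\ z <= x) by (unfold x, y, z; lra).
assert (y * (x * s - z * p) <= 0) by nra.
nra.
Qed.

Lemma below_apex_right (a b c r : point) : fst a < fst c < fst b -> 0 < orient a b c ->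
  within c b r -> orient a b r <= 0 -> orient c b r <= 0.
Proof.
unfold orient, within; intros [H1 H2] H3 [H4 H5] H6.
set (x := fst b - fst c) in *; set (y := fst b - fst a) in *; set (z := fst b - fst r) in *.
set (p := snd b - snd c) in *; set (q := snd b - snd a) in *; set (s := snd b - snd r) in *.
assert (0 < x /\ x < y /\ 0 <= z /\ z <= x) by (unfold x, y, z; lra).
replace (snd c - snd a) with (q - p) in H3 by (unfold q, p; ring).
replace (fst c - fst a) with (y - x) in H3 by (unfold x, y; ring).
replace (snd r - snd a) with (q - s) in H6 by (unfold s, q; ring).
replace (fst r - fst a) with (y - z) in H6 by (unfold y, z; ring).
replace (snd r - snd c) with (p - s) by (unfold s, p; ring).
replace (fst r - fst c) with (x - z) by (unfold x, z; ring).
assert (y * (z * p - x * s) <= 0) by nra.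
nra.
Qed.

(** * Consecutive elements and sorted lists *)

Definition sorted_by {T : Type} (X : T -> R) (p : list T) : Prop :=
  forall p1 u p2, p = p1 ++ u :: p2 -> forall w, In w p2 -> X u < X w.

Section Lists.
Context {T : Type}.
Implicit Types (p q : list T) (u v w c d : T).

Lemma consec_cons u w q c d : consec (u :: w :: q) c d <-> (c = u /\ d = w) \/ consec (w :: q) c d.
Proof.
split.
- intros (p1 & p2 & H); destruct p1 as [|a p1]; injection H; intros; subst; [left; auto|].
  right; exists p1, p2; assumption.
- intros [[-> ->]|(p1 & p2 & H)]; [exists [], q; reflexivity|exists (u :: p1), p2; rewrite H; reflexivity].
Qed.

Lemma consec_one u c d : ~ consec [u] c d.
Proof. intros (p1 & p2 & H); destruct p1 as [|a [|b p1]]; discriminate. Qed.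

Lemma consec_app p u q c d : consec (p ++ u :: q) c d <-> consec (p ++ [u]) c d \/ consec (u :: q) c d.
Proof.
induction p as [|a [|b p] IH]; simpl app in *.
- split; [auto|intros [H|H]; [destruct (consec_one _ _ _ H)|auto]].
- rewrite 2 consec_cons; split; [tauto|].
  intros [[H|H]|H]; auto; destruct (consec_one _ _ _ H).
- rewrite 2 consec_cons; tauto.
Qed.

Lemma consec_mem p c d : consec p c d -> In c p /\ In d p.
Proof. intros (p1 & p2 & ->); rewrite 2 in_app_iff; simpl; auto. Qed.

Lemma sorted_by_before X p u q c : sorted_by X (p ++ u :: q) -> In c p -> X c < X u.
Proof.
intros H Hc; apply in_split in Hc; destruct Hc as (a & b & ->).
apply (H a c (b ++ u :: q)); [rewrite <- app_assoc; reflexivity|].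
rewrite in_app_iff; simpl; auto.
Qed.

Lemma sorted_by_after X p u q c : sorted_by X (p ++ u :: q) -> In c q -> X u < X c.
Proof. intros H; apply (H p u q eq_refl). Qed.

Lemma consec_left X p u q c d : sorted_by X (p ++ u :: q) -> consec (p ++ [u]) c d -> X d <= X u.
Proof.
intros H Hc; apply consec_mem in Hc; destruct Hc as [_ Hd].
rewrite in_app_iff in Hd; destruct Hd as [Hd|[<-|[]]]; [|lra].
left; exact (sorted_by_before _ _ _ _ _ H Hd).
Qed.

Lemma consec_right X p u q c d : sorted_by X (p ++ u :: q) -> consec (u :: q) c d -> X u <= X c.
Proof.
intros H Hc; apply consec_mem in Hc; destruct Hc as [[<-|Hc] _]; [lra|].
left; exact (sorted_by_after _ _ _ _ _ H Hc).
Qed.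

Lemma sorted_by_cons X u p : sorted_by X (u :: p) <-> (forall w, In w p -> X u < X w) /\ sorted_by X p.
Proof.
split.
- intros H; split; [exact (H [] u p eq_refl)|].
  intros p1 c p2 ->; exact (H (u :: p1) c p2 eq_refl).
- intros [H1 H2] p1 c p2 E w Hw; destruct p1 as [|a p1]; injection E; intros; subst; auto.
  exact (H2 p1 c p2 eq_refl w Hw).
Qed.

Lemma sorted_by_fill X p v w0 w1 q : sorted_by X (p ++ v :: w0 :: w1 :: q) ->
  sorted_by X (p ++ v :: w1 :: q).
Proof.
induction p as [|a p IH]; simpl.
- rewrite !sorted_by_cons; simpl; intuition.
- rewrite 2 sorted_by_cons; intros [H1 H2]; split; [|auto].
  intros c Hc; apply H1; rewrite in_app_iff in *; simpl in *; tauto.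
Qed.

Lemma sorted_by_add X p u v w q : sorted_by X (p ++ u :: w :: q) -> X u < X v < X w ->
  sorted_by X (p ++ u :: v :: w :: q).
Proof.
intros H Hv; induction p as [|a p IH]; simpl in *.
- rewrite !sorted_by_cons in *; simpl in *; destruct H as [H1 [H2 H3]].
  repeat split; auto; intros c [<-|Hc]; try lra.
  + destruct Hc as [<-|Hc]; [lra|auto].
  + specialize (H2 c Hc); lra.
- rewrite sorted_by_cons in *; destruct H as [H1 H2]; split; [|auto].
  intros c Hc; rewrite in_app_iff in Hc; simpl in Hc.
  assert (X a < X u) by (apply H1; rewrite in_app_iff; simpl; auto).
  destruct Hc as [Hc|[<-|[<-|Hc]]]; try lra; apply H1; rewrite in_app_iff; simpl; tauto.
Qed.

End Lists.

Lemma drawn_joins {T : Type} (pos : T -> point) u v a b r : joins u v a b -> on_segment (pos a) (pos b) r ->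
  on_segment (pos u) (pos v) r.
Proof. intros [[-> ->]|[-> ->]]; auto using on_segment_sym. Qed.

(** * Adding an edge or a vertex to a picture *)

Section Steps.
Context {T : Type}.
Variables (pos : T -> point).

(** With [w0] strictly under the segment from [v] to [w1], the old boundary v, w0, w1 touches this
    segment at its ends only, and everything drawn is on or below that boundary. All conditions
    follow from the resulting fact [meet]. *)
Lemma picture_fill p1 v w0 w1 p2 ord E :
  planar_picture (p1 ++ v :: w0 :: w1 :: p2) ord E pos -> In v ord -> In w1 ord ->
  orient (pos v) (pos w1) (pos w0) < 0 ->
  planar_picture (p1 ++ v :: w1 :: p2) ord (fun a b => E a b \/ joins v w1 a b) pos.
Proof.
intros H Hv Hw1 Ho; pose proof (pic_incr _ _ _ _ H) as Hi.
assert (O1 : 0 < orient (pos v) (pos w0) (pos w1)) by (unfold orient in *; lra).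
change (sorted_by (fun a => fst (pos a)) (p1 ++ v :: w0 :: w1 :: p2)) in Hi.
assert (Hi' : sorted_by (fun a => fst (pos a)) ((p1 ++ [v]) ++ w0 :: w1 :: p2)) by (rewrite <- app_assoc; exact Hi).
assert (Hi'' : sorted_by (fun a => fst (pos a)) ((p1 ++ [v; w0]) ++ w1 :: p2)) by (rewrite <- app_assoc; exact Hi).
assert (X1 : fst (pos v) < fst (pos w0)) by (apply (sorted_by_after _ _ _ _ _ Hi); simpl; auto).
assert (X2 : fst (pos w0) < fst (pos w1)) by (apply (sorted_by_after _ _ _ _ _ Hi'); simpl; auto).
assert (X3 : fst (pos v) < fst (pos w1)) by lra.
assert (meet : forall r, drawn ord E pos r -> on_segment (pos v) (pos w1) r -> r = pos v \/ r = pos w1).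
{ intros r Dr Sr; destruct (pic_below _ _ _ _ H r Dr) as [(c & d & Cc & Wc) Hb].
  pose proof (Hb c d Cc Wc) as Oc; destruct Wc as [W1 W2].
  rewrite consec_app, consec_cons, consec_cons in Cc.
  destruct Cc as [Cc|[[-> ->]|[[-> ->]|Cc]]].
  - left; apply (segment_left_end _ _ _ X3 Sr).
    pose proof (consec_left _ _ _ _ _ _ Hi Cc); simpl in *; lra.
  - left; destruct Sr as (t & Ht & S1 & S2).
    rewrite (orient_segment _ _ _ _ _ _ S1 S2), orient_aab in Oc.
    assert (t = 0) by nra; subst t; apply point_eq; lra.
  - right; destruct Sr as (t & Ht & S1 & S2).
    rewrite (orient_segment _ _ _ _ _ _ S1 S2), orient_abb, <- orient_rot in Oc.
    assert (t = 1) by nra; subst t; apply point_eq; lra.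
  - right; apply (segment_right_end _ _ _ X3 Sr).
    pose proof (consec_right _ _ _ _ _ _ Hi'' Cc); simpl in *; lra. }
assert (vert : forall w, In w ord -> drawn ord E pos (pos w)) by (intros w Hw; left; exists w; auto).
constructor.
- exact (pic_inj _ _ _ _ H).
- intros a b w [HE|HJ] Hw Ha Hb Hs; [exact (pic_off _ _ _ _ H a b w HE Hw Ha Hb Hs)|].
  destruct (meet _ (vert w Hw) (drawn_joins _ _ _ _ _ _ HJ Hs)) as [M|M];
    apply (pic_inj _ _ _ _ H) in M; auto; subst w; destruct HJ as [[-> ->]|[-> ->]]; auto.
- assert (cross : forall a b x y r, joins v w1 a b -> E x y -> on_segment (pos a) (pos b) r ->
      on_segment (pos x) (pos y) r -> exists w, (w = a \/ w = b) /\ (w = x \/ w = y) /\ r = pos w).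
  { intros a b x y r HJ HE Sa Sx.
    assert (M : r = pos v \/ r = pos w1).
    { apply meet; [right; exists x, y; auto|exact (drawn_joins _ _ _ _ _ _ HJ Sa)]. }
    assert (K : forall w, In w ord -> (w = a \/ w = b) -> r = pos w ->
       exists w, (w = a \/ w = b) /\ (w = x \/ w = y) /\ r = pos w).
    { intros w Hw Hab ->; exists w; split; [auto|split; [|auto]].
      apply NNPP; intros N; apply (pic_off _ _ _ _ H x y w HE Hw); tauto. }
    destruct M as [M|M]; [apply (K v)|apply (K w1)]; auto; destruct HJ as [[-> ->]|[-> ->]]; auto. }
  intros a b x y r [HE|HJ] [HE'|HJ'] Hn Sa Sx.
  + exact (pic_cross _ _ _ _ H a b x y r HE HE' Hn Sa Sx).
  + destruct (cross x y a b r HJ' HE Sx Sa) as (w & W1 & W2 & W3); exists w; auto.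
  + exact (cross a b x y r HJ HE' Sa Sx).
  + exfalso; apply Hn; destruct HJ as [[-> ->]|[-> ->]]; destruct HJ' as [[-> ->]|[-> ->]]; unfold joins; auto.
- assert (old : forall r, drawn ord E pos r -> below (p1 ++ v :: w1 :: p2) pos r).
  { intros r Dr; destruct (pic_below _ _ _ _ H r Dr) as [(c & d & Cc & Wc) Hb]; split.
    - rewrite consec_app, consec_cons, consec_cons in Cc.
      destruct Cc as [Cc|[[-> ->]|[[-> ->]|Cc]]];
        [exists c, d|exists v, w1|exists v, w1|exists c, d]; (split; [rewrite consec_app, consec_cons; tauto|]);
        unfold within in *; lra.
    - intros c' d' Cc' Wc'; rewrite consec_app, consec_cons in Cc'.
      destruct Cc' as [Cc'|[[-> ->]|Cc']];
        [apply Hb; auto; rewrite consec_app; auto| |apply Hb; auto; rewrite consec_app, !consec_cons; auto].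
      destruct (Rle_dec (fst r) (fst (pos w0))) as [Hr|Hr].
      + apply (below_upper_side_left _ (pos w0)); auto; [unfold within in *; lra|].
        apply Hb; [rewrite consec_app, !consec_cons; auto|unfold within in *; lra].
      + apply (below_upper_side_right _ (pos w0)); auto; [unfold within in *; lra|].
        apply Hb; [rewrite consec_app, !consec_cons; auto|unfold within in *; lra]. }
  intros r [(w & Hw & ->)|(a & b & [HE|HJ] & Sr)].
  + apply old; auto.
  + apply old; right; exists a, b; auto.
  + apply (drawn_joins _ _ _ _ _ _ HJ) in Sr.
    pose proof (segment_within _ _ _ X3 Sr) as Wr; split.
    * exists v, w1; split; [rewrite consec_app, consec_cons; auto|exact Wr].
    * intros c d Cc Wc; pose proof Cc as Cc'; rewrite consec_app, consec_cons in Cc.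
      destruct Cc as [Cc|[[-> ->]|Cc]].
      -- assert (r = pos v) as ->.
         { apply (segment_left_end _ _ _ X3 Sr).
           pose proof (consec_left _ _ _ _ _ _ Hi Cc); unfold within in *; simpl in *; lra. }
         apply old; auto.
      -- rewrite (on_segment_orient _ _ _ Sr); lra.
      -- assert (r = pos w1) as ->.
         { apply (segment_right_end _ _ _ X3 Sr).
           pose proof (consec_right _ _ _ _ _ _ Hi'' Cc); unfold within in *; simpl in *; lra. }
         apply old; auto.
- exact (sorted_by_fill _ _ _ _ _ _ Hi).
Qed.

(** A point strictly above the boundary edge uw, between its ends, sees all of that edge: the two
    new segments run above the old picture and touch it only at [u] and [w]. *)
Lemma picture_add p1 u v w p2 ord E :
  planar_picture (p1 ++ u :: w :: p2) ord E pos -> In u ord -> In w ord ->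
  (forall a b, E a b -> In a ord /\ In b ord) ->
  fst (pos u) < fst (pos v) < fst (pos w) ->
  0 < orient (pos u) (pos w) (pos v) ->
  planar_picture (p1 ++ u :: v :: w :: p2) (v :: ord)
    (fun a b => E a b \/ joins v u a b \/ joins v w a b) pos.
Proof.
intros H Hu Hw HEo [X1 X2] Ho; pose proof (pic_incr _ _ _ _ H) as Hi.
change (sorted_by (fun a => fst (pos a)) (p1 ++ u :: w :: p2)) in Hi.
assert (Hi' : sorted_by (fun a => fst (pos a)) ((p1 ++ [u]) ++ w :: p2)) by (rewrite <- app_assoc; exact Hi).
assert (X3 : fst (pos u) < fst (pos w)) by lra.
assert (meetu : forall r, drawn ord E pos r -> on_segment (pos u) (pos v) r -> r = pos u).
{ intros r Dr Sr; destruct (pic_below _ _ _ _ H r Dr) as [(c & d & Cc & Wc) Hb].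
  pose proof (Hb c d Cc Wc) as Oc; destruct Wc as [W1 W2].
  rewrite consec_app, consec_cons in Cc.
  destruct Cc as [Cc|[[-> ->]|Cc]].
  - apply (segment_left_end _ _ _ X1 Sr).
    pose proof (consec_left _ _ _ _ _ _ Hi Cc); simpl in *; lra.
  - destruct Sr as (t & Ht & S1 & S2).
    rewrite (orient_segment _ _ _ _ _ _ S1 S2), orient_aab in Oc.
    assert (t = 0) by nra; subst t; apply point_eq; lra.
  - pose proof (consec_right _ _ _ _ _ _ Hi' Cc); pose proof (segment_within _ _ _ X1 Sr).
    unfold within in *; simpl in *; lra. }
assert (meetw : forall r, drawn ord E pos r -> on_segment (pos v) (pos w) r -> r = pos w).
{ intros r Dr Sr; destruct (pic_below _ _ _ _ H r Dr) as [(c & d & Cc & Wc) Hb].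
  pose proof (Hb c d Cc Wc) as Oc; destruct Wc as [W1 W2].
  rewrite consec_app, consec_cons in Cc.
  destruct Cc as [Cc|[[-> ->]|Cc]].
  - pose proof (consec_left _ _ _ _ _ _ Hi Cc); pose proof (segment_within _ _ _ X2 Sr).
    unfold within in *; simpl in *; lra.
  - destruct Sr as (t & Ht & S1 & S2).
    rewrite (orient_segment _ _ _ _ _ _ S1 S2), orient_abb in Oc.
    assert (t = 1) by nra; subst t; apply point_eq; lra.
  - apply (segment_right_end _ _ _ X2 Sr).
    pose proof (consec_right _ _ _ _ _ _ Hi' Cc); simpl in *; lra. }
assert (vert : forall a, In a ord -> drawn ord E pos (pos a)) by (intros a Ha; left; exists a; auto).
assert (new : ~ drawn ord E pos (pos v)).
{ intros D; assert (E' := meetu _ D (on_segment_right _ _)); rewrite E' in X1; lra. }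
assert (seg : forall a b r, joins v u a b \/ joins v w a b -> on_segment (pos a) (pos b) r ->
   exists z, (z = u \/ z = w) /\ joins v z a b /\ on_segment (pos v) (pos z) r /\
     (drawn ord E pos r -> r = pos z)).
{ intros a b r [HJ|HJ] Sr; [exists u|exists w]; pose proof (drawn_joins _ _ _ _ _ _ HJ Sr) as Sv;
  repeat split; auto.
  intros D; apply meetu; auto using on_segment_sym. }
assert (ordz : forall z, z = u \/ z = w -> In z ord) by (intros z [->| ->]; auto).
constructor.
- intros a b [<-|Ha] [<-|Hb] Hab; auto.
  + destruct new; rewrite Hab; auto.
  + destruct new; rewrite <- Hab; auto.
  + exact (pic_inj _ _ _ _ H a b Ha Hb Hab).
- intros a b c [HE|HJ] Hc Ha Hb Hs.
  + destruct Hc as [<-|Hc]; [apply new; right; exists a, b; auto|].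
    exact (pic_off _ _ _ _ H a b c HE Hc Ha Hb Hs).
  + destruct (seg a b _ HJ Hs) as (z & Hz & Jz & Sz & Mz).
    destruct Hc as [<-|Hc]; [destruct Jz as [[-> ->]|[-> ->]]; auto|].
    assert (c = z) as -> by (apply (pic_inj _ _ _ _ H); auto).
    destruct Jz as [[-> ->]|[-> ->]]; auto.
- assert (cross : forall a b x y r, joins v u a b \/ joins v w a b -> E x y -> on_segment (pos a) (pos b) r ->
      on_segment (pos x) (pos y) r -> exists c, (c = a \/ c = b) /\ (c = x \/ c = y) /\ r = pos c).
  { intros a b x y r HJ HE Sa Sx.
    destruct (seg a b _ HJ Sa) as (z & Hz & Jz & Sz & Mz).
    assert (r = pos z) as -> by (apply Mz; right; exists x, y; auto).
    exists z; split; [destruct Jz as [[-> ->]|[-> ->]]; auto|split; [|auto]].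
    apply NNPP; intros N; apply (pic_off _ _ _ _ H x y z HE (ordz z Hz)); tauto. }
  intros a b x y r [HE|HJ] [HE'|HJ'] Hn Sa Sx.
  + exact (pic_cross _ _ _ _ H a b x y r HE HE' Hn Sa Sx).
  + destruct (cross x y a b r HJ' HE Sx Sa) as (c & C1 & C2 & C3); exists c; auto.
  + exact (cross a b x y r HJ HE' Sa Sx).
  + exists v; repeat split.
    * destruct HJ as [[[-> ->]|[-> ->]]|[[-> ->]|[-> ->]]]; auto.
    * destruct HJ' as [[[-> ->]|[-> ->]]|[[-> ->]|[-> ->]]]; auto.
    * assert (K : forall a b x y, joins v u a b -> joins v w x y -> on_segment (pos a) (pos b) r ->
         on_segment (pos x) (pos y) r -> r = pos v).
      { intros a' b' x' y' J1 J2 S1 S2; apply (drawn_joins _ _ _ _ _ _ J1), on_segment_sym in S1.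
        apply (drawn_joins _ _ _ _ _ _ J2) in S2.
        apply (segment_right_end _ _ _ X1 S1), (segment_within _ _ _ X2 S2). }
      destruct HJ as [HJ|HJ]; destruct HJ' as [HJ'|HJ'];
        [exfalso; apply Hn|exact (K a b x y HJ HJ' Sa Sx)|exact (K x y a b HJ' HJ Sx Sa)|exfalso; apply Hn];
        destruct HJ as [[-> ->]|[-> ->]]; destruct HJ' as [[-> ->]|[-> ->]]; unfold joins; auto.
- assert (old : forall r, drawn ord E pos r -> below (p1 ++ u :: v :: w :: p2) pos r).
  { intros r Dr; destruct (pic_below _ _ _ _ H r Dr) as [(c & d & Cc & Wc) Hb]; split.
    - rewrite consec_app, consec_cons in Cc.
      destruct Cc as [Cc|[[-> ->]|Cc]];
        [exists c, d; split; [rewrite consec_app; auto|auto]| |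
         exists c, d; split; [rewrite consec_app, !consec_cons; auto|auto]].
      destruct (Rle_dec (fst r) (fst (pos v))); [exists u, v|exists v, w];
        (split; [rewrite consec_app, !consec_cons; auto|unfold within in *; lra]).
    - assert (Huw : within (pos u) (pos w) r -> orient (pos u) (pos w) r <= 0).
      { intros W; apply Hb; auto; rewrite consec_app, consec_cons; auto. }
      intros c' d' Cc' Wc'; rewrite consec_app, !consec_cons in Cc'.
      destruct Cc' as [Cc'|[[-> ->]|[[-> ->]|Cc']]].
      + apply Hb; auto; rewrite consec_app; auto.
      + apply (below_apex_left _ (pos w)); auto; apply Huw; unfold within in *; lra.
      + apply (below_apex_right (pos u)); auto; apply Huw; unfold within in *; lra.
      + apply Hb; auto; rewrite consec_app, !consec_cons; auto. }
  assert (newu : forall r, on_segment (pos u) (pos v) r -> below (p1 ++ u :: v :: w :: p2) pos r).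
  { intros r Sr; pose proof (segment_within _ _ _ X1 Sr) as Wr; split.
    - exists u, v; split; [rewrite consec_app, consec_cons; auto|exact Wr].
    - intros c d Cc Wc; rewrite consec_app, !consec_cons in Cc; pose proof Cc as Cc'.
      destruct Cc as [Cc|[[-> ->]|[[-> ->]|Cc]]].
      + assert (r = pos u) as ->.
        { apply (segment_left_end _ _ _ X1 Sr).
          pose proof (consec_left _ _ _ _ _ _ Hi Cc); unfold within in *; simpl in *; lra. }
        apply (old _ (vert u Hu)); auto; rewrite consec_app; auto.
      + rewrite (on_segment_orient _ _ _ Sr); lra.
      + assert (r = pos v) as -> by (apply (segment_right_end _ _ _ X1 Sr), Wc).
        rewrite orient_aab; lra.
      + pose proof (consec_right _ _ _ _ _ _ Hi' Cc); unfold within in *; simpl in *; lra. }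
  assert (neww : forall r, on_segment (pos v) (pos w) r -> below (p1 ++ u :: v :: w :: p2) pos r).
  { intros r Sr; pose proof (segment_within _ _ _ X2 Sr) as Wr; split.
    - exists v, w; split; [rewrite consec_app, !consec_cons; auto|exact Wr].
    - intros c d Cc Wc; rewrite consec_app, !consec_cons in Cc; pose proof Cc as Cc'.
      destruct Cc as [Cc|[[-> ->]|[[-> ->]|Cc]]].
      + pose proof (consec_left _ _ _ _ _ _ Hi Cc); unfold within in *; simpl in *; lra.
      + assert (r = pos v) as -> by (apply (segment_left_end _ _ _ X2 Sr), Wc).
        rewrite orient_abb; lra.
      + rewrite (on_segment_orient _ _ _ Sr); lra.
      + assert (r = pos w) as ->.
        { apply (segment_right_end _ _ _ X2 Sr).
          pose proof (consec_right _ _ _ _ _ _ Hi' Cc); unfold within in *; simpl in *; lra. }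
        apply (old _ (vert w Hw)); auto; rewrite consec_app, !consec_cons; auto. }
  intros r [(c & [<-|Hc] & ->)|(a & b & [HE|[HJ|HJ]] & Sr)].
  + apply newu, on_segment_right.
  + apply old; auto.
  + apply old; right; exists a, b; auto.
  + apply newu, on_segment_sym, (drawn_joins _ _ _ _ _ _ HJ Sr).
  + apply neww, (drawn_joins _ _ _ _ _ _ HJ Sr).
- exact (sorted_by_add _ _ _ _ _ _ Hi (conj X1 X2)).
Qed.
End Steps.

(** * Realization with prescribed heights *)

Definition gapped {T : Type} (d : R) (X : T -> R) (p : list T) : Prop :=
  forall u w, consec p u w -> X u + d <= X w.

Definition upd {T : Type} (X : T -> R) (v : T) (t : R) (a : T) : R :=
  if excluded_middle_informative (a = v) then t else X a.

Definition decreasing_along {T : Type} (h : T -> R) (ord : list T) : Prop := sorted_by (fun a => - h a) ord.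

Section Realization.
Context {T : Type}.
Implicit Types (p q ord : list T) (u v w a b : T) (X h s : T -> R).

Lemma upd_same X v t : upd X v t v = t.
Proof. unfold upd; destruct excluded_middle_informative; tauto. Qed.

Lemma upd_other X v t a : a <> v -> upd X v t a = X a.
Proof. unfold upd; destruct excluded_middle_informative; tauto. Qed.

Lemma stacked_nodup p ord E : stacked p ord E -> NoDup p.
Proof.
induction 1 as [a b ne|p1 u w p2 ord E v nv st IH|p1 v w0 w1 p2 ord E st IH].
- constructor; [simpl; intuition|constructor; [simpl; auto|constructor]].
- replace (p1 ++ u :: v :: w :: p2) with ((p1 ++ [u]) ++ v :: w :: p2) by (rewrite <- app_assoc; reflexivity).
  replace (p1 ++ u :: w :: p2) with ((p1 ++ [u]) ++ w :: p2) in * by (rewrite <- app_assoc; reflexivity).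
  apply NoDup_Add with (a := v) (l := (p1 ++ [u]) ++ w :: p2); [apply Add_app|split; auto].
  intros Hv; apply nv; now apply (stacked_mem _ _ _ st).
- replace (p1 ++ v :: w1 :: p2) with ((p1 ++ [v]) ++ w1 :: p2) by (rewrite <- app_assoc; reflexivity).
  replace (p1 ++ v :: w0 :: w1 :: p2) with ((p1 ++ [v]) ++ w0 :: w1 :: p2) in IH by (rewrite <- app_assoc; reflexivity).
  exact (NoDup_remove_1 _ _ _ IH).
Qed.

Lemma stacked_ends p ord E : stacked p ord E -> forall a b, E a b -> In a ord /\ In b ord.
Proof.
intros st a b H; split; [exact (proj2 (stacked_mem _ _ _ st) a b H)|].
exact (proj2 (stacked_mem _ _ _ st) b a (stacked_sym _ _ _ st a b H)).
Qed.

(** Lets the abscissa of a new vertex be assigned while keeping the picture of the older ones. *)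
Lemma picture_ext p ord E (pos pos' : T -> point) : stacked p ord E ->
  (forall a, In a ord -> pos a = pos' a) -> planar_picture p ord E pos -> planar_picture p ord E pos'.
Proof.
intros st He H.
assert (HE : forall a b, E a b -> pos a = pos' a /\ pos b = pos' b).
{ intros a b Hab; destruct (stacked_ends _ _ _ st a b Hab); split; auto. }
assert (Hp : forall a, In a p -> pos a = pos' a) by (intros a Ha; apply He, (stacked_mem _ _ _ st), Ha).
constructor.
- intros u v Hu Hv; rewrite <- !He by assumption; exact (pic_inj _ _ _ _ H u v Hu Hv).
- intros u v w Huv Hw; destruct (HE u v Huv) as [<- <-]; rewrite <- He by assumption.
  exact (pic_off _ _ _ _ H u v w Huv Hw).
- intros u v x y r Huv Hxy N; destruct (HE u v Huv) as [E1 E2]; destruct (HE x y Hxy) as [E3 E4].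
  rewrite <- E1, <- E2, <- E3, <- E4; intros S1 S2.
  destruct (pic_cross _ _ _ _ H u v x y r Huv Hxy N S1 S2) as (w & W1 & W2 & W3).
  exists w; repeat split; auto; rewrite W3; destruct W1 as [->| ->]; auto.
- intros r D; assert (D' : drawn ord E pos r).
  { destruct D as [(w & Hw & ->)|(u & v & Huv & Sr)]; [left; exists w; split; [auto|symmetry; auto]|].
    right; exists u, v; destruct (HE u v Huv) as [-> ->]; auto. }
  destruct (pic_below _ _ _ _ H r D') as [(u & w & Cu & Wu) Hb]; split.
  + exists u, w; destruct (consec_mem _ _ _ Cu); rewrite <- !Hp by assumption; auto.
  + intros c d Cc; destruct (consec_mem _ _ _ Cc); rewrite <- !Hp by assumption; auto.
- intros p1 u p2 Ep w Hw; rewrite <- !Hp; [exact (pic_incr _ _ _ _ H p1 u p2 Ep w Hw)| |];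
    rewrite Ep, in_app_iff; simpl; auto.
Qed.

Lemma small_perturbation (c d : R) : c < 0 -> exists e0, 0 < e0 /\ forall e, 0 <= e <= e0 -> c + e * d < 0.
Proof.
intros Hc; pose proof (Rabs_pos d) as Hd.
(* With this bound [e * Rabs d] is at most half of [- c]; the summand 1 excludes a zero
   denominator. *)
exists (- c / (2 * (Rabs d + 1))); assert (P : 0 < 2 * (Rabs d + 1)) by lra; split.
- apply Rdiv_lt_0_compat; lra.
- intros e [E1 E2]; pose proof (Rle_abs d) as Ha.
  assert (e * (2 * (Rabs d + 1)) <= - c).
  { apply Rmult_le_compat_r with (r := 2 * (Rabs d + 1)) in E2; [|lra].
    unfold Rdiv in E2; rewrite Rmult_assoc, Rinv_l in E2 by lra; lra. }
  nra.
Qed.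

(** For fixed abscissae the orientation is linear in the heights, so tilting the lines changes it by
    a multiple of [e]. *)
Lemma orient_affine (xa xb xc ha hb hc sa sb sc e : R) :
  orient (xa, ha + e * sa) (xb, hb + e * sb) (xc, hc + e * sc) =
  orient (xa, ha) (xb, hb) (xc, hc) + e * orient (xa, sa) (xb, sb) (xc, sc).
Proof. unfold orient; simpl; ring. Qed.

(* The heights are prescribed in advance (up to a shear by e), as well as the abscissae of the upper boundary,
   provided that its gaps are large: a wide gap makes the boundary edges flat, hence visible from above. *)
Theorem stacked_realizable p ord E (h s : T -> R) : stacked p ord E -> decreasing_along h ord ->
  exists D0, 0 < D0 /\ forall X, gapped D0 X p ->
  exists xs, (forall a, In a p -> xs a = X a) /\ exists e0, 0 < e0 /\ forall e, 0 <= e <= e0 ->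
    planar_picture p ord E (fun a => (xs a, h a + e * (s a * xs a))).
Proof.
intros st; induction st as [a b ne|p1 u w p2 ord E v nv st IH|p1 v w0 w1 p2 ord E st IH]; intros Hh.
- exists 1; split; [lra|]; intros X HX; exists X; split; [auto|]; exists 1; split; [lra|]; intros e He.
  assert (Hab : X a + 1 <= X b) by (apply HX; exists [], []; reflexivity).
  set (pos := fun a => (X a, h a + e * (s a * X a))).
  assert (Xab : fst (pos a) < fst (pos b)) by (simpl; lra).
  assert (Cab : forall c d, consec [a; b] c d -> c = a /\ d = b).
  { intros c d C; rewrite consec_cons in C; destruct C as [C|C]; [auto|destruct (consec_one _ _ _ C)]. }
  constructor.
  + intros c d Hc Hd Hcd; apply (f_equal fst) in Hcd; simpl in *; intuition; subst; auto; lra.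
  + intros c d f J Hf Hc Hd; simpl in Hf; destruct J as [[-> ->]|[-> ->]]; intuition.
  + intros c d x y r J J' N; destruct J as [[-> ->]|[-> ->]]; destruct J' as [[-> ->]|[-> ->]]; destruct N; unfold joins; auto.
  + assert (sg : forall r, on_segment (pos a) (pos b) r -> below [a; b] pos r).
    { intros r Sr; split; [exists a, b; split; [exists [], []; reflexivity|exact (segment_within _ _ _ Xab Sr)]|].
      intros c d Cc _; destruct (Cab c d Cc) as [-> ->]; rewrite (on_segment_orient _ _ _ Sr); lra. }
    intros r [(c & [<-|[<-|[]]] & ->)|(c & d & J & Sr)]; apply sg; auto using on_segment_left, on_segment_right.
    exact (drawn_joins _ _ _ _ _ _ J Sr).
  + change (sorted_by (fun a => fst (pos a)) [a; b]); rewrite !sorted_by_cons; repeat split.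
    * intros c [<-|[]]; exact Xab.
    * intros c [].
    * intros q1 c q2 Hq; destruct q1; discriminate.
- unfold decreasing_along in Hh; rewrite sorted_by_cons in Hh; destruct Hh as [Hv Hh].
  destruct (IH Hh) as (D0 & PD & K); exists D0; split; [exact PD|]; intros X HX.
  assert (G1 : X u + D0 <= X v) by (apply HX; exists p1, (w :: p2); reflexivity).
  assert (G2 : X v + D0 <= X w) by (apply HX; exists (p1 ++ [u]), p2; rewrite <- app_assoc; reflexivity).
  destruct (K X) as (xs & Hxs & e0 & Pe & P).
  { intros c d Cc; rewrite consec_app, consec_cons in Cc; destruct Cc as [Cc|[[-> ->]|Cc]]; [|lra|];
      apply HX; rewrite consec_app, !consec_cons; auto. }
  pose proof (proj1 (stacked_mem _ _ _ st)) as Hm.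
  assert (Iu : In u ord) by (apply Hm; rewrite in_app_iff; simpl; auto).
  assert (Iw : In w ord) by (apply Hm; rewrite in_app_iff; simpl; auto).
  assert (xu : xs u = X u) by (apply Hxs; rewrite in_app_iff; simpl; auto).
  assert (xw : xs w = X w) by (apply Hxs; rewrite in_app_iff; simpl; auto).
  assert (uv : u <> v) by congruence.
  assert (wv : w <> v) by congruence.
  pose proof (Hv u Iu) as Hu'; pose proof (Hv w Iw) as Hw'; simpl in Hu', Hw'.
  (* [v] is higher than both [u] and [w] and lies between them, hence above uw. *)
  assert (O0 : - orient (X u, h u) (X w, h w) (X v, h v) < 0).
  { unfold orient; simpl; destruct (Rle_dec (h w) (h u)); nra. }
  destruct (small_perturbation _ (- orient (X u, s u * X u) (X w, s w * X w) (X v, s v * X v)) O0) as (e1 & Pe1 & Q).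
  exists (upd xs v (X v)); split.
  { intros a Ha; destruct (excluded_middle_informative (a = v)) as [->|n]; [apply upd_same|].
    rewrite upd_other by exact n; apply Hxs; rewrite in_app_iff in *; simpl in *.
    destruct Ha as [Ha|[Ha|[Ha|Ha]]]; auto; congruence. }
  exists (Rmin e0 e1); split; [apply Rmin_glb_lt; auto|]; intros e [E1 E2].
  assert (He0 : 0 <= e <= e0) by (pose proof (Rmin_l e0 e1); lra).
  assert (He1 : 0 <= e <= e1) by (pose proof (Rmin_r e0 e1); lra).
  apply picture_add.
  + apply (picture_ext _ _ _ _ _ st) with (2 := P e He0).
    intros a Ha; rewrite !upd_other by congruence; reflexivity.
  + exact Iu.
  + exact Iw.
  + exact (stacked_ends _ _ _ st).
  + simpl; rewrite upd_same, !upd_other by auto; lra.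
  + rewrite upd_same, !upd_other, xu, xw, orient_affine by auto; specialize (Q e He1); lra.
- pose proof (stacked_nodup _ _ _ st) as Np.
  replace (p1 ++ v :: w0 :: w1 :: p2) with ((p1 ++ [v]) ++ w0 :: w1 :: p2) in Np by (rewrite <- app_assoc; reflexivity).
  apply NoDup_remove_2 in Np; rewrite <- app_assoc in Np; simpl in Np.
  pose proof (proj1 (stacked_mem _ _ _ st)) as Hm.
  assert (I0 : In w0 (v :: ord)) by (apply Hm; rewrite in_app_iff; simpl; auto).
  assert (v0 : v <> w0) by (intros ->; apply Np; rewrite in_app_iff; simpl; auto).
  assert (w10 : w1 <> w0) by (intros ->; apply Np; rewrite in_app_iff; simpl; auto).
  assert (Hv : h w0 < h v).
  { unfold decreasing_along in Hh; rewrite sorted_by_cons in Hh; destruct Hh as [Hh _].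
    destruct I0 as [I0|I0]; [congruence|specialize (Hh w0 I0); simpl in Hh; lra]. }
  destruct (IH Hh) as (D0 & PD & K).
  (* [w0] goes at distance [D0] to the right of [v], and it is lower than [v], the most recent
     vertex. The segment from [v] to [w1] passes above it as soon as its horizontal extent exceeds
     [k]; the summand [2 * D0] leaves a gap [D0] on either side of [w0]. *)
  set (k := D0 * Rabs (h v - h w1) / (h v - h w0)).
  assert (Pk : 0 <= k).
  { unfold k; apply Rmult_le_pos; [apply Rmult_le_pos; [lra|apply Rabs_pos]|left; apply Rinv_0_lt_compat; lra]. }
  exists (2 * D0 + k + 1); split; [lra|]; intros X HX.
  assert (G1 : X v + (2 * D0 + k + 1) <= X w1) by (apply HX; exists p1, p2; reflexivity).
  destruct (K (upd X w0 (X v + D0))) as (xs & Hxs & e0 & Pe & P).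
  { intros c d Cc; rewrite consec_app, !consec_cons in Cc.
    destruct Cc as [Cc|[[-> ->]|[[-> ->]|Cc]]].
    - assert (c <> w0 /\ d <> w0) as [N1 N2].
      { destruct (consec_mem _ _ _ Cc) as [M1 M2]; split; intros ->; apply Np; rewrite in_app_iff in *; simpl in *; tauto. }
      rewrite !upd_other by assumption.
      assert (X c + (2 * D0 + k + 1) <= X d) by (apply HX; rewrite consec_app; auto); lra.
    - rewrite upd_same, upd_other by assumption; lra.
    - rewrite upd_same, upd_other by assumption; lra.
    - assert (c <> w0 /\ d <> w0) as [N1 N2].
      { destruct (consec_mem _ _ _ Cc) as [M1 M2]; split; intros ->; apply Np; rewrite in_app_iff in *; simpl in *; tauto. }
      rewrite !upd_other by assumption.
      assert (X c + (2 * D0 + k + 1) <= X d) by (apply HX; rewrite consec_app, !consec_cons; auto); lra. }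
  assert (xv : xs v = X v) by (rewrite Hxs by (rewrite in_app_iff; simpl; auto); apply upd_other; auto).
  assert (x1 : xs w1 = X w1) by (rewrite Hxs by (rewrite in_app_iff; simpl; auto); apply upd_other; auto).
  assert (x0 : xs w0 = X v + D0) by (rewrite Hxs by (rewrite in_app_iff; simpl; auto); apply upd_same).
  assert (O0 : orient (xs v, h v) (xs w1, h w1) (xs w0, h w0) < 0).
  { rewrite xv, x1, x0; unfold orient; simpl.
    assert (k * (h v - h w0) = D0 * Rabs (h v - h w1)) by (unfold k; field; lra).
    pose proof (Rle_abs (h v - h w1)); nra. }
  destruct (small_perturbation _ (orient (xs v, s v * xs v) (xs w1, s w1 * xs w1) (xs w0, s w0 * xs w0)) O0) as (e1 & Pe1 & Q).
  exists xs; split.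
  { intros a Ha; rewrite Hxs by (rewrite in_app_iff in *; simpl in *; tauto).
    apply upd_other; intros ->; apply Np; exact Ha. }
  exists (Rmin e0 e1); split; [apply Rmin_glb_lt; auto|]; intros e [E1 E2].
  assert (He0 : 0 <= e <= e0) by (pose proof (Rmin_l e0 e1); lra).
  assert (He1 : 0 <= e <= e1) by (pose proof (Rmin_r e0 e1); lra).
  apply (picture_fill _ _ _ w0).
  + exact (P e He0).
  + simpl; auto.
  + apply Hm; rewrite in_app_iff; simpl; auto.
  + rewrite orient_affine; exact (Q e He1).
Qed.
End Realization.

(** * Tracing a planar drawing on a grid *)

(** A Lebesgue number: every point is close to some centre relative to the radius of that centre,
    and the radii involved stay above [d0]. The radius 1 outside the square only makes it a total
    function. *)
Lemma unit_square_compact (Q : R -> R -> R -> Prop) :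
  (forall u v, 0 <= u <= 1 -> 0 <= v <= 1 -> exists d, 0 < d /\ Q u v d) ->
  exists d0, 0 < d0 /\ forall x y, 0 <= x <= 1 -> 0 <= y <= 1 ->
    exists u v d, 0 <= u <= 1 /\ 0 <= v <= 1 /\ Q u v d /\ Rabs (x - u) < d /\ Rabs (y - v) < d /\ d0 <= d.
Proof.
intros H.
assert (F : forall u v, exists d : posreal, 0 <= u <= 1 -> 0 <= v <= 1 -> Q u v d).
{ intros u v; destruct (classic (0 <= u <= 1 /\ 0 <= v <= 1)) as [[Hu Hv]|N].
  - destruct (H u v Hu Hv) as (d & Pd & Hd); exists (mkposreal d Pd); auto.
  - exists (mkposreal 1 Rlt_0_1); tauto. }
set (delta := fun u v => proj1_sig (constructive_indefinite_description _ (F u v))).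
assert (D : forall u v, 0 <= u <= 1 -> 0 <= v <= 1 -> Q u v (delta u v)).
{ intros u v; exact (proj2_sig (constructive_indefinite_description _ (F u v))). }
destruct (compactness_value_2d 0 1 0 1 delta) as [d Hd].
exists d; split; [apply cond_pos|]; intros x y Hx Hy.
destruct (NNPP _ (Hd x y Hx Hy)) as (u & v & Hu & Hv & H1 & H2 & H3).
exists u, v, (delta u v); repeat split; auto; tauto.
Qed.

Definition far (eta : R) (p q : point) : Prop :=
  eta <= Rabs (fst p - fst q) \/ eta <= Rabs (snd p - snd q).

Definition close (d : R) (p q : point) : Prop :=
  Rabs (fst p - fst q) <= d /\ Rabs (snd p - snd q) <= d.

Lemma far_mono eta eta' p q : eta' <= eta -> far eta p q -> far eta' p q.
Proof. intros H [F|F]; [left|right]; lra. Qed.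

Lemma separated_curves (f g : R -> point) : continuous_on_01 f -> continuous_on_01 g ->
  (forall s t, 0 <= s <= 1 -> 0 <= t <= 1 -> f s <> g t) ->
  exists eta, 0 < eta /\ forall s t, 0 <= s <= 1 -> 0 <= t <= 1 -> far eta (f s) (g t).
Proof.
intros Cf Cg N.
destruct (unit_square_compact (fun u v d => forall s t, 0 <= s <= 1 -> 0 <= t <= 1 ->
   Rabs (s - u) < d -> Rabs (t - v) < d -> far d (f s) (g t))) as (d0 & P0 & H).
- intros u v Hu Hv.
  (* Of the separation [3 * e] each curve can use up less than [e] near the chosen parameters, which
     leaves [e]. *)
  assert (E : exists e, 0 < e /\ far (3 * e) (f u) (g v)).
  { destruct (Req_dec (fst (f u)) (fst (g v))) as [E1|E1].
    - destruct (Req_dec (snd (f u)) (snd (g v))) as [E2|E2].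
      + exfalso; apply (N u v Hu Hv); destruct (f u), (g v); simpl in *; congruence.
      + assert (0 < Rabs (snd (f u) - snd (g v))) by (apply Rabs_pos_lt; lra).
        exists (Rabs (snd (f u) - snd (g v)) / 3); split; [lra|right; lra].
    - assert (0 < Rabs (fst (f u) - fst (g v))) by (apply Rabs_pos_lt; lra).
      exists (Rabs (fst (f u) - fst (g v)) / 3); split; [lra|left; lra]. }
  destruct E as (e & Pe & Fe).
  destruct (Cf u Hu e Pe) as (d1 & P1 & H1); destruct (Cg v Hv e Pe) as (d2 & P2 & H2).
  exists (Rmin e (Rmin d1 d2)); split; [repeat apply Rmin_glb_lt; auto|].
  intros s t Hs Ht Ds Dt.
  pose proof (Rmin_l e (Rmin d1 d2)); pose proof (Rmin_r e (Rmin d1 d2)).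
  pose proof (Rmin_l d1 d2); pose proof (Rmin_r d1 d2).
  destruct (H1 s Hs ltac:(lra)) as [A1 A2]; destruct (H2 t Ht ltac:(lra)) as [B1 B2].
  apply (far_mono e); [lra|]; unfold far in *.
  apply Rabs_def2 in A1, A2, B1, B2.
  destruct Fe as [Fe|Fe]; [left|right]; revert Fe; unfold Rabs; repeat destruct Rcase_abs; lra.
- exists d0; split; [exact P0|]; intros s t Hs Ht.
  destruct (H s t Hs Ht) as (u & v & d & Hu & Hv & Q & D1 & D2 & D3).
  apply (far_mono d); auto.
Qed.

Lemma uniformly_continuous_01 (f : R -> point) : continuous_on_01 f -> forall e, 0 < e ->
  exists d, 0 < d /\ forall s t, 0 <= s <= 1 -> 0 <= t <= 1 -> Rabs (s - t) < d -> close e (f s) (f t).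
Proof.
intros Cf e Pe.
(* The second coordinate is a dummy. The radius is doubled so that it also covers [t], which is
   close to [s] rather than to the centre. *)
destruct (unit_square_compact (fun u v d => forall s, 0 <= s <= 1 -> Rabs (s - u) < 2 * d ->
   close (e / 2) (f s) (f u))) as (d0 & P0 & H).
- intros u _ Hu _; destruct (Cf u Hu (e / 2) ltac:(lra)) as (d & Pd & Hd).
  exists (d / 2); split; [lra|]; intros s Hs Ds; destruct (Hd s Hs ltac:(lra)); split; lra.
- exists d0; split; [exact P0|]; intros s t Hs Ht Dst.
  destruct (H s s Hs Hs) as (u & v & d & Hu & Hv & Q & D1 & D2 & D3).
  destruct (Q s Hs ltac:(lra)) as [A1 A2].
  destruct (Q t Ht) as [B1 B2].
  { apply Rabs_def2 in Dst, D1; apply Rabs_def1; lra. }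
  apply Rabs_le_between in A1, A2, B1, B2.
  split; apply Rabs_le_between; lra.
Qed.

Lemma unit_interval_induction (P : R -> Prop) d : 0 < d -> P 0 ->
  (forall s t, 0 <= s <= 1 -> 0 <= t <= 1 -> Rabs (t - s) < d -> P s -> P t) ->
  forall t, 0 <= t <= 1 -> P t.
Proof.
intros Pd P0 Hs.
assert (K : forall k : nat, forall t, 0 <= t <= 1 -> t <= INR k * (d / 2) -> P t).
{ induction k as [|k IH]; intros t Ht Hk.
  - simpl in Hk; replace t with 0 by lra; exact P0.
  - rewrite S_INR in Hk; destruct (Rle_dec t (d / 2)) as [L|L].
    + apply (Hs 0 t); auto; [lra|]; apply Rabs_def1; lra.
    + apply (Hs (t - d / 2) t); auto; [lra| |apply IH; lra].
      apply Rabs_def1; lra. }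
intros t Ht; destruct (INR_unbounded (2 / d)) as [k Hk].
apply (K k t Ht).
assert (2 / d * (d / 2) = 1) by (field; lra).
assert (2 / d * (d / 2) <= INR k * (d / 2)) by (apply Rmult_le_compat_r; lra).
lra.
Qed.

Lemma bounded_curve (f : R -> point) : continuous_on_01 f ->
  exists B, 0 < B /\ forall t, 0 <= t <= 1 -> close B (f t) (0, 0).
Proof.
intros Cf.
destruct (uniformly_continuous_01 f Cf 1 Rlt_0_1) as (d & Pd & Hd).
assert (K : forall k : nat, forall t, 0 <= t <= 1 -> t <= INR k * (d / 2) -> close (INR k) (f t) (f 0)).
{ induction k as [|k IH]; intros t Ht Hk.
  - simpl in Hk; replace t with 0 by lra; split; unfold Rminus; rewrite Rplus_opp_r, Rabs_R0; simpl; lra.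
  - rewrite S_INR in *; pose proof (pos_INR k) as Pk.
    set (t' := Rmax 0 (t - d / 2)).
    assert (T : 0 <= t' <= t /\ t - d / 2 <= t') by (unfold t', Rmax; destruct Rle_dec; lra).
    assert (T2 : t' <= INR k * (d / 2)) by (unfold t', Rmax; destruct Rle_dec; nra).
    destruct (IH t') as [I1 I2]; [lra|lra|].
    destruct (Hd t t' Ht) as [J1 J2]; [lra|apply Rabs_def1; lra|].
    apply Rabs_le_between in I1, I2, J1, J2; split; apply Rabs_le_between; lra. }
destruct (INR_unbounded (2 / d)) as [k Hk].
exists (INR k + Rabs (fst (f 0)) + Rabs (snd (f 0)) + 1).
pose proof (pos_INR k); pose proof (Rabs_pos (fst (f 0))); pose proof (Rabs_pos (snd (f 0))).
split; [lra|]; intros t Ht; destruct (K k t Ht) as [K1 K2].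
{ assert (2 / d * (d / 2) = 1) by (field; lra).
  assert (2 / d * (d / 2) <= INR k * (d / 2)) by (apply Rmult_le_compat_r; lra).
  lra. }
pose proof (Rabs_triang (fst (f t) - fst (f 0)) (fst (f 0))).
pose proof (Rabs_triang (snd (f t) - snd (f 0)) (snd (f 0))).
split; simpl; [replace (fst (f t) - 0) with (fst (f t) - fst (f 0) + fst (f 0)) by ring|
  replace (snd (f t) - 0) with (snd (f t) - snd (f 0) + snd (f 0)) by ring]; lra.
Qed.

(** Paths of cells inside [P]. The trivial path at a cell outside [P] is allowed, hence the
    alternative in [linked_end]. *)
Definition linked (P : nat * nat -> Prop) : nat * nat -> nat * nat -> Prop :=
  clos_refl_trans _ (fun a b => adj4 a b /\ P a /\ P b).

Lemma linked_trans P a b c : linked P a b -> linked P b c -> linked P a c.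
Proof. exact (rt_trans _ _ a b c). Qed.

Lemma linked_mono (P Q : nat * nat -> Prop) a b : (forall c, P c -> Q c) -> linked P a b -> linked Q a b.
Proof.
intros H; induction 1 as [a b (A & Pa & Pb)|a|a b c _ IH1 _ IH2];
  [apply rt_step; auto|apply rt_refl|exact (linked_trans _ _ _ _ IH1 IH2)].
Qed.

Lemma adj4_sym a b : adj4 a b -> adj4 b a.
Proof. unfold adj4; intuition. Qed.

Lemma linked_sym P a b : linked P a b -> linked P b a.
Proof.
induction 1 as [a b (A & Pa & Pb)|a|a b c _ IH1 _ IH2];
  [apply rt_step; auto using adj4_sym|apply rt_refl|exact (linked_trans _ _ _ _ IH2 IH1)].
Qed.

Lemma linked_horizontal (P : nat * nat -> Prop) i i' j :
  (forall k, (i <= k <= i' \/ i' <= k <= i)%nat -> P (k, j)) -> linked P (i, j) (i', j).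
Proof.
assert (K : forall k i, (forall m, (i <= m <= i + k)%nat -> P (m, j)) -> linked P (i, j) ((i + k)%nat, j)).
{ induction k as [|k IH]; intros i0 H.
  - rewrite Nat.add_0_r; apply rt_refl.
  - apply (linked_trans _ _ ((i0 + k)%nat, j)).
    + apply IH; intros m Hm; apply H; lia.
    + apply rt_step; split; [right; simpl; split; [reflexivity|lia]|split; apply H; lia]. }
intros H; destruct (Nat.le_ge_cases i i') as [L|L].
- replace i' with (i + (i' - i))%nat by lia; apply K; intros m Hm; apply H; lia.
- apply linked_sym; replace i with (i' + (i - i'))%nat by lia; apply K; intros m Hm; apply H; lia.
Qed.

Lemma linked_vertical (P : nat * nat -> Prop) i j j' :
  (forall k, (j <= k <= j' \/ j' <= k <= j)%nat -> P (i, k)) -> linked P (i, j) (i, j').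
Proof.
assert (K : forall k j, (forall m, (j <= m <= j + k)%nat -> P (i, m)) -> linked P (i, j) (i, (j + k)%nat)).
{ induction k as [|k IH]; intros j0 H.
  - rewrite Nat.add_0_r; apply rt_refl.
  - apply (linked_trans _ _ (i, (j0 + k)%nat)).
    + apply IH; intros m Hm; apply H; lia.
    + apply rt_step; split; [left; simpl; split; [reflexivity|lia]|split; apply H; lia]. }
intros H; destruct (Nat.le_ge_cases j j') as [L|L].
- replace j' with (j + (j' - j))%nat by lia; apply K; intros m Hm; apply H; lia.
- apply linked_sym; replace j with (j' + (j - j'))%nat by lia; apply K; intros m Hm; apply H; lia.
Qed.

(** * Cells near a curve *)

Section Mesh.
Variables (d B : R).
Hypothesis d_pos : 0 < d.

(** Cell (i, j) stands for the point (i d - B, j d - B); the shift makes natural indices suffice for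
    the box of half-width [B]. With radius [2 * d], the cell of a point stays near when the point
    moves by at most [d], while two points near one cell differ by at most [4 * d] in each
    coordinate. *)
Definition near (c : nat * nat) (p : point) : Prop :=
  Rabs (INR (fst c) * d - (fst p + B)) <= 2 * d /\ Rabs (INR (snd c) * d - (snd p + B)) <= 2 * d.

Definition in_cell (c : nat * nat) (p : point) : Prop :=
  INR (fst c) * d <= fst p + B < INR (fst c) * d + d /\ INR (snd c) * d <= snd p + B < INR (snd c) * d + d.

Lemma floor_exists x : 0 <= x -> exists k : nat, INR k * d <= x < INR k * d + d.
Proof.
intros Hx; destruct (INR_unbounded (x / d)) as [m Hm].
assert (Hm' : x < INR m * d) by (apply Rlt_div_l in Hm; auto).
clear Hm; induction m as [|m IH].
- simpl in Hm'; lra.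
- destruct (Rlt_dec x (INR m * d)) as [L|L]; [auto|].
  exists m; rewrite S_INR in Hm'; lra.
Qed.

Lemma in_cell_exists p : close B p (0, 0) -> exists c, in_cell c p.
Proof.
intros [H1 H2]; simpl in *; apply Rabs_le_between in H1, H2.
destruct (floor_exists (fst p + B)) as [i Hi]; [lra|].
destruct (floor_exists (snd p + B)) as [j Hj]; [lra|].
exists (i, j); split; simpl; lra.
Qed.

Lemma in_cell_near c p q : in_cell c p -> close d p q -> near c q.
Proof.
intros [H1 H2] [C1 C2]; apply Rabs_le_between in C1, C2; split; apply Rabs_le_between; lra.
Qed.

Lemma close_refl p : close d p p.
Proof. split; apply Rabs_le_between; lra. Qed.

Lemma near_close c p q : near c p -> near c q -> ~ far (5 * d) p q.
Proof.
intros [H1 H2] [H3 H4]; apply Rabs_le_between in H1, H2, H3, H4.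
intros [F|F]; revert F; unfold Rabs; destruct Rcase_abs; lra.
Qed.

(** The cells near a point form a rectangular block, so an L-shaped path joins any two of them. *)
Lemma near_block c c' p : near c p -> near c' p -> linked (fun a => near a p) c c'.
Proof.
destruct c as [i j], c' as [i' j']; intros [H1 H2] [H3 H4]; simpl in *.
assert (mid : forall a b k x, (a <= k <= b)%nat -> Rabs (INR a * d - x) <= 2 * d -> Rabs (INR b * d - x) <= 2 * d ->
   Rabs (INR k * d - x) <= 2 * d).
{ intros a b k x [K1 K2] A1 A2; apply le_INR in K1, K2; apply Rabs_le_between in A1, A2.
  apply Rabs_le_between; nra. }
apply (linked_trans _ _ (i', j)).
- apply linked_horizontal; intros k [K|K]; split; simpl; eauto.
- apply linked_vertical; intros k [K|K]; split; simpl; eauto.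
Qed.

(** The blocks of successive points of the curve overlap: for close parameters, the cell of the
    first point is near both. *)
Lemma near_curve_linked (f : R -> point) c c' s t : continuous_on_01 f ->
  (forall t, 0 <= t <= 1 -> close B (f t) (0, 0)) ->
  0 <= s <= 1 -> 0 <= t <= 1 -> near c (f s) -> near c' (f t) ->
  linked (fun a => exists t, 0 <= t <= 1 /\ near a (f t)) c c'.
Proof.
intros Cf Bf Hs Ht Hc Hc'.
assert (blk : forall u a b, 0 <= u <= 1 -> near a (f u) -> near b (f u) ->
   linked (fun a => exists t, 0 <= t <= 1 /\ near a (f t)) a b).
{ intros u a b Hu Ha Hb; apply linked_mono with (2 := near_block a b (f u) Ha Hb).
  intros x Hx; exists u; auto. }
destruct (uniformly_continuous_01 f Cf d d_pos) as (del & Pd & Hd).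
assert (K : forall t, 0 <= t <= 1 -> forall a b, near a (f 0) -> near b (f t) ->
   linked (fun a => exists t, 0 <= t <= 1 /\ near a (f t)) a b).
{ intros t' Ht'; pattern t'; apply (unit_interval_induction _ del Pd); auto.
  - intros a b; apply (blk 0); lra.
  - intros u v Hu Hv Huv IH a b Ha Hb.
    destruct (in_cell_exists (f u) (Bf u Hu)) as [e He].
    apply (linked_trans _ _ e).
    + apply IH; [exact Ha|exact (in_cell_near _ _ _ He (close_refl _))].
    + apply (blk v); auto; apply (in_cell_near _ (f u)); [exact He|].
      apply Hd; auto; rewrite Rabs_minus_sym; exact Huv. }
destruct (in_cell_exists (f 0) (Bf 0 ltac:(lra))) as [e He].
assert (He' : near e (f 0)) by exact (in_cell_near _ _ _ He (close_refl _)).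
apply (linked_trans _ _ e); [apply linked_sym|]; [apply (K s)|apply (K t)]; auto.
Qed.

Lemma near_bound c p M : close B p (0, 0) -> 2 * B / d + 2 < INR M -> near c p ->
  (fst c < M)%nat /\ (snd c < M)%nat.
Proof.
intros [C1 C2] HM [H1 H2]; simpl in *; apply Rabs_le_between in C1, C2, H1, H2.
assert (HM' : 2 * B + 2 * d < INR M * d).
{ apply Rmult_lt_compat_r with (r := d) in HM; auto; unfold Rdiv in HM.
  rewrite Rmult_plus_distr_r, Rmult_assoc, Rinv_l in HM by lra; lra. }
split; apply INR_lt; nra.
Qed.

End Mesh.

Lemma finite_small (P : nat -> R -> Prop) (n : nat) :
  (forall i e e', 0 < e' <= e -> P i e -> P i e') ->
  (forall i, (i < n)%nat -> exists e, 0 < e /\ P i e) ->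
  exists e, 0 < e /\ forall i, (i < n)%nat -> P i e.
Proof.
intros Mono; induction n as [|n IH]; intros H.
- exists 1; split; [lra|intros; lia].
- destruct IH as (e1 & P1 & H1); [intros; apply H; lia|].
  destruct (H n) as (e2 & P2 & H2); [lia|].
  exists (Rmin e1 e2); split; [apply Rmin_glb_lt; auto|]; intros i Hi.
  assert (0 < Rmin e1 e2) by (apply Rmin_glb_lt; auto).
  destruct (Nat.eq_dec i n) as [->|ne].
  + apply (Mono n e2); [split; [auto|apply Rmin_r]|exact H2].
  + apply (Mono i e1); [split; [auto|apply Rmin_l]|apply H1; lia].
Qed.

Lemma linked_end P a b : linked P a b -> a = b \/ P b.
Proof.
induction 1 as [a b (A & Pa & Pb)|a|a b c _ IH1 _ IH2]; auto.
destruct IH2 as [->|]; auto.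
Qed.

(** All cells on the path are themselves reachable from [a], which lets the path be taken inside the
    reachable set. *)
Lemma linked_reach P a b : linked P a b -> linked (linked P a) a b.
Proof.
intros H; apply clos_rt_rtn1 in H; induction H as [|b c S _ IH]; [apply rt_refl|].
assert (R : linked P a b).
{ destruct (linked_end _ _ _ IH) as [->|R]; [apply rt_refl|exact R]. }
apply (linked_trans _ _ b); [exact IH|]; apply rt_step.
split; [apply S|split; [exact R|]].
apply (linked_trans _ _ b); [exact R|apply rt_step; exact S].
Qed.

(** * Stars and middle thirds of the arcs *)

Section Drawing.
Variables (n : nat) (E : nat -> nat -> Prop) (pos : nat -> point) (arc : nat -> nat -> R -> point).
Hypothesis graph : simple_graph n E.
Hypothesis pos_inj : forall u v, (u < n)%nat -> (v < n)%nat -> pos u = pos v -> u = v.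
Hypothesis arcs : forall u v, E u v ->
   continuous_on_01 (arc u v) /\
   (forall s t, 0 <= s <= 1 -> 0 <= t <= 1 -> arc u v s = arc u v t -> s = t) /\
   arc u v 0 = pos u /\ arc u v 1 = pos v.
Hypothesis arc_vertex : forall u v w, E u v -> (w < n)%nat -> w <> u -> w <> v -> ~ on_arc (arc u v) (pos w).
Hypothesis arc_cross : forall u v x y r, E u v -> E x y -> ~ same_edge u v x y ->
   on_arc (arc u v) r -> on_arc (arc x y) r ->
   exists w, (w = u \/ w = v) /\ (w = x \/ w = y) /\ r = pos w.

(** [planar] provides two unrelated arcs for an edge, [arc u v] and [arc v u]; this selects one of
    them. *)
Definition oriented u v := E u v /\ (u < v)%nat.

Lemma oriented_lt u v : oriented u v -> (u < n)%nat /\ (v < n)%nat.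
Proof. intros [H _]; exact (proj1 graph u v H). Qed.

Lemma arc_meets_vertex u v w s : oriented u v -> (w < n)%nat -> 0 <= s <= 1 -> arc u v s = pos w ->
  (w = u /\ s = 0) \/ (w = v /\ s = 1).
Proof.
intros [Huv Hlt] Hw Hs Hr; destruct (arcs u v Huv) as (_ & Inj & A0 & A1).
destruct (Nat.eq_dec w u) as [->|nu]; [left; split; auto; apply Inj; auto; [lra|congruence]|].
destruct (Nat.eq_dec w v) as [->|nv]; [right; split; auto; apply Inj; auto; [lra|congruence]|].
exfalso; apply (arc_vertex u v w Huv Hw nu nv); exists s; auto.
Qed.

Lemma arcs_meet u v x y s t : oriented u v -> oriented x y -> 0 <= s <= 1 -> 0 <= t <= 1 -> arc u v s = arc x y t ->
  (u = x /\ v = y /\ s = t) \/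
  exists w, ((w = u /\ s = 0) \/ (w = v /\ s = 1)) /\ ((w = x /\ t = 0) \/ (w = y /\ t = 1)).
Proof.
intros Huv Hxy Hs Ht Hr; pose proof (oriented_lt _ _ Huv) as [Lu Lv].
destruct (classic (same_edge u v x y)) as [[[-> ->]|[-> ->]]|N].
- left; repeat split; apply (arcs x y); auto; apply Hxy.
- destruct Huv, Hxy; lia.
- right; destruct (arc_cross u v x y (arc u v s)) as (w & W1 & W2 & W3);
    [apply Huv|apply Hxy|exact N|exists s; auto|exists t; auto|].
  assert (Lw : (w < n)%nat) by (destruct W1; subst; auto).
  exists w; split; [apply arc_meets_vertex; auto|apply arc_meets_vertex; auto; congruence].
Qed.

(** Arcs with a common end are not at positive distance, so they are cut into thirds. Then stars of
    distinct vertices are disjoint, as are middle thirds of distinct edges, and a star meets only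
    the middle thirds of its own arcs. *)
Definition star (a : nat) (r : point) : Prop := r = pos a \/
  exists u v s, oriented u v /\ r = arc u v s /\ ((a = u /\ 0 <= s <= 1/3) \/ (a = v /\ 2/3 <= s <= 1)).

Definition middle u v (r : point) : Prop := exists s, 1/3 <= s <= 2/3 /\ r = arc u v s.

Lemma star_disjoint a b r : (a < n)%nat -> (b < n)%nat -> star a r -> star b r -> a = b.
Proof.
intros La Lb [->|(u & v & s & Huv & -> & Hs)] [Hb|(x & y & t & Hxy & Hb & Ht)].
- apply pos_inj; auto.
- symmetry in Hb; apply arc_meets_vertex in Hb; auto; [|lra].
  destruct Hb as [[-> ->]|[-> ->]]; destruct Ht as [[-> Ht]|[-> Ht]]; auto; lra.
- apply arc_meets_vertex in Hb; auto; [|lra].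
  destruct Hb as [[-> ->]|[-> ->]]; destruct Hs as [[-> Hs]|[-> Hs]]; auto; lra.
- apply arcs_meet in Hb; auto; [|lra|lra].
  destruct Hb as [(-> & -> & ->)|(w & [[W1 S1]|[W1 S1]] & [[W2 T1]|[W2 T1]])];
  destruct Hs as [[-> Hs]|[-> Hs]]; destruct Ht as [[-> Ht]|[-> Ht]]; try congruence; lra.
Qed.

Lemma star_middle a u v r : (a < n)%nat -> oriented u v -> star a r -> middle u v r -> a = u \/ a = v.
Proof.
intros La Huv [->|(x & y & t & Hxy & -> & Ht)] (s & Hs & Hr).
- symmetry in Hr; apply arc_meets_vertex in Hr; auto; [|lra]; tauto.
- apply arcs_meet in Hr; auto; [|lra|lra].
  destruct Hr as [(-> & -> & ->)|(w & [[W1 S1]|[W1 S1]] & [[W2 T1]|[W2 T1]])]; try lra; tauto.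
Qed.

Lemma middle_disjoint u v x y r : oriented u v -> oriented x y -> middle u v r -> middle x y r -> u = x /\ v = y.
Proof.
intros Huv Hxy (s & Hs & ->) (t & Ht & Hr); apply arcs_meet in Hr; auto; [|lra|lra].
destruct Hr as [(-> & -> & _)|(w & [[W1 S1]|[W1 S1]] & _)]; auto; lra.
Qed.

(** All compact pieces as curves on the unit interval: a vertex as a constant curve, then the first,
    middle and last thirds of an arc. The last third is run backwards so that pieces of a star start
    at its vertex. *)
Definition piece (k u v : nat) (t : R) : point :=
  match k with
  | 0 => pos u
  | 1 => arc u v (t / 3)
  | 2 => arc u v ((1 + t) / 3)
  | _ => arc u v (1 - t / 3)
  end.

Definition valid (k u v : nat) : Prop := (u < n)%nat /\ (v < n)%nat /\ (k = 0%nat \/ oriented u v).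

Lemma continuous_reparam g a b : continuous_on_01 g -> (forall t, 0 <= t <= 1 -> 0 <= a + b * t <= 1) ->
  Rabs b <= 1 -> continuous_on_01 (fun t => g (a + b * t)).
Proof.
intros Cg Hab Hb t Ht e Pe; destruct (Cg _ (Hab t Ht) e Pe) as (d & Pd & Hd).
exists d; split; [exact Pd|]; intros s Hs Ds; apply Hd; auto.
replace (a + b * s - (a + b * t)) with (b * (s - t)) by ring; rewrite Rabs_mult.
pose proof (Rabs_pos (s - t)); pose proof (Rabs_pos b); nra.
Qed.

Lemma continuous_ext f g : (forall t, f t = g t) -> continuous_on_01 f -> continuous_on_01 g.
Proof.
intros H Cf t Ht e Pe; destruct (Cf t Ht e Pe) as (d & Pd & Hd); exists d; split; [exact Pd|].
intros s; rewrite <- !H; apply Hd.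
Qed.

Lemma piece_continuous k u v : valid k u v -> continuous_on_01 (piece k u v).
Proof.
intros (_ & _ & Hv); destruct k as [|k].
- intros t Ht e Pe; exists 1; split; [lra|]; intros s _ _; simpl.
  rewrite !Rminus_diag, Rabs_R0; auto.
- assert (Huv : E u v) by (destruct Hv as [Hv|Hv]; [discriminate|apply Hv]).
  destruct (arcs u v Huv) as (Ca & _).
  destruct k as [|[|k]].
  + apply (continuous_ext (fun t => arc u v (0 + 1/3 * t))); [intros t; simpl; f_equal; field|].
    apply continuous_reparam; auto; [intros; lra|apply Rabs_le_between; lra].
  + apply (continuous_ext (fun t => arc u v (1/3 + 1/3 * t))); [intros t; simpl; f_equal; field|].
    apply continuous_reparam; auto; [intros; lra|apply Rabs_le_between; lra].
  + apply (continuous_ext (fun t => arc u v (1 + - (1/3) * t))); [intros t; simpl; f_equal; field|].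
    apply continuous_reparam; auto; [intros; lra|apply Rabs_le_between; lra].
Qed.

Lemma star_piece a r : (a < n)%nat -> star a r -> exists k u v t, (k < 4)%nat /\ valid k u v /\ 0 <= t <= 1 /\
  r = piece k u v t /\ piece k u v 0 = pos a /\ forall t, 0 <= t <= 1 -> star a (piece k u v t).
Proof.
intros La [->|(u & v & s & Huv & -> & Hs)].
- exists 0%nat, a, a, 0; repeat split; auto; try lra; try lia; left; reflexivity.
- pose proof (oriented_lt _ _ Huv) as [Lu Lv]; destruct (arcs u v (proj1 Huv)) as (_ & _ & A0 & A1).
  destruct Hs as [[-> Hs]|[-> Hs]].
  + exists 1%nat, u, v, (3 * s); repeat split; auto; try lra; try lia; simpl.
    * f_equal; field.
    * rewrite <- A0; f_equal; field.
    * intros t Ht; right; exists u, v, (t / 3); split; [exact Huv|split; [reflexivity|left; split; [reflexivity|lra]]].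
  + exists 3%nat, u, v, (3 * (1 - s)); repeat split; auto; try lra; try lia; simpl.
    * f_equal; field.
    * rewrite <- A1; f_equal; field.
    * intros t Ht; right; exists u, v, (1 - t / 3); split; [exact Huv|split; [reflexivity|right; split; [reflexivity|lra]]].
Qed.

Lemma middle_piece u v r : oriented u v -> middle u v r <-> exists t, 0 <= t <= 1 /\ r = piece 2 u v t.
Proof.
intros Huv; split.
- intros (s & Hs & ->); exists (3 * s - 1); split; [lra|simpl; f_equal; field].
- intros (t & Ht & ->); exists ((1 + t) / 3); split; [lra|reflexivity].
Qed.

Lemma pieces_separated : exists eta, 0 < eta /\
  forall k u v k' u' v', (k < 4)%nat -> (k' < 4)%nat -> valid k u v -> valid k' u' v' ->
  (forall s t, 0 <= s <= 1 -> 0 <= t <= 1 -> piece k u v s <> piece k' u' v' t) ->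
  forall s t, 0 <= s <= 1 -> 0 <= t <= 1 -> far eta (piece k u v s) (piece k' u' v' t).
Proof.
pose (P := fun k u v k' u' v' eta => valid k u v -> valid k' u' v' ->
  (forall s t, 0 <= s <= 1 -> 0 <= t <= 1 -> piece k u v s <> piece k' u' v' t) ->
  forall s t, 0 <= s <= 1 -> 0 <= t <= 1 -> far eta (piece k u v s) (piece k' u' v' t)).
assert (M : forall k u v k' u' v' e e', 0 < e' <= e -> P k u v k' u' v' e -> P k u v k' u' v' e').
{ intros k u v k' u' v' e e' [_ He] H V V' N s t Hs Ht; apply (far_mono e); auto; apply H; auto. }
assert (H : exists eta, 0 < eta /\ forall k, (k < 4)%nat -> forall u, (u < n)%nat -> forall v, (v < n)%nat ->
   forall k', (k' < 4)%nat -> forall u', (u' < n)%nat -> forall v', (v' < n)%nat -> P k u v k' u' v' eta).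
{ apply finite_small; [intros; eapply M; eauto|intros k Hk].
  apply finite_small; [intros; eapply M; eauto|intros u Hu].
  apply finite_small; [intros; eapply M; eauto|intros v Hv].
  apply finite_small; [intros; eapply M; eauto|intros k' Hk'].
  apply finite_small; [intros; eapply M; eauto|intros u' Hu'].
  apply finite_small; [intros; eapply M; eauto|intros v' Hv'].
  destruct (classic (valid k u v /\ valid k' u' v' /\ forall s t, 0 <= s <= 1 -> 0 <= t <= 1 ->
     piece k u v s <> piece k' u' v' t)) as [(V & V' & N)|N].
  - destruct (separated_curves _ _ (piece_continuous _ _ _ V) (piece_continuous _ _ _ V') N) as (e & Pe & He).
    exists e; split; [exact Pe|]; intros _ _ _; exact He.
  - exists 1; split; [lra|]; intros V V' N'; exfalso; apply N; auto. }
destruct H as (eta & Pe & H); exists eta; split; [exact Pe|].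
intros k u v k' u' v' Hk Hk' V V'; pose proof V as (? & ? & _); pose proof V' as (? & ? & _); apply H; auto.
Qed.

Lemma pieces_bounded : exists B, 0 < B /\
  forall k u v, (k < 4)%nat -> valid k u v -> forall t, 0 <= t <= 1 -> close B (piece k u v t) (0, 0).
Proof.
(* The bound is written as an inverse because [finite_small] produces a common small number. *)
pose (P := fun k u v e => valid k u v -> forall t, 0 <= t <= 1 -> close (/ e) (piece k u v t) (0, 0)).
assert (M : forall k u v e e', 0 < e' <= e -> P k u v e -> P k u v e').
{ intros k u v e e' [Pe He] H V t Ht; destruct (H V t Ht).
  assert (/ e <= / e') by (apply Rinv_le_contravar; auto); split; lra. }
assert (H : exists e, 0 < e /\ forall k, (k < 4)%nat -> forall u, (u < n)%nat -> forall v, (v < n)%nat -> P k u v e).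
{ apply finite_small; [intros; eapply M; eauto|intros k Hk].
  apply finite_small; [intros; eapply M; eauto|intros u Hu].
  apply finite_small; [intros; eapply M; eauto|intros v Hv].
  destruct (classic (valid k u v)) as [V|N].
  - destruct (bounded_curve _ (piece_continuous _ _ _ V)) as (b & Pb & Hb).
    exists (/ b); split; [apply Rinv_0_lt_compat; auto|]; intros _; rewrite Rinv_inv; exact Hb.
  - exists 1; split; [lra|]; intros V; contradiction. }
destruct H as (e & Pe & H); exists (/ e); split; [apply Rinv_0_lt_compat; auto|].
intros k u v Hk V; pose proof V as (? & ? & _); apply H; auto.
Qed.

(** * Disjoint connected sets of cells for the vertices *)

Section Cells.
Variables (eta B d : R).
Hypothesis eta_pos : 0 < eta.
Hypothesis sep : forall k u v k' u' v', (k < 4)%nat -> (k' < 4)%nat -> valid k u v -> valid k' u' v' ->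
  (forall s t, 0 <= s <= 1 -> 0 <= t <= 1 -> piece k u v s <> piece k' u' v' t) ->
  forall s t, 0 <= s <= 1 -> 0 <= t <= 1 -> far eta (piece k u v s) (piece k' u' v' t).
Hypothesis bounded : forall k u v, (k < 4)%nat -> valid k u v ->
  forall t, 0 <= t <= 1 -> close B (piece k u v t) (0, 0).
Hypothesis d_pos : 0 < d.
Hypothesis d_eta : 5 * d < eta.

Definition star_cell a c := exists r, star a r /\ near d B c r.
Definition middle_cell u v c := exists r, middle u v r /\ near d B c r.

Lemma near_not_far c r r' : near d B c r -> near d B c r' -> ~ far eta r r'.
Proof.
intros N N' F; apply (near_close d B d_pos c r r' N N'); apply (far_mono eta); auto; lra.
Qed.

(** A cell near two disjoint pieces would bring points of them closer than [eta]. The next two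
    lemmas rest on the same remark. *)
Lemma star_cell_disjoint a b c : (a < n)%nat -> (b < n)%nat -> star_cell a c -> star_cell b c -> a = b.
Proof.
intros La Lb (r & Sr & Nr) (r' & Sr' & Nr'); apply NNPP; intros ne.
destruct (star_piece a r La Sr) as (k & u & v & t & Hk & V & Ht & -> & _ & P).
destruct (star_piece b r' Lb Sr') as (k' & u' & v' & t' & Hk' & V' & Ht' & -> & _ & P').
apply (near_not_far c _ _ Nr Nr'), sep; auto.
intros s s' Hs Hs' Hr; apply ne, (star_disjoint a b (piece k u v s)); auto; rewrite Hr; auto.
Qed.

Lemma oriented_valid u v : oriented u v -> valid 2 u v.
Proof. intros H; pose proof (oriented_lt _ _ H) as [? ?]; repeat split; auto. Qed.

Lemma star_middle_cell a u v c : (a < n)%nat -> oriented u v -> star_cell a c -> middle_cell u v c ->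
  a = u \/ a = v.
Proof.
intros La Huv (r & Sr & Nr) (r' & Sr' & Nr'); apply NNPP; intros ne.
destruct (star_piece a r La Sr) as (k & x & y & t & Hk & V & Ht & -> & _ & P).
apply (middle_piece _ _ _ Huv) in Sr'; destruct Sr' as (t' & Ht' & ->).
apply (near_not_far c _ _ Nr Nr'), sep; auto using oriented_valid.
intros s s' Hs Hs' Hr; apply ne, (star_middle a u v (piece k x y s)); auto.
rewrite Hr; apply middle_piece; eauto.
Qed.

Lemma middle_cell_disjoint u v x y c : oriented u v -> oriented x y -> middle_cell u v c -> middle_cell x y c ->
  u = x /\ v = y.
Proof.
intros Huv Hxy (r & Sr & Nr) (r' & Sr' & Nr'); apply NNPP; intros ne.
apply (middle_piece _ _ _ Huv) in Sr; destruct Sr as (t & Ht & ->).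
apply (middle_piece _ _ _ Hxy) in Sr'; destruct Sr' as (t' & Ht' & ->).
apply (near_not_far c _ _ Nr Nr'), sep; auto using oriented_valid.
intros s s' Hs Hs' Hr; apply ne, (middle_disjoint u v x y (piece 2 u v s)); auto.
- apply middle_piece; eauto.
- rewrite Hr; apply middle_piece; eauto.
Qed.

Lemma star_in_box a r : (a < n)%nat -> star a r -> close B r (0, 0).
Proof.
intros La Sr; destruct (star_piece a r La Sr) as (k & u & v & t & Hk & V & Ht & -> & _).
apply bounded; auto.
Qed.

Lemma middle_in_box u v r : oriented u v -> middle u v r -> close B r (0, 0).
Proof.
intros Huv Sr; apply (middle_piece _ _ _ Huv) in Sr; destruct Sr as (t & Ht & ->).
apply bounded; auto using oriented_valid.
Qed.

Lemma cell_at r : close B r (0, 0) -> exists c, near d B c r.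
Proof.
intros Hr; destruct (in_cell_exists d B d_pos r Hr) as [c Hc]; exists c.
exact (in_cell_near d B d_pos c r r Hc (close_refl d d_pos r)).
Qed.

Lemma star_linked a c c' : (a < n)%nat -> star_cell a c -> star_cell a c' -> linked (star_cell a) c c'.
Proof.
intros La.
assert (S0 : star a (pos a)) by (left; reflexivity).
destruct (cell_at (pos a)) as [c0 H0]; [exact (star_in_box a _ La S0)|].
assert (K : forall c, star_cell a c -> linked (star_cell a) c0 c).
{ intros e (r & Sr & Nr); destruct (star_piece a r La Sr) as (k & u & v & t & Hk & V & Ht & -> & P0 & P).
  apply (linked_mono (fun x => exists t, 0 <= t <= 1 /\ near d B x (piece k u v t))).
  - intros x (t' & Ht' & Nx); exists (piece k u v t'); auto.
  - apply (near_curve_linked d B d_pos (piece k u v) c0 e 0 t); auto; try lra.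
    + apply piece_continuous; auto.
    + rewrite P0; exact H0. }
intros Hc Hc'; apply (linked_trans _ _ c0); [apply linked_sym|]; auto.
Qed.

Lemma middle_linked u v c c' : oriented u v -> middle_cell u v c -> middle_cell u v c' ->
  linked (middle_cell u v) c c'.
Proof.
intros Huv (r & Sr & Nr) (r' & Sr' & Nr').
apply (middle_piece _ _ _ Huv) in Sr; destruct Sr as (t & Ht & ->).
apply (middle_piece _ _ _ Huv) in Sr'; destruct Sr' as (t' & Ht' & ->).
apply (linked_mono (fun x => exists t, 0 <= t <= 1 /\ near d B x (piece 2 u v t))).
- intros x (s & Hs & Nx); exists (piece 2 u v s); split; [apply middle_piece; eauto|exact Nx].
- apply (near_curve_linked d B d_pos (piece 2 u v) c c' t t'); auto.
  + apply piece_continuous, oriented_valid, Huv.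
  + intros s Hs; apply bounded; auto using oriented_valid.
Qed.

(* The share of u in the middle of uv: what is reached from its star before the star of v. *)
Definition tentacle u v c := (middle_cell u v c /\ ~ star_cell v c) /\
  exists c0, star_cell u c0 /\ linked (fun x => middle_cell u v x /\ ~ star_cell v x) c0 c.

Definition blob u c := star_cell u c \/ exists v, oriented u v /\ tentacle u v c.

(** A tentacle cell lies in the middle of its edge uv, so it can belong only to the star of [u] or
    [v], and that of [v] is excluded by definition. *)
Lemma blob_disjoint u w c : (u < n)%nat -> (w < n)%nat -> blob u c -> blob w c -> u = w.
Proof.
assert (K : forall a u v, (a < n)%nat -> oriented u v -> star_cell a c -> tentacle u v c -> a = u).
{ intros a x y La Hxy Sa [[M N] _]; destruct (star_middle_cell a x y c La Hxy Sa M) as [->| ->]; tauto. }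
intros Lu Lw [Su|(v & Hv & Tv)] [Sw|(x & Hx & Tx)].
- exact (star_cell_disjoint u w c Lu Lw Su Sw).
- exact (K u w x Lu Hx Su Tx).
- symmetry; exact (K w u v Lw Hv Sw Tv).
- apply (middle_cell_disjoint u v w x c Hv Hx); [apply Tv|apply Tx].
Qed.

(** A tentacle is what can be reached from the star, so [linked_reach] leads each of its cells back
    to the star without leaving the set. *)
Lemma blob_linked u c c' : (u < n)%nat -> blob u c -> blob u c' -> linked (blob u) c c'.
Proof.
intros Lu.
assert (K : forall c, blob u c -> exists c0, star_cell u c0 /\ linked (blob u) c0 c).
{ intros e [Se|(v & Hv & [[M N] (c0 & S0 & L0)])]; [exists e; split; [auto|apply rt_refl]|].
  exists c0; split; [exact S0|]; apply linked_reach in L0.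
  refine (linked_mono _ _ _ _ _ L0); intros x Hx.
  destruct (linked_end _ _ _ Hx) as [<-|Hx']; [left; exact S0|].
  right; exists v; split; [exact Hv|split; [exact Hx'|exists c0; auto]]. }
intros Hc Hc'; destruct (K c Hc) as (c0 & S0 & L0); destruct (K c' Hc') as (c1 & S1 & L1).
apply (linked_trans _ _ c0); [apply linked_sym; exact L0|].
apply (linked_trans _ _ c1); [|exact L1].
apply (linked_mono (star_cell u)); [left; auto|apply star_linked; auto].
Qed.

Lemma blob_adjacent u v : oriented u v -> exists c c', blob u c /\ blob v c' /\ adj4 c c'.
Proof.
intros Huv; pose proof (oriented_lt _ _ Huv) as [Lu Lv].
assert (SM : forall s, 1/3 <= s <= 2/3 -> middle u v (arc u v s)) by (intros s Hs; exists s; auto).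
destruct (cell_at (arc u v (1/3))) as [a Ha]; [apply (middle_in_box u v); auto; apply SM; lra|].
destruct (cell_at (arc u v (2/3))) as [b Hb]; [apply (middle_in_box u v); auto; apply SM; lra|].
assert (Ma : middle_cell u v a) by (exists (arc u v (1/3)); split; [apply SM; lra|exact Ha]).
assert (Mb : middle_cell u v b) by (exists (arc u v (2/3)); split; [apply SM; lra|exact Hb]).
assert (Sa : star_cell u a).
{ exists (arc u v (1/3)); split; [|exact Ha]; right; exists u, v, (1/3).
  split; [exact Huv|split; [reflexivity|left; split; [reflexivity|lra]]]. }
assert (Sb : star_cell v b).
{ exists (arc u v (2/3)); split; [|exact Hb]; right; exists u, v, (2/3).
  split; [exact Huv|split; [reflexivity|right; split; [reflexivity|lra]]]. }
assert (Na : ~ star_cell v a).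
{ intros Sv; pose proof (star_cell_disjoint u v a Lu Lv Sa Sv) as Q; destruct Huv; lia. }
assert (Ta : tentacle u v a).
{ split; [auto|]; exists a; split; [exact Sa|apply rt_refl]. }
pose proof (middle_linked u v a b Huv Ma Mb) as L; apply clos_rt_rt1n in L.
(* Walk through the middle cells from the star of [u] to that of [v]: up to the first cell in the
   star of [v], all cells belong to the tentacle. *)
revert Sb Ta; clear Ha Hb Ma Mb Sa Na; induction L as [a|a e b (A & Pa & Pe) _ IH]; intros Sb Ta.
- destruct Ta as [[_ N] _]; contradiction.
- destruct (classic (star_cell v e)) as [Se|Ne].
  + exists a, e; split; [right; exists v; auto|split; [left; exact Se|exact A]].
  + apply IH; auto; destruct Ta as [[Q1 Q2] (c0 & S0 & L0)]; split; [auto|].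
    exists c0; split; [exact S0|]; apply (linked_trans _ _ a); [exact L0|].
    apply rt_step; auto.
Qed.

Lemma blob_bounded u c M : (u < n)%nat -> 2 * B / d + 2 < INR M -> blob u c -> (fst c < M)%nat /\ (snd c < M)%nat.
Proof.
intros Lu HM [(r & Sr & Nr)|(v & Hv & [[(r & Sr & Nr) _] _])].
- exact (near_bound d B d_pos c r M (star_in_box u r Lu Sr) HM Nr).
- exact (near_bound d B d_pos c r M (middle_in_box u v r Hv Sr) HM Nr).
Qed.

Lemma blob_inhabited u : (u < n)%nat -> exists c, blob u c.
Proof.
intros Lu; assert (S0 : star u (pos u)) by (left; reflexivity).
destruct (cell_at (pos u)) as [c0 H0]; [exact (star_in_box u _ Lu S0)|].
exists c0; left; exists (pos u); auto.
Qed.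

End Cells.
End Drawing.

Theorem planar_grid_minor (n : nat) (E : nat -> nat -> Prop) : simple_graph n E -> planar n E ->
  exists (M : nat) (lab : nat * nat -> option nat),
    (forall c v, lab c = Some v -> (v < n)%nat /\ (fst c < M)%nat /\ (snd c < M)%nat) /\
    (forall v, (v < n)%nat -> exists c, lab c = Some v) /\
    (forall c c' v, lab c = Some v -> lab c' = Some v -> linked (fun a => lab a = Some v) c c') /\
    (forall u v, E u v -> exists c c', lab c = Some u /\ lab c' = Some v /\ adj4 c c').
Proof.
intros G (pos & arc & Hp & Ha & Hv & Hc).
destruct (pieces_separated n E pos arc Ha) as (eta & Pe & sep).
destruct (pieces_bounded n E pos arc Ha) as (B & PB & bnd).
set (d := eta / 6); assert (Pd : 0 < d) by (unfold d; lra); assert (De : 5 * d < eta) by (unfold d; lra).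
destruct (INR_unbounded (2 * B / d + 2)) as [M HM].
pose (S := blob E pos arc B d).
assert (U : forall c, exists o, (forall v, o = Some v <-> (v < n)%nat /\ S v c)).
{ intros c; destruct (classic (exists v, (v < n)%nat /\ S v c)) as [(v & Lv & Sv)|N].
  - exists (Some v); intros w; split; [intros [= <-]; auto|].
    intros [Lw Sw]; f_equal; eapply blob_disjoint; eauto.
  - exists None; intros w; split; [discriminate|intros H; exfalso; eauto]. }
exists M, (fun c => proj1_sig (constructive_indefinite_description _ (U c))).
assert (L : forall c v, proj1_sig (constructive_indefinite_description _ (U c)) = Some v <-> (v < n)%nat /\ S v c).
{ intros c; exact (proj2_sig (constructive_indefinite_description _ (U c))). }
split; [|split; [|split]].
- intros c v H; apply L in H; destruct H as [Lv Sv]; split; [exact Lv|].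
  eapply blob_bounded; eauto.
- intros v Lv; assert (I : exists c, S v c) by (eapply blob_inhabited; eauto); destruct I as [c Sc].
  exists c; apply L; auto.
- intros c c' v H H'; apply L in H, H'; destruct H as [Lv Sv]; destruct H' as [_ Sv'].
  apply (linked_mono (S v)); [intros x Sx; apply L; auto|].
  eapply blob_linked; eauto.
- assert (K : forall u v, oriented E u v -> exists c c', S u c /\ S v c' /\ adj4 c c').
  { intros u v Huv; eapply blob_adjacent; eauto. }
  intros u v Huv; pose proof (proj1 G u v Huv) as [Lu Lv].
  destruct (Nat.lt_trichotomy u v) as [L1|[->|L1]].
  + destruct (K u v) as (c & c' & S1 & S2 & A); [split; auto|].
    exists c, c'; repeat split; try apply L; auto.
  + destruct (proj2 (proj2 G) v Huv).
  + destruct (K v u) as (c & c' & S1 & S2 & A); [split; auto; apply G; exact Huv|].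
    exists c', c; repeat split; try apply L; auto; apply adj4_sym; exact A.
Qed.

(** * Placing the vertices on the lines *)

Lemma stacked_order_nodup {T : Type} (p ord : list T) E : stacked p ord E -> NoDup ord.
Proof.
induction 1 as [a b ne|p1 u w p2 ord E v nv st IH|p1 v w0 w1 p2 ord E st IH]; [|constructor; auto|exact IH].
constructor; [simpl; intuition congruence|constructor; [simpl; auto|constructor]].
Qed.

Lemma gapped_exists {T : Type} (D : R) (p : list T) : NoDup p -> exists X, gapped D X p.
Proof.
induction p as [|u [|w p] IH]; intros N.
- exists (fun _ => 0); intros a b C; apply consec_mem in C; destruct (proj1 C).
- exists (fun _ => 0); intros a b C; destruct (consec_one _ _ _ C).
- inversion N as [|? ? Nu Np]; subst; destruct (IH Np) as [X HX].
  exists (upd X u (X w - D)); intros a b C; rewrite consec_cons in C; destruct C as [[-> ->]|C].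
  + rewrite upd_same, upd_other by (intros ->; apply Nu; simpl; auto); lra.
  + destruct (consec_mem _ _ _ C) as [Ia Ib].
    rewrite !upd_other by (intros ->; auto); apply HX; exact C.
Qed.

(** The order is decreasing because the placed vertices are listed with the most recent, hence
    highest, first. *)
Lemma sort_by (t : nat -> R) (l : list nat) : NoDup l ->
  (forall i j, In i l -> In j l -> t i = t j -> i = j) ->
  exists l', Permutation l l' /\ sorted_by (fun i => - t i) l'.
Proof.
assert (ins : forall i l, sorted_by (fun i => - t i) l -> (forall j, In j l -> t j <> t i) ->
  exists l', Permutation (i :: l) l' /\ sorted_by (fun i => - t i) l').
{ intros i m; induction m as [|j m IH]; intros Sm N.
  - exists [i]; split; [apply Permutation_refl|]; apply sorted_by_cons; split; [intros w []|exact Sm].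
  - apply sorted_by_cons in Sm as [S1 S2].
    destruct (Rlt_dec (t j) (t i)) as [L|L].
    + exists (i :: j :: m); split; [apply Permutation_refl|]; apply sorted_by_cons; split.
      * intros w [<-|Hw]; [lra|specialize (S1 w Hw); simpl in S1; lra].
      * apply sorted_by_cons; auto.
    + destruct IH as (l' & Pl & Sl); [exact S2|intros k Hk; apply N; simpl; auto|].
      exists (j :: l'); split.
      * apply Permutation_trans with (j :: i :: m); [apply perm_swap|constructor; exact Pl].
      * apply sorted_by_cons; split; [|exact Sl]; intros w Hw.
        apply (Permutation_in _ (Permutation_sym Pl)) in Hw; destruct Hw as [<-|Hw]; [|exact (S1 w Hw)].
        assert (t j <> t i) by (apply N; simpl; auto); lra. }
induction l as [|i l IH]; intros N Inj.
- exists []; split; [constructor|]; intros p1 u p2 Hp; destruct p1; discriminate.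
- inversion N as [|? ? Ni Nl]; subst; destruct IH as (l' & Pl & Sl); [exact Nl|intros; apply Inj; simpl; auto|].
  destruct (ins i l' Sl) as (l'' & Pl' & Sl').
  { intros j Hj Eq; apply (Permutation_in _ (Permutation_sym Pl)) in Hj.
    apply Ni; rewrite <- (Inj j i); simpl; auto. }
  exists l''; split; [|exact Sl']; apply Permutation_trans with (i :: l'); auto.
Qed.

Definition holds (P : Prop) : bool := if excluded_middle_informative P then true else false.

Lemma holds_true P : holds P = true <-> P.
Proof. unfold holds; destruct excluded_middle_informative; split; auto; discriminate. Qed.

(* The special vertices receive the prescribed heights in order, the other ones fit in between. *)
Lemma interleave_heights {T : Type} (special : T -> Prop) (t : nat -> R) (ord : list T) :
  NoDup ord -> forall (is : list nat) (ub : R), sorted_by (fun i => - t i) is -> (forall i, In i is -> t i < ub) ->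
  length is = length (filter (fun a => holds (special a)) ord) ->
  exists (h : T -> R) (lbl : T -> nat), decreasing_along h ord /\ (forall a, In a ord -> h a < ub) /\
    (forall a, In a ord -> special a -> In (lbl a) is /\ h a = t (lbl a)) /\
    (forall a b, In a ord -> In b ord -> special a -> special b -> lbl a = lbl b -> a = b).
Proof.
induction ord as [|v ord IH]; intros N is ub Sis Hub Len.
- exists (fun _ => 0), (fun _ => 0%nat); split; [|split; [|split]].
  + intros p1 u p2 Hp; destruct p1; discriminate.
  + intros a [].
  + intros a [].
  + intros a b [].
- inversion N as [|? ? Nv No]; subst; simpl in Len.
  (* The head [v] takes the height [hv], which becomes the upper bound for the older vertices, and
     [is'] lists the prescribed heights still to be used. *)
  assert (step : forall is' hv lv, sorted_by (fun i => - t i) is' -> (forall i, In i is' -> t i < hv) -> hv < ub ->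
     (forall i, In i is' -> In i is) -> length is' = length (filter (fun a => holds (special a)) ord) ->
     (special v -> In lv is /\ ~ In lv is' /\ hv = t lv) ->
     exists (h : T -> R) (lbl : T -> nat), decreasing_along h (v :: ord) /\ (forall a, In a (v :: ord) -> h a < ub) /\
       (forall a, In a (v :: ord) -> special a -> In (lbl a) is /\ h a = t (lbl a)) /\
       (forall a b, In a (v :: ord) -> In b (v :: ord) -> special a -> special b -> lbl a = lbl b -> a = b)).
  { intros is' hv lv S' H' Hv Inc Len' Sv.
    destruct (IH No is' hv S' H' Len') as (h & lbl & D & U & P & Q).
    assert (hold : forall a, In a ord -> upd h v hv a = h a) by (intros a Ha; apply upd_other; congruence).
    set (lbl' := fun a => if excluded_middle_informative (a = v) then lv else lbl a).
    assert (lv' : lbl' v = lv) by (unfold lbl'; destruct excluded_middle_informative; tauto).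
    assert (lo : forall a, In a ord -> lbl' a = lbl a).
    { intros a Ha; unfold lbl'; destruct excluded_middle_informative; congruence. }
    exists (upd h v hv), lbl'; split; [|split; [|split]].
    - apply sorted_by_cons; split.
      + intros a Ha; rewrite upd_same, hold by exact Ha; specialize (U a Ha); lra.
      + intros p1 u p2 Hp w Hw; assert (In u ord) by (rewrite Hp, in_app_iff; simpl; auto).
        assert (In w ord) by (rewrite Hp, in_app_iff; simpl; auto).
        rewrite !hold by assumption; exact (D p1 u p2 Hp w Hw).
    - intros a [<-|Ha]; [rewrite upd_same; exact Hv|rewrite hold by exact Ha; specialize (U a Ha); lra].
    - intros a [<-|Ha] Sa.
      + rewrite upd_same, lv'; destruct (Sv Sa) as (? & ? & ?); auto.
      + rewrite hold, lo by exact Ha; destruct (P a Ha Sa); auto.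
    - intros a b [<-|Ha] [<-|Hb] Sa Sb E; auto.
      + exfalso; rewrite lv', lo in E by exact Hb; destruct (Sv Sa) as (_ & N1 & _); apply N1.
        rewrite E; apply P; auto.
      + exfalso; rewrite lv', lo in E by exact Ha; destruct (Sv Sb) as (_ & N1 & _); apply N1.
        rewrite <- E; apply P; auto.
      + rewrite !lo in E by assumption; auto. }
  destruct (holds (special v)) eqn:Hs.
  + destruct is as [|i is]; [discriminate|]; simpl in Len; injection Len as Len.
    apply sorted_by_cons in Sis as [S1 S2].
    apply (step is (t i) i); auto; simpl; auto.
    * intros j Hj; specialize (S1 j Hj); simpl in S1; lra.
    * apply Hub; simpl; auto.
    * intros _; repeat split; auto; intros Hi; specialize (S1 i Hi); simpl in S1; lra.
  + assert (Ns : ~ special v) by (intros Sv; apply holds_true in Sv; congruence).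
    destruct is as [|i is].
    * apply (step [] (ub - 1) 0%nat); auto; try lra; try tauto; intros i [].
    * assert (t i < ub) by (apply Hub; simpl; auto).
      (* An ordinary vertex goes halfway between the bound and the next prescribed height; its label
         0 is a dummy. *)
      apply (step (i :: is) ((t i + ub) / 2) 0%nat); auto; try lra; try tauto.
      apply sorted_by_cons in Sis as [S1 S2].
      intros j [<-|Hj]; [lra|specialize (S1 j Hj); simpl in S1; lra].
Qed.

Lemma exceed (l : list R) : exists r, 0 < r /\ forall x, In x l -> x < r.
Proof.
induction l as [|x l (r & Pr & H)].
- exists 1; split; [lra|intros x []].
- exists (Rmax r (x + 1)); split; [apply Rlt_le_trans with r; [lra|apply Rmax_l]|].
  intros y [<-|Hy]; [apply Rlt_le_trans with (x + 1); [lra|apply Rmax_r]|].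
  apply Rlt_le_trans with r; [auto|apply Rmax_l].
Qed.

(* The transversal is the line (r, 0) + y (1, m); the quotients are the values of y where it meets the given lines. *)
Lemma transversal (n : nat) (L : nat -> line) :
  (forall i j, (1 <= i <= n)%nat -> (1 <= j <= n)%nat -> i <> j -> ~ same_line (L i) (L j)) ->
  exists r m, (forall i, (1 <= i <= n)%nat -> la (L i) + lb (L i) * m <> 0) /\
    forall i j, (1 <= i <= n)%nat -> (1 <= j <= n)%nat ->
      (lc (L i) - la (L i) * r) / (la (L i) + lb (L i) * m) = (lc (L j) - la (L j) * r) / (la (L j) + lb (L j) * m) ->
      i = j.
Proof.
intros H.
(* [m] is positive and exceeds the slope of every non-vertical line, so the transversal is parallel
   to none of the lines. *)
destruct (exceed (map (fun i => - la (L i) / lb (L i)) (seq 1 n))) as (m & Pm & Hm).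
set (k := fun i => la (L i) + lb (L i) * m).
assert (K : forall i, (1 <= i <= n)%nat -> k i <> 0).
{ intros i Hi Z; unfold k in Z.
  destruct (Req_dec (lb (L i)) 0) as [B|B].
  - destruct (l_nondeg (L i)) as [A|A]; [apply A; rewrite B in Z; lra|contradiction].
  - assert (- la (L i) / lb (L i) < m).
    { apply Hm, (in_map (fun i => - la (L i) / lb (L i))), in_seq; lia. }
    assert (m = - la (L i) / lb (L i)) by (field_simplify_eq; [lra|exact B]); lra. }
(* The only [r] for which lines i and j meet the transversal in the same point, when they are not
   parallel. *)
set (bad := fun i j => (lc (L j) * k i - lc (L i) * k j) / (la (L j) * k i - la (L i) * k j)).
destruct (exceed (flat_map (fun i => map (bad i) (seq 1 n)) (seq 1 n))) as (r & Pr & Hr).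
exists r, m; split; [exact K|]; intros i j Hi Hj E.
apply NNPP; intros ne; apply (H i j Hi Hj ne).
pose proof (K i Hi) as Ki; pose proof (K j Hj) as Kj; fold (k i) (k j) in E.
assert (E1 : (lc (L i) - la (L i) * r) * k j = (lc (L j) - la (L j) * r) * k i).
{ apply (f_equal (fun x => x * (k i * k j))) in E; field_simplify in E; auto; lra. }
(* The determinant is [m] times that of the two normal vectors, so as [m] is positive it vanishes
   only for parallel lines. Parallel lines with a common point on the transversal have proportional
   equations and coincide. *)
destruct (Req_dec (la (L j) * k i - la (L i) * k j) 0) as [Z|Z].
- assert (Zc : lc (L i) * k j = lc (L j) * k i).
  { replace (lc (L i) * k j) with ((lc (L i) - la (L i) * r) * k j + r * (la (L i) * k j)) by ring.
    replace (lc (L j) * k i) with ((lc (L j) - la (L j) * r) * k i + r * (la (L j) * k i)) by ring.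
    rewrite E1; replace (la (L i) * k j) with (la (L j) * k i) by lra; reflexivity. }
  assert (Zb : lb (L i) * k j = lb (L j) * k i).
  { assert (m * (la (L j) * lb (L i) - la (L i) * lb (L j)) = 0) by (unfold k in Z; lra).
    assert (la (L j) * lb (L i) - la (L i) * lb (L j) = 0) by nra.
    unfold k; lra. }
  intros [x y]; unfold on_line; simpl.
  assert (I : (la (L i) * x + lb (L i) * y - lc (L i)) * k j = (la (L j) * x + lb (L j) * y - lc (L j)) * k i).
  { replace ((la (L i) * x + lb (L i) * y - lc (L i)) * k j) with
      (la (L i) * k j * x + lb (L i) * k j * y - lc (L i) * k j) by ring.
    rewrite Zb, Zc; replace (la (L i) * k j) with (la (L j) * k i) by lra; ring. }
  split; intros Q; [assert ((la (L j) * x + lb (L j) * y - lc (L j)) * k i = 0) as P by (rewrite <- I, Q; ring)|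
    assert ((la (L i) * x + lb (L i) * y - lc (L i)) * k j = 0) as P by (rewrite I, Q; ring)];
  apply Rmult_integral in P; destruct P; [lra|contradiction|lra|contradiction].
- assert (bad i j < r).
  { apply Hr, in_flat_map; exists i; split; [apply in_seq; lia|apply in_map, in_seq; lia]. }
  assert (r = bad i j) by (unfold bad; field_simplify_eq; [lra|exact Z]); lra.
Qed.

(** [psi] is affine, and injective because [e] is positive, so it transports segments and their
    intersections; the drawing keeps only the vertices [f v] and the edges between them. *)
Lemma drawing_of_picture {T : Type} (n : nat) (E : nat -> nat -> Prop) (p ord : list T) EE pos0 (f : nat -> T)
    (psi : point -> point) (r m e : R) :
  simple_graph n E -> planar_picture p ord EE pos0 ->
  (forall v, (v < n)%nat -> In (f v) ord) ->
  (forall u v, (u < n)%nat -> (v < n)%nat -> f u = f v -> u = v) ->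
  (forall u v, E u v -> EE (f u) (f v)) ->
  0 < e -> (forall a, psi a = (r + snd a, m * snd a + e * fst a)) ->
  straight_line_drawing n E (fun v => psi (pos0 (f v))).
Proof.
intros G H Fo Fi FE Pe Hpsi.
assert (inj : forall a b, psi a = psi b -> a = b).
{ intros a b Eq; rewrite !Hpsi in Eq; injection Eq as E1 E2; apply point_eq; nra. }
assert (seg : forall a b c, on_segment (psi a) (psi b) c -> exists d, c = psi d /\ on_segment a b d).
{ intros a b c (t & Ht & C1 & C2).
  exists (fst a + t * (fst b - fst a), snd a + t * (snd b - snd a)); split.
  - apply point_eq; rewrite !Hpsi in *; simpl in *; lra.
  - exists t; simpl; auto. }
assert (ends : forall u v, E u v -> (u < n)%nat /\ (v < n)%nat) by (intros u v; apply (proj1 G)).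
split; [|split].
- intros u v Hu Hv Eq; apply Fi; auto; apply (pic_inj _ _ _ _ H); auto.
- intros u v w Huv Hw nu nv S; destruct (ends u v Huv) as [Lu Lv].
  destruct (seg _ _ _ S) as (c & C1 & C2); apply inj in C1; subst c.
  apply (pic_off _ _ _ _ H (f u) (f v) (f w)); auto.
- intros u v x y c Huv Hxy N S1 S2; destruct (ends u v Huv) as [Lu Lv]; destruct (ends x y Hxy) as [Lx Ly].
  destruct (seg _ _ _ S1) as (c1 & C1 & D1); destruct (seg _ _ _ S2) as (c2 & C2 & D2); subst c.
  apply inj in C2; subst c2.
  destruct (pic_cross _ _ _ _ H (f u) (f v) (f x) (f y) c1) as (w & W1 & W2 & W3); auto.
  { intros [[E1 E2]|[E1 E2]]; apply N; [left|right]; split; apply Fi; auto. }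
  assert (exists z, (z = u \/ z = v) /\ w = f z) as (z & Z1 & ->).
  { destruct W1 as [->| ->]; eauto. }
  assert (Lz : (z < n)%nat) by (destruct Z1; subst; auto).
  exists z; split; [exact Z1|split; [|rewrite W3; reflexivity]].
  destruct W2 as [W2|W2]; apply Fi in W2; auto.
Qed.

Theorem mainTheorem14 (n : nat) (L : nat -> line) (E : nat -> nat -> Prop) :
  (forall i j, (1 <= i <= n)%nat -> (1 <= j <= n)%nat -> i <> j ->
     ~ same_line (L i) (L j)) ->
  simple_graph n E ->
  planar n E ->
  exists pi : nat -> nat, vertex_labelling n pi /\ supports n L E pi.
Proof.
intros HL G P.
destruct (planar_grid_minor n E G P) as (M & lab & lab_bound & lab_all & lab_linked & lab_edge).
destruct (@Discs.grid_minor_stacked M lab) as (T & p & ord & EE & f & st & f_inj & f_ord & f_edge).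
{ intros c v Hc; exact (proj2 (lab_bound c v Hc)). }
{ intros c c' v Hc Hc'.
  exact (lab_linked c c' v Hc Hc'). }
assert (f_inj' : forall u v, (u < n)%nat -> (v < n)%nat -> f u = f v -> u = v).
{ intros u v Hu Hv; destruct (lab_all u Hu) as [c Hc]; destruct (lab_all v Hv) as [c' Hc']; eauto. }
assert (f_ord' : forall v, (v < n)%nat -> In (f v) ord).
{ intros v Hv; destruct (lab_all v Hv) as [c Hc]; eauto. }
assert (f_edge' : forall u v, E u v -> EE (f u) (f v)).
{ intros u v Huv; destruct (lab_edge u v Huv) as (c & c' & Hc & Hc' & A).
  apply (f_edge u v c c'); auto; intros ->; exact (proj2 (proj2 G) v Huv). }
destruct (transversal n L HL) as (r & m & Hk & Ht).
set (k := fun i => la (L i) + lb (L i) * m) in *.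
set (t := fun i => (lc (L i) - la (L i) * r) / k i).
destruct (sort_by t (seq 1 n)) as (is & Pis & Sis).
{ apply seq_NoDup. }
{ intros i j Hi Hj; apply in_seq in Hi, Hj; apply Ht; lia. }
set (special := fun a => exists v, (v < n)%nat /\ f v = a).
destruct (exceed (map t is)) as (ub & _ & Hub).
pose proof (stacked_order_nodup _ _ _ st) as No.
destruct (interleave_heights special t ord No is ub Sis) as (h & lbl & Dh & _ & Hlbl & lbl_inj).
{ intros i Hi; apply Hub, in_map, Hi. }
(* There are as many special vertices as lines: [f] is a bijection from the n vertices of the graph
   onto them. *)
{ rewrite <- (Permutation_length Pis), length_seq.
  replace n with (length (map f (seq 0 n))) at 1 by (rewrite length_map, length_seq; reflexivity).
  assert (Nf : NoDup (map f (seq 0 n))).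
  { apply NoDup_map_NoDup_ForallPairs; [|apply seq_NoDup].
    intros u v Hu Hv; apply in_seq in Hu, Hv; apply f_inj'; lia. }
  apply Nat.le_antisymm; apply NoDup_incl_length; auto using NoDup_filter; intros a Ha.
  - apply in_map_iff in Ha; destruct Ha as (v & <- & Hv); apply in_seq in Hv.
    apply filter_In; split; [apply f_ord'; lia|apply holds_true; exists v; split; [lia|reflexivity]].
  - apply filter_In in Ha; destruct Ha as [_ Ha]; apply (proj1 (holds_true (special a))) in Ha; destruct Ha as (v & Hv & <-).
    apply in_map, in_seq; lia. }
(* In the coordinates (x, y) of the point (r + y, m y + e x), the line [L i] has the equation y = t
   i - e x lb / k i. Its slope is proportional to [e], and it passes through (0, t i). *)
destruct (stacked_realizable p ord EE h (fun a => - lb (L (lbl a)) / k (lbl a)) st Dh) as (D0 & PD & K).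
destruct (gapped_exists D0 p (stacked_nodup _ _ _ st)) as [X HX].
destruct (K X HX) as (xs & _ & e & Pe & Pic).
specialize (Pic e ltac:(lra)).
assert (sp : forall v, (v < n)%nat -> special (f v)) by (intros v Hv; exists v; auto).
assert (range : forall v, (v < n)%nat -> (1 <= lbl (f v) <= n)%nat).
{ intros v Hv; destruct (Hlbl (f v) (f_ord' v Hv) (sp v Hv)) as [I _].
  apply (Permutation_in _ (Permutation_sym Pis)), in_seq in I; lia. }
exists (fun v => lbl (f v)); split; [split|].
- exact range.
- intros u v Hu Hv Eq; apply f_inj'; auto.
- exists (fun v => (fun a => (r + snd a, m * snd a + e * fst a))
      (xs (f v), h (f v) + e * (- lb (L (lbl (f v))) / k (lbl (f v)) * xs (f v)))); split.
  + apply (drawing_of_picture n E p ord EE (fun a => (xs a, h a + e * (- lb (L (lbl a)) / k (lbl a) * xs a))) f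
      (fun a => (r + snd a, m * snd a + e * fst a)) r m e); auto.
  + intros v Hv; destruct (Hlbl (f v) (f_ord' v Hv) (sp v Hv)) as [_ Hh].
    unfold on_line; simpl; rewrite Hh; pose proof (Hk _ (range v Hv)) as Kv.
    unfold t, k in *; field; exact Kv.
Qed.
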